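(* Let $a_1,a_2,a_3\in\mathbb N$ and $w=a_1+a_2+a_3$. The exponential part $\mathcal E(\tau_2)$ of the constant Fourier mode of $C_{a_1,a_2,a_3}$ has the following general structure: there exist rational numbers $f_+(s;n)$, $f_-(s;n)$ and $f(s;n,m)$ (for $1\le s\le w-2$, $n\ge1$, $2-w\le m\le w-3$) such that $$\mathcal E(\tau_2)=\sum_{s=1}^{w-2}\sum_{n=1}^\infty\left(\left(f_+(s;n)(4\pi\tau_2)^s+\frac{f_-(s;n)}{(4\pi\tau_2)^{s-1}}\right)\mathrm{Ei}(4\pi n\tau_2)+e^{-4\pi n\tau_2}\sum_{m=2-w}^{w-3}f(s;n,m)\,(4\pi\tau_2)^m\right).$$
   Context: Here $\mathbb N$ is the set of positive integers and $\tau=\tau_1+i\tau_2$ with $\tau_1\in\mathbb R$, $\tau_2>0$. For $a_1,a_2,a_3\in\mathbb N$, $$C_{a_1,a_2,a_3}(\tau)=\sum\ \prod_{r=1}^{3}\left(\frac{\tau_2}{\pi|m_r+n_r\tau|^2}\right)^{a_r},$$ the absolutely convergent sum being over all $(m_r,n_r)\in\mathbb Z^2\setminus\{(0,0)\}$, $r=1,2,3$, with $m_1+m_2+m_3=0$ and $n_1+n_2+n_3=0$. The constant Fourier mode is $C^{(0)}_{a_1,a_2,a_3}(\tau_2)=\int_0^1C_{a_1,a_2,a_3}(\tau_1+i\tau_2)\,d\tau_1$. It decomposes uniquely as $C^{(0)}_{a_1,a_2,a_3}(\tau_2)=\mathcal L(\tau_2)+\mathcal E(\tau_2)$, where $\mathcal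 L$ is a Laurent polynomial in $\tau_2$ (with powers between $1-w$ and $w$) and $\mathcal E$ is exponentially decaying as $\tau_2\to\infty$; this defines $\mathcal E$. The function $\mathrm{Ei}$ denotes the incomplete $\Gamma$-function $\mathrm{Ei}(x)=\Gamma(0,x)=\int_x^\infty t^{-1}e^{-t}\,dt$ for $x>0$. *)

(* Defs.v *)
From HB Require Import structures.
From mathcomp Require Import all_boot all_order all_algebra.
From mathcomp Require Import zify.
From mathcomp Require Import complex.
From mathcomp Require Import all_classical all_reals all_analysis.
Set Implicit Arguments.
Unset Strict Implicit.
Unset Printing Implicit Defensive.
Import Order.TTheory GRing.Theory Num.Theory.
Import numFieldNormedType.Exports.

Local Open Scope classical_set_scope.
Local Open Scope ring_scope.
Local Open Scope complex_scope.

(* The integers from lo to hi, both included; empty if hi < lo. *)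
Definition zrange (lo hi : int) : seq int :=
  if lo <= hi then [seq lo + k%:Z | k <- iota 0 `|hi - lo|.+1] else [::].

Lemma mem_zrange lo hi m : (m \in zrange lo hi) = (lo <= m <= hi).
Proof.
rewrite /zrange; case: ifP => h; last by rewrite in_nil; lia.
apply/mapP/idP => [[k]|hm]; first by rewrite mem_iota; lia.
by exists `|m - lo|%N; [rewrite mem_iota; lia | lia].
Qed.

Lemma zrange_uniq lo hi : uniq (zrange lo hi).
Proof.
rewrite /zrange; case: ifP => // _.
by rewrite map_inj_uniq ?iota_uniq// => i j /addrI [].
Qed.

Section ModularGraphFunction.
Variable R : realType.
Implicit Types (tau : R[i]) (p : int * int).

(* tau_2 / (pi |m + n tau|^2) for p = (m, n) *)
Definition propagator tau p : R :=
  complex.Im tau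
    / (pi * ComplexField.Normc.normc (p.1%:~R + p.2%:~R * tau) ^+ 2).

Definition momenta : set ((int * int) * (int * int) * (int * int)) :=
  [set p | [/\ p.1.1 != 0, p.1.2 != 0, p.2 != 0
             & p.1.1 + p.1.2 + p.2 = 0]].

(* All terms are nonnegative, so esum is the absolutely convergent sum. *)
Definition C (a1 a2 a3 : nat) tau : R :=
  fine (\esum_(p in momenta)
    (propagator tau p.1.1 ^+ a1 * propagator tau p.1.2 ^+ a2
      * propagator tau p.2 ^+ a3)%:E)%E.

Definition constant_mode (a1 a2 a3 : nat) (t2 : R) : R :=
  Rintegral (@lebesgue_measure R) `[0, 1] (fun t1 => C a1 a2 a3 (t1 +i* t2)).

Definition laurent_poly (lo hi : int) (L : R -> R) : Prop :=
  exists c : int -> R,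
    forall t : R, 0 < t -> L t = \sum_(k <- zrange lo hi) c k * t ^ k.

Definition exponentially_decaying (E : R -> R) : Prop :=
  exists c K : R, 0 < c /\ \forall t \near +oo, `|E t| <= K * expR (- (c * t)).

(* Only the values of E on the half-line t > 0 matter; there the decomposition
   determines E, as a nonzero Laurent polynomial does not decay exponentially. *)
Definition is_exponential_part (a1 a2 a3 : nat) (E : R -> R) : Prop :=
  let w : int := (a1 + a2 + a3)%N in
  exists L : R -> R,
    [/\ laurent_poly (1 - w) w L, exponentially_decaying E
      & forall t : R, 0 < t -> constant_mode a1 a2 a3 t = L t + E t].

(* Gamma(0, x), rather than the principal-value integral of e^t / t that is
   also called Ei. *)
Definition Ei (x : R) : R :=
  Rintegral (@lebesgue_measure R) `[x, +oo[ (fun t => t^-1 * expR (- t)).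

End ModularGraphFunction.

(* Main.v *)
Require Import Defs.
From HB Require Import structures.
From mathcomp Require Import all_boot all_order all_algebra.
From mathcomp Require Import zify ring lra.
From mathcomp Require Import complex polyrcf.
From mathcomp Require Import all_classical all_reals all_analysis measurable_realfun.
(* For fixed (n1, n2) = g (nu1, nu2) with nu primitive, completed to a basis of
   Z^2 by mu, write (m1, m2) = j nu + d mu. Summing over j unfolds the integral
   over tau_1 to one over the whole line. For d <> 0 the integrand has poles
   only at -d mu_r/nu_r +- i g tau_2, so partial fractions and a primitive give
   a rational combination of pi T^(k+1-2w) Re (2 kappa T + i d)^-k, where
   T = g tau_2 and kappa is 0 or plus or minus a product nu_r nu_s. Lipschitz'
   formula for the sum over d turns the terms with kappa <> 0 into powers of
   tau_2 times series in exp(-4 pi N tau_2) with g |kappa| dividing N, plus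
   Laurent terms; no Ei occurs.
   Since |n1|, |n2| <= 2N for the modes contributing to a given N, each
   exponential receives finitely many contributions, and the bounds on the
   partial fraction coefficients are polynomial in N. The Laurent parts of the
   partial sums are t^(1-w) times polynomials of bounded degree, hence so is
   their limit, and exponential decay determines the decomposition. *)

Set Implicit Arguments.
Unset Strict Implicit.
Unset Printing Implicit Defensive.
Import Order.TTheory GRing.Theory Num.Theory.
Import numFieldNormedType.Exports.

Local Open Scope classical_set_scope.
Local Open Scope ring_scope.

(** * Rational functions of T and Y with poles on the lines Y + 2kT = 0 *)

Section CoefficientFunctions.
Variable K : numFieldType.
Implicit Types (T Y : K) (F G : K -> K -> K) (S : pred int).

(** The exponential terms carry the exponents m = k + 1 - w, where k is a pole order in Y. Degree
    counting alone allows k up to 2w - 1, but the range of m in the theorem asks for k <= w - 1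
    whenever kappa is nonzero. Hence the expansion tracks a separate bound [b] on these orders,
    which grows by one per propagator although a propagator is quadratic. Rationality comes from
    matching powers: pi^(1-w) from the prefactor and the line integral, and pi^k from Lipschitz'
    formula, combine to the same power as that of tau_2. Since coefficients of many modes are added,
    every partial fraction step also records a bound [B] on the sum of the absolute values of the
    rational coefficients, uniform in T and d. For the Laurent parts no bound is recorded: their
    partial sums converge at each tau_2 because the full sums and the exponential parts do, and
    polynomials of bounded degree that converge pointwise converge coefficientwise. *)

Definition generic T Y := T != 0 /\ forall k : int, Y + 2 * k%:~R * T != 0.

(** [x] is (coefficient, slope, pole order). The power of T is tied to the pole order, so that every
    term is homogeneous of degree [- h] in (T, Y). *)
Definition coef_term (h : nat) T Y (x : rat * int * nat) : K :=
  ratr x.1.1 * T ^+ x.2 / T ^+ h / (Y + 2 * x.1.2%:~R * T) ^+ x.2.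

Definition admissible S (h b : nat) (x : rat * int * nat) :=
  [&& S x.1.2, (0 < x.2)%N, (x.2 <= h)%N & (x.1.2 != 0) ==> (x.2 <= b)%N].

(* The bound b on the pole order concerns only the poles off Y = 0: the poles
   at Y = 0 will contribute zeta values to the Laurent polynomial. *)
Definition coef S (h b : nat) (B : rat) F :=
  exists s : seq (rat * int * nat),
    [/\ all (admissible S h b) s, \sum_(x <- s) `|x.1.1| <= B
      & forall T Y, generic T Y -> F T Y = \sum_(x <- s) coef_term h T Y x].

Lemma coef_eq S h b B F G : (forall T Y, generic T Y -> F T Y = G T Y) ->
  coef S h b B F -> coef S h b B G.
Proof.
by move=> FG [s [? ? sF]]; exists s; split=> // T Y gTY; rewrite -FG// sF.
Qed.

Lemma coef_weaken S h b b' (B B' : rat) F : (b <= b')%N -> B <= B' ->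
  coef S h b B F -> coef S h b' B' F.
Proof.
move=> bb' BB' [s [adm sB sF]]; exists s; split=> //; last exact: le_trans BB'.
apply: sub_all adm => x /and4P[Sx x0 xh /implyP xb]; apply/and4P; split=> //.
by apply/implyP => /xb /leq_trans; apply.
Qed.

Lemma coef_zero S h b : coef S h b 0 (fun _ _ => 0).
Proof. by exists [::]; rewrite big_nil; split=> // T Y _; rewrite big_nil. Qed.

Lemma coef_add S h b B1 B2 F G : coef S h b B1 F -> coef S h b B2 G ->
  coef S h b (B1 + B2) (fun T Y => F T Y + G T Y).
Proof.
move=> [s [sa sB sF]] [r [ra rB rG]]; exists (s ++ r); split.
- by rewrite all_cat sa.
- by rewrite big_cat lerD.
- by move=> T Y gTY; rewrite big_cat sF// rG.
Qed.

Lemma coef_scale S h b B (q : rat) F : coef S h b B F ->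
  coef S h b (`|q| * B) (fun T Y => ratr q * F T Y).
Proof.
move=> [s [sa sB sF]]; exists [seq (q * x.1.1, x.1.2, x.2) | x <- s]; split.
- by rewrite all_map; apply: sub_all sa => x.
- rewrite big_map /=; under eq_bigr do rewrite normrM.
  by rewrite -mulr_sumr ler_wpM2l.
- move=> T Y gTY; rewrite big_map /= sF// mulr_sumr; apply: eq_bigr => x _.
  by rewrite /coef_term /= rmorphM/= !mulrA.
Qed.

Lemma coef_divT S h b B F : coef S h b B F ->
  coef S h.+1 b B (fun T Y => F T Y / T).
Proof.
move=> [s [sa sB sF]]; exists s; split => //.
  apply: sub_all sa => x /and4P[? ? xh ?]; apply/and4P; split=> //.
  exact: leqW.
move=> T Y gTY; rewrite sF// mulr_suml; apply: eq_bigr => x _.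
by rewrite /coef_term exprS invfM mulrA; ring.
Qed.

Lemma coef_sum S h b (s : seq (rat * int * nat)) (c : rat)
    (F : rat * int * nat -> K -> K -> K) :
  (forall x, x \in s -> coef S h b (c * `|x.1.1|) (F x)) ->
  coef S h b (c * \sum_(x <- s) `|x.1.1|) (fun T Y => \sum_(x <- s) F x T Y).
Proof.
elim: s => [|x s IHs] sF.
  by rewrite big_nil mulr0; apply: coef_eq (coef_zero _ _ _) => T Y _; rewrite big_nil.
rewrite big_cons mulrDr; apply: (@coef_eq _ _ _ _ (fun T Y => F x T Y + \sum_(y <- s) F y T Y)).
  by move=> T Y _; rewrite big_cons.
apply: coef_add; first by apply: sF; rewrite mem_head.
by apply: IHs => y ys; apply: sF; rewrite in_cons ys orbT.
Qed.

Lemma coef_linV S (k : int) : S k ->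
  coef S 1 1 1 (fun T Y => (Y + 2 * k%:~R * T)^-1).
Proof.
move=> Sk; exists [:: (1, k, 1%N)]; split.
- by rewrite /= /admissible Sk/= implybT.
- by rewrite big_seq1.
- move=> T Y [T0 _]; rewrite big_seq1 /coef_term /= rmorph1 !expr1 mul1r.
  by rewrite divff// mul1r.
Qed.

(** With D' = Y + 2k'T, D = Y + 2kT and q = 1/(2(k' - k)) one has T/(D' D) = q (1/D - 1/D'), which
    lowers the power of D' by one. As |q| <= 1, each step adds at most 1 to the bound, whatever the
    slopes are. *)
Lemma coef_term_linV S h b (k k' : int) (m : nat) : S k -> S k' -> (m <= h)%N ->
    ((k' != 0) ==> (m <= b)%N) ->
  coef S h.+1 (b + (k != 0)) m.+1%:R
    (fun T Y => T ^+ m / T ^+ h / (Y + 2 * k'%:~R * T) ^+ m / (Y + 2 * k%:~R * T)).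
Proof.
move=> Sk Sk' mh mb; have [->|kk'] := eqVneq k k'.
  exists [:: (1, k', m.+1)]; split.
  - rewrite /= /admissible Sk' /= ltnS mh andbT /=; apply/implyP => k0.
    by rewrite k0 addn1 ltnS (implyP mb).
  - by rewrite big_seq1 normr1 ler1n.
  - move=> T Y [T0 /(_ k') D0]; rewrite big_seq1 /coef_term /= rmorph1 mul1r.
    rewrite !exprS; field.
    by rewrite D0 !expf_neq0.
elim: m mh mb => [|m IH] mh mb.
  exists [:: (1, k, 1%N)]; split.
  - rewrite /= /admissible Sk /= andbT; apply/implyP => k0.
    by rewrite k0 addn1.
  - by rewrite big_seq1.
  - move=> T Y [T0 /(_ k) D0]; rewrite big_seq1 /coef_term /= rmorph1 mul1r.
    rewrite !exprS !expr0; field.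
    by rewrite D0 T0 !expf_neq0.
have d0 : 2 * (k' - k) != 0 :> int by lia.
set q : rat := (2 * (k' - k))%:~R^-1.
have q1 : `|q| <= 1.
  rewrite /q normfV -intr_norm invf_le1 ?ltr0z ?normr_gt0// (_ : 1 = 1%:~R)// ler_int; lia.
have {}IH := IH (ltnW mh) _.
have mb' : (k' != 0) ==> (m <= b)%N by apply/implyP => k0; apply: ltnW; apply: (implyP mb).
have c1 : coef S h.+1 (b + (k != 0)) 1
    (fun T Y => T ^+ m.+1 / T ^+ h.+1 / (Y + 2 * k'%:~R * T) ^+ m.+1).
  exists [:: (1, k', m.+1)]; split.
  - rewrite /= /admissible Sk' /= ltnS (ltnW mh) andbT /=; apply/implyP => k0.
    by rewrite (leq_trans (implyP mb k0))// leq_addr.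
  - by rewrite big_seq1.
  - by move=> T Y _; rewrite big_seq1 /coef_term /= rmorph1 mul1r.
have := coef_add (coef_scale q (IH mb')) (coef_scale (- q) c1).
set F := (F in coef _ _ _ _ F) => cF.
apply: (@coef_eq _ _ _ _ F); last first.
  apply: coef_weaken cF => //.
  by rewrite normrN -mulrDr natr1 ler_piMl.
move=> T Y [T0 D0]; have := D0 k; have := D0 k'.
have qE : (ratr q : K) = (2 * (k'%:~R - k%:~R))^-1.
  by rewrite /q fmorphV rmorph_int intrM intrB.
have qd0 : k'%:~R - k%:~R != 0 :> K by rewrite -intrB intr_eq0; lia.
rewrite /F rmorphN/= qE !exprS => D'0 Dk0.
field.
rewrite qd0 T0 D'0 Dk0 !expf_neq0//=.
Qed.

Lemma coef_div_lin S h b B (k : int) F : S k -> coef S h b B F ->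
  coef S h.+1 (b + (k != 0)) (h.+1%:R * B) (fun T Y => F T Y / (Y + 2 * k%:~R * T)).
Proof.
move=> Sk [s [sa sB sF]].
have : coef S h.+1 (b + (k != 0)) (h.+1%:R * \sum_(x <- s) `|x.1.1|)
  (fun T Y => \sum_(x <- s) coef_term h T Y x / (Y + 2 * k%:~R * T)).
  apply: coef_sum => x /(allP sa) /and4P[Sx x0 xh xb].
  have /(coef_scale x.1.1) := coef_term_linV Sk Sx xh xb.
  set G := (G in coef _ _ _ _ G) => cG; apply: (@coef_eq _ _ _ _ G).
    by move=> T Y _; rewrite /G/coef_term !mulrA.
  apply: coef_weaken cG => //; rewrite mulrC ler_wpM2r// ler_nat.
  exact: xh.
move=> cs; apply: coef_weaken (leqnn _) _ (coef_eq _ cs).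
  by rewrite ler_wpM2l.
by move=> T Y gTY; rewrite sF// mulr_suml.
Qed.

End CoefficientFunctions.

(** * Partial fractions in xi of a product of propagators, with coefficient bounds *)

Section RowExpansion.
Variables (K : numFieldType) (I : eqType) (nu mu : I -> int) (S : pred int).
Variable Q : nat.
Hypotheses (S0 : S 0) (Q1 : (0 < Q)%N).
Hypothesis unimodular : forall r s, r != s -> absz (nu r * mu s - nu s * mu r)%R = 1%N.
Hypothesis S_prod : forall r s, r != s -> nu r != 0 -> nu s != 0 ->
  S (nu r * nu s) /\ S (- (nu r * nu s)).
Hypothesis Q_prod : forall r s, r != s -> (absz (nu r * nu s)%R <= Q)%N.
Implicit Types (T Y xi : K) (j : I * bool).

Definition pole j T Y : K := - ((mu j.1)%:~R / (nu j.1)%:~R) * Y + (-1) ^+ j.2 * T.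

(** For Y = -id and xi = -ix this is (nu x + mu d)^2 + nu^2 T^2, the denominator of a propagator in
    the unfolded coordinates. *)
Definition row r T Y xi : K :=
  (nu r)%:~R ^+ 2 * T ^+ 2 - ((nu r)%:~R * xi + (mu r)%:~R * Y) ^+ 2.

Definition regular T Y xi :=
  generic T Y /\ forall j, nu j.1 != 0 -> xi - pole j T Y != 0.

(* Every summand is homogeneous of degree -H in (T, Y, xi). *)
Inductive pole_sum (b H : nat) : rat -> (K -> K -> K -> K) -> Prop :=
| PoleTerm j m h c B F : nu j.1 != 0 -> (0 < m)%N -> (h + m)%N = H -> (c + m <= b)%N ->
    coef S h c B F ->
    pole_sum b H B (fun T Y xi => F T Y / (xi - pole j T Y) ^+ m)
| PoleAdd B1 B2 P1 P2 : pole_sum b H B1 P1 -> pole_sum b H B2 P2 ->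
    pole_sum b H (B1 + B2) (fun T Y xi => P1 T Y xi + P2 T Y xi)
| PoleEq B B' P P' : B <= B' -> (forall T Y xi, regular T Y xi -> P T Y xi = P' T Y xi) ->
    pole_sum b H B P -> pole_sum b H B' P'.

Lemma pole_sum_ge0 b H B P : pole_sum b H B P -> 0 <= B.
Proof.
elim=> [j m h c B' F _ _ _ _ [s [_ + _]]|B1 B2 P1 P2 _ + _|B1 B2 P1 P2 + _ _].
- by apply: le_trans; apply: sumr_ge0.
- exact: addr_ge0.
- by move=> le12 B10; apply: le_trans le12.
Qed.

Lemma pole_sum_weaken b b' H B P : (b <= b')%N -> pole_sum b H B P -> pole_sum b' H B P.
Proof.
move=> bb'; elim=> {B P}[j m h c B F *|B1 B2 P1 P2 _ ? _|B1 B2 P1 P2 ? P12 _].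
- by apply: (PoleTerm (h := h) (c := c)) => //; apply: leq_trans bb'.
- exact: PoleAdd.
- exact: PoleEq.
Qed.

Lemma pole_sumZ b H (q : rat) B P : pole_sum b H B P ->
  pole_sum b H (`|q| * B) (fun T Y xi => ratr q * P T Y xi).
Proof.
elim=> {B P}[j m h c B F nj m0 hm cm cF|B1 B2 P1 P2 _ IH1 _ IH2|B1 B2 P1 P2 B12 P12 _ IH].
- apply: PoleEq (PoleTerm nj m0 hm cm (coef_scale q cF)) => // T Y xi _.
  by rewrite mulrA.
- by rewrite mulrDr; apply: PoleEq (PoleAdd IH1 IH2) => // T Y xi _; rewrite mulrDr.
- by apply: PoleEq IH => [|T Y xi /P12->//]; rewrite ler_wpM2l.
Qed.

Lemma pole_sum_divT b H B P : pole_sum b H B P ->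
  pole_sum b H.+1 B (fun T Y xi => P T Y xi / T).
Proof.
elim=> {B P}[j m h c B F nj m0 hm cm cF|B1 B2 P1 P2 _ IH1 _ IH2|B1 B2 P1 P2 B12 P12 _ IH].
- apply: PoleEq (PoleTerm (h := h.+1) nj m0 _ cm (coef_divT cF)) => //.
    by move=> T Y xi _; rewrite mulrAC.
  by rewrite addSn hm.
- by apply: PoleEq (PoleAdd IH1 IH2) => // T Y xi _; rewrite mulrDl.
- by apply: PoleEq IH => // T Y xi /P12->.
Qed.

(** Y is the linear form of slope 0, whose pole order is not counted by [b]; only the bound on the
    coefficients grows. *)
Lemma pole_sum_divY b H B P : pole_sum b H B P ->
  pole_sum b H.+1 (H%:R * B) (fun T Y xi => P T Y xi / Y).
Proof.
elim=> {B P}[j m h c B F nj m0 hm cm cF|B1 B2 P1 P2 _ IH1 _ IH2|B1 B2 P1 P2 B12 P12 _ IH].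
- have B0 : 0 <= B by case: cF => s [_ + _]; apply: le_trans; apply: sumr_ge0.
  have := coef_div_lin S0 cF; rewrite eqxx addn0 => cF'.
  apply: PoleEq (PoleTerm (h := h.+1) nj m0 _ cm cF').
  + by rewrite ler_wpM2r// ler_nat; lia.
  + by move=> T Y xi _; rewrite mulr0 mul0r addr0 mulrAC.
  + by rewrite addSn hm.
- by rewrite mulrDr; apply: PoleEq (PoleAdd IH1 IH2) => // T Y xi _; rewrite mulrDl.
- by apply: PoleEq IH => [|T Y xi /P12->//]; rewrite ler_wpM2l.
Qed.

(** The coefficient of Y in the difference has numerator nu_r mu_s - nu_s mu_r, which is a sign by
    unimodularity. Clearing the denominator leaves Y + 2kT with k equal to 0 or plus or minus nu_r
    nu_s: this is the origin of the slopes kappa. *)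
Lemma pole_sub i j : nu i.1 != 0 -> nu j.1 != 0 -> i.1 != j.1 ->
  exists sg k : int, [/\ sg ^+ 2 = 1, S k & forall T Y,
    (pole i T Y - pole j T Y)^-1 =
      (sg * (nu i.1 * nu j.1))%:~R / (Y + 2 * k%:~R * T)].
Proof.
case: i j => [r e] [s f] /= nr ns rs.
pose sg : int := nu r * mu s - nu s * mu r.
have sg1 : sg ^+ 2 = 1 by have := unimodular rs; rewrite -/sg; nia.
have kE : exists k : int, S k /\ 2 * k%:~R = sg%:~R * (nu r * nu s)%:~R * ((-1) ^+ e - (-1) ^+ f) :> K.
  have [Sp Sm] := S_prod rs nr ns.
  have : sg = 1 \/ sg = - 1 by nia.
  case: e f => [] [] /= [->|->].
  - by exists 0; split=> //; rewrite subrr !mulr0.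
  - by exists 0; split=> //; rewrite subrr !mulr0.
  - by exists (- (nu r * nu s)); split=> //; rewrite mulrNz; ring.
  - by exists (nu r * nu s); split=> //; rewrite !mulrNz; ring.
  - by exists (nu r * nu s); split=> //; ring.
  - by exists (- (nu r * nu s)); split=> //; rewrite !mulrNz; ring.
  - by exists 0; split=> //; rewrite subrr !mulr0.
  - by exists 0; split=> //; rewrite subrr !mulr0.
have [k [Sk kE']] := kE; exists sg, k; split=> // T Y; rewrite kE' /pole /=.
have nr' : (nu r)%:~R != 0 :> K by rewrite intr_eq0.
have ns' : (nu s)%:~R != 0 :> K by rewrite intr_eq0.
have sg0 : sg%:~R ^+ 2 = 1 :> K by rewrite -rmorphXn sg1.
have sgE : sg%:~R = (nu r)%:~R * (mu s)%:~R - (nu s)%:~R * (mu r)%:~R :> K.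
  by rewrite intrB !intrM.
have sgn0 : sg%:~R != 0 :> K by rewrite -sqrf_eq0 sg0 oner_eq0.
have sgV : (sg%:~R)^-1 = sg%:~R :> K by apply: (mulfI sgn0); rewrite divff// -expr2 sg0.
rewrite -[LHS]invrK -[RHS]invrK; congr (_^-1); rewrite !invrK invfM invrK intrM invfM sgV intrM invfM.
transitivity ((sg%:~R / ((nu r)%:~R * (nu s)%:~R)) * Y + sg%:~R ^+ 2 * ((-1) ^+ e - (-1) ^+ f) * T); last first.
  by field; rewrite nr' ns'.
by rewrite sg0 sgE; field; rewrite nr' ns'.
Qed.

Lemma coef_div_pole i j h b B F : nu i.1 != 0 -> nu j.1 != 0 -> i != j ->
    coef S h b B F ->
  coef S h.+1 b.+1 ((Q * h.+1)%:R * B) (fun T Y => F T Y / (pole i T Y - pole j T Y)).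
Proof.
move=> ni nj ij cF.
have B0 : 0 <= B by case: cF => s [_ + _]; apply: le_trans; apply: sumr_ge0.
have [ij1|ij1] := eqVneq i.1 j.1.
  (* The two poles of one row differ by [2 * T] up to sign, so this case is a division by T. *)
  case: i j ij1 ij ni nj => [r e] [s f] /= <- ij nr _.
  have ef : f = ~~ e by move: ij; rewrite xpair_eqE eqxx /=; case: e f => [] [].
  apply: (@coef_eq _ _ _ _ _ (fun T Y => ratr ((-1) ^+ e / 2) * (F T Y / T))).
    move=> T Y [T0 _]; have nr' : (nu r)%:~R != 0 :> K by rewrite intr_eq0.
    rewrite /pole /= ef rmorphM/= fmorphV rmorphXn/= rmorphN rmorph1 rmorph_nat.
    have -> : (-1) ^+ (~~ e) = - (-1) ^+ e :> K.
      by case: (e); rewrite expr0 expr1 ?opprK.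
    have : (-1) ^+ e != 0 :> K by rewrite signr_eq0.
    move: (sqrr_sign K e); move: ((-1) ^+ e : K) => x x2 x0.
    have xV : x = x^-1 by apply: (mulfI x0); rewrite divff// -expr2 x2.
    rewrite [X in _ = _ / X](_ : _ = x * (2 * T)); last by ring.
    by rewrite !invfM -xV; ring.
  apply: coef_weaken (coef_scale _ (coef_divT cF)) => //.
  rewrite ler_wpM2r// normrM normr_sign mul1r normfV ger0_norm//.
  by rewrite (@le_trans _ _ 1)// ?ler1n ?muln_gt0 ?Q1// invf_le1// ler1n.
have [sg [k [sg1 Sk polesE]]] := pole_sub ni nj ij1.
have nn : `|(nu i.1 * nu j.1)%:~R : rat| <= Q%:R.
  by rewrite -intr_norm -[Q%:R]/(Q%:~R) ler_int; have := Q_prod ij1; lia.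
apply: (@coef_eq _ _ _ _ _ (fun T Y =>
    ratr (sg * (nu i.1 * nu j.1))%:~R * (F T Y / (Y + 2 * k%:~R * T)))).
  by move=> T Y _; rewrite rmorph_int polesE; ring.
apply: coef_weaken (coef_scale _ (coef_div_lin Sk cF)).
  by case: (k != 0); rewrite ?addn1 ?addn0.
rewrite natrM -mulrA ler_wpM2r ?mulr_ge0// intrM normrM.
have -> : `|sg%:~R : rat| = 1.
  by rewrite -intr_norm; have -> : `|sg| = 1 by nia.
by rewrite mul1r.
Qed.

Lemma pole_neq i j T Y : nu i.1 != 0 -> nu j.1 != 0 -> i != j -> generic T Y ->
  pole i T Y - pole j T Y != 0.
Proof.
move=> ni nj ij [T0 D0]; have [ij1|ij1] := eqVneq i.1 j.1.
  case: i j ij1 ij ni nj => [r e] [s f] /= <- ij nr _.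
  have ef : f = ~~ e by move: ij; rewrite xpair_eqE eqxx /=; case: e f => [] [].
  have T2 : 2 * T != 0 by rewrite mulf_neq0// pnatr_eq0.
  rewrite /pole /= ef opprD addrACA subrr add0r.
  case: (e); rewrite /= expr0 expr1 mulN1r mul1r.
    by rewrite -opprD oppr_eq0 -mulr2n -mulr_natl.
  by rewrite opprK -mulr2n -mulr_natl.
have [sg [k [sg1 Sk /(_ T Y) polesE]]] := pole_sub ni nj ij1.
rewrite -invr_eq0 polesE mulf_neq0 ?invr_eq0// intr_eq0 !mulf_neq0//.
by apply/eqP => sg0; rewrite sg0 in sg1.
Qed.

(** With poles p_i and p_j, 1/((xi - p_j)(xi - p_i)) = (1/(xi - p_i) - 1/(xi - p_j))/(p_i - p_j)
    lowers the order at p_j. Each step doubles the terms and costs a factor [Q * h.+1] with h <= H;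
    hence the base [2 * Q * H.+1]. *)
Lemma pole_term_div i j h b B F m : nu i.1 != 0 -> nu j.1 != 0 -> i != j ->
    coef S h b B F ->
  forall H (m0 : (0 < m)%N) (hm : (h + m)%N = H),
  pole_sum (b + m).+1 H.+1 (((2 * Q * H.+1) ^ m)%:R * B)
    (fun T Y xi => F T Y / (xi - pole j T Y) ^+ m / (xi - pole i T Y)).
Proof.
move=> ni nj ij; elim: m h b B F => // m IH h b B F cF H _ hm.
have ji : j != i by rewrite eq_sym.
have B0 : 0 <= B by case: cF => s [_ + _]; apply: le_trans; apply: sumr_ge0.
have cG := coef_div_pole ni nj ij cF; set G := (G in coef _ _ _ _ G) in cG.
have tX : pole_sum (b + m.+1).+1 H.+1 (`|-1| * ((Q * h.+1)%:R * B))
    (fun T Y xi => ratr (-1) * (G T Y / (xi - pole j T Y) ^+ m.+1)).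
  apply: pole_sumZ; apply: (PoleTerm (h := h.+1) (c := b.+1)) => //.
    by rewrite addSn hm.
have tZ : pole_sum (b + m.+1).+1 H.+1 (((2 * Q * H.+1) ^ m * (Q * h.+1))%:R * B)
    (fun T Y xi => G T Y / (xi - pole j T Y) ^+ m / (xi - pole i T Y)).
  case: m IH hm tX => [|m] IH hm _.
    apply: PoleEq (PoleTerm (j := i) (m := 1) (h := h.+1) (c := b.+1) ni _ _ _ cG) => //.
    - by rewrite mul1n.
    - by move=> T Y xi _; rewrite expr0 divr1 expr1.
    - by rewrite addSn hm.
  have := IH h.+1 b.+1 _ _ cG H isT; rewrite addSnnS => /(_ hm).
  by rewrite addSnnS mulrA -natrM.
apply: PoleEq (PoleAdd tZ tX).
  rewrite normrN1 mul1r -mulrDl ler_wpM2r// -natrD ler_nat.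
  have hH : (h.+1 <= H.+1)%N by lia.
  have := expn_gt0 (2 * Q * H.+1) m; rewrite !muln_gt0 Q1 /= expnS => p0.
  have := leq_mul (leqnn (Q * (2 * Q * H.+1) ^ m)) hH; nia.
move=> T Y xi [reg1 reg]; rewrite /G rmorphN1.
have ri := reg _ ni; have rj := reg _ nj.
have pij : pole i T Y - pole j T Y != 0.
  exact: pole_neq ni nj ij reg1.
rewrite exprS; field.
by rewrite pij ri rj expf_neq0.
Qed.

(** The order m in [pole_term_div] is at most H, so the exponent H serves all pole orders at
    once. *)
Definition step_cost H : nat := (2 * Q * H.+1) ^ H.

Lemma pole_sum_div i b H B P : nu i.1 != 0 -> pole_sum b H B P ->
  pole_sum b.+1 H.+1 ((step_cost H)%:R * B) (fun T Y xi => P T Y xi / (xi - pole i T Y)).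
Proof.
move=> ni; elim=> {B P}[j m h c B F nj m0 hm cm cF|B1 B2 P1 P2 _ IH1 _ IH2|B1 B2 P1 P2 B12 P12 _ IH].
- have B0 : 0 <= B by case: cF => s [_ + _]; apply: le_trans; apply: sumr_ge0.
  have base0 : (0 < 2 * Q * H.+1)%N by rewrite !muln_gt0 Q1.
  have [ij|ij] := eqVneq i j.
    apply: PoleEq (PoleTerm (m := m.+1) (H := H.+1) (b := b.+1) nj _ _ _ cF) => //.
    + by rewrite ler_peMl// ler1n expn_gt0 base0.
    + by move=> T Y xi _; rewrite ij exprS invfM mulrA mulrAC.
    + by rewrite addnS hm.
    + by rewrite addnS.
  apply: PoleEq (pole_sum_weaken _ (pole_term_div ni nj ij cF m0 hm)) => //.
  by rewrite ler_wpM2r// ler_nat leq_pexp2l//; lia.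
- by rewrite mulrDr; apply: PoleEq (PoleAdd IH1 IH2) => // T Y xi _; rewrite mulrDl.
- by apply: PoleEq IH => [|T Y xi /P12->//]; rewrite ler_wpM2l.
Qed.

Lemma row_factor r T Y xi : nu r != 0 -> regular T Y xi ->
  (row r T Y xi)^-1 = ratr (2 * (nu r)%:~R ^+ 2)^-1 *
    (((xi - pole (r, true) T Y)^-1 - (xi - pole (r, false) T Y)^-1) / T).
Proof.
move=> nr [[T0 _] reg]; have := reg (r, true) nr; have := reg (r, false) nr.
rewrite /pole /= expr0 expr1.
have nr' : (nu r)%:~R != 0 :> K by rewrite intr_eq0.
set A := xi - _; set B := xi - _ => A0 B0.
have -> : row r T Y xi = (nu r)%:~R ^+ 2 * - (A * B).
  by rewrite /row /A /B; field.
rewrite fmorphV rmorphM/= rmorphXn/= rmorph_int rmorph_nat.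
have -> : B^-1 - A^-1 = (A - B) / (A * B) by field; rewrite A0 B0.
have -> : A - B = - 2 * T by rewrite /A /B; ring.
by field; rewrite A0 B0 nr' T0.
Qed.

(** A row has two poles, which doubles the cost of a division; the prefactor 1/(2 nu^2) in
    [row_factor] compensates for this. *)
Lemma half_sqr_le (n : int) : n != 0 -> `|(2 * n%:~R ^+ 2)^-1 : rat| * 2 <= 1.
Proof.
move=> n0; rewrite normfV normrM normrX -intr_norm (ger0_norm (ler0n _ _)) invfM mulrAC mulVf//.
rewrite mul1r invf_le1 ?exprn_ege1//.
  by rewrite (_ : 1 = 1%:~R)// ler_int; lia.
by rewrite exprn_gt0// ltr0z; lia.
Qed.

Lemma pole_sum_div_row r b H B P : nu r != 0 -> pole_sum b H B P ->
  pole_sum b.+1 H.+2 ((step_cost H)%:R * B) (fun T Y xi => P T Y xi / row r T Y xi).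
Proof.
move=> nr pP; have B0 := pole_sum_ge0 pP.
have d1 := @pole_sum_div (r, true) _ _ _ _ nr pP.
have d2 := pole_sumZ (-1) (@pole_sum_div (r, false) _ _ _ _ nr pP).
have := pole_sumZ (2 * (nu r)%:~R ^+ 2)^-1 (pole_sum_divT (PoleAdd d1 d2)).
apply: PoleEq => [|T Y xi reg].
  rewrite normrN1 mul1r; have := half_sqr_le nr; move: (`|_|) => x x2.
  have : 0 <= (step_cost H)%:R * B by rewrite mulr_ge0.
  move: (_ * B) => y y0; nra.
rewrite (row_factor nr reg) rmorphN1; ring.
Qed.

(** Here the row equals -Y^2, so no new pole in xi arises and Y is divided out twice. *)
Lemma pole_sum_div_zero_row r b H B P : nu r = 0 -> absz (mu r) = 1%N ->
  pole_sum b H B P ->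
  pole_sum b H.+2 ((H.+1 * H)%:R * B) (fun T Y xi => P T Y xi / row r T Y xi).
Proof.
move=> nr mr pP.
have := pole_sumZ (-1) (pole_sum_divY (pole_sum_divY pP)).
apply: PoleEq => [|T Y xi reg]; first by rewrite normrN1 mul1r mulrA natrM.
have m2 : (mu r)%:~R ^+ 2 = 1 :> K.
  by rewrite -rmorphXn (_ : mu r ^+ 2 = 1)//; nia.
rewrite /row nr mulr0z !mul0r expr0n /= mul0r !add0r exprMn m2 mul1r rmorphN1.
by rewrite invrN expr2 invfM; ring.
Qed.

Lemma pole_sum_div_rows (s : seq I) V b H B P :
    (forall r, nu r = 0 -> absz (mu r) = 1%N) -> (step_cost (H + 2 * size s) <= V)%N ->
  pole_sum b H B P ->
  pole_sum (b + size s) (H + 2 * size s) ((V ^ size s)%:R * B)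
    (fun T Y xi => P T Y xi / \prod_(r <- s) row r T Y xi).
Proof.
move=> mu1; elim: s b H B P => [|r s IH] b H B P /= HV pP.
  rewrite addn0 muln0 addn0 expn0.
  by apply: PoleEq pP => [|T Y xi _]; rewrite ?mul1r// big_nil divr1.
have B0 := pole_sum_ge0 pP.
(* Both kinds of step cost at most V, because [step_cost] is increasing and V bounds it at the final
   homogeneity. *)
have mono : (step_cost H <= V)%N /\ (H.+1 * H <= V)%N.
  have base H' : (0 < 2 * Q * H'.+1)%N by rewrite !muln_gt0 Q1.
  have H2 : (H.+2 <= H + 2 * (size s).+1)%N by lia.
  have le1 : (step_cost H.+2 <= V)%N.
    apply: leq_trans HV; rewrite /step_cost.
    apply: (@leq_trans ((2 * Q * H.+3) ^ (H + 2 * (size s).+1))).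
      by apply: leq_pexp2l; [exact: base|lia].
    by rewrite leq_exp2r; [rewrite leq_mul2l; lia|lia].
  split; apply: leq_trans le1; rewrite /step_cost.
    apply: (@leq_trans ((2 * Q * H.+1) ^ H.+2)); first by apply: leq_pexp2l; [exact: base|lia].
    by rewrite leq_exp2r//; rewrite leq_mul2l; lia.
  apply: (@leq_trans ((2 * Q * H.+3) ^ 2)); last by apply: leq_pexp2l; [exact: base|lia].
  by rewrite expnS expn1 leq_mul//; nia.
have step : pole_sum b.+1 H.+2 (V%:R * B) (fun T Y xi => P T Y xi / row r T Y xi).
  have [nr|nr] := eqVneq (nu r) 0.
    apply: PoleEq (pole_sum_weaken (leqnSn _) (pole_sum_div_zero_row nr (mu1 _ nr) pP)) => //.
    by rewrite ler_wpM2r// ler_nat; case: mono.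
  apply: PoleEq (pole_sum_div_row nr pP) => //.
  by rewrite ler_wpM2r// ler_nat; case: mono.
have := IH _ _ _ _ _ step.
have -> : (H.+2 + 2 * size s = H + 2 * (size s).+1)%N by lia.
move=> /(_ HV); rewrite addSnnS; apply: PoleEq => [|T Y xi _].
  by rewrite mulrA -natrM expnS mulnC.
by rewrite big_cons invfM mulrA.
Qed.

(** The expansion starts from two rows. A single row would have coefficients proportional to 1/T,
    without a pole in Y, and their sum over d would diverge; for two distinct rows the difference of
    the poles supplies the factor 1/(Y + 2kT). *)
Lemma pole_pair i j : nu i.1 != 0 -> nu j.1 != 0 -> i.1 != j.1 ->
  pole_sum 2 2 (2 * Q%:R)
    (fun T Y xi => (xi - pole i T Y)^-1 / (xi - pole j T Y)).
Proof.
move=> ni nj ij.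
have [sg [k [sg1 Sk polesE]]] := pole_sub ni nj ij.
have nn : `|(sg * (nu i.1 * nu j.1))%:~R : rat| <= Q%:R.
  rewrite -intr_norm -[Q%:R]/(Q%:~R) ler_int normrM.
  have -> : `|sg| = 1 by nia.
  by rewrite mul1r; have := Q_prod ij; lia.
have cv := coef_scale (sg * (nu i.1 * nu j.1))%:~R (coef_linV K Sk).
have ti := @PoleTerm 2 2 i 1 1 1 _ _ ni isT erefl isT cv.
have tj := pole_sumZ (-1) (@PoleTerm 2 2 j 1 1 1 _ _ nj isT erefl isT cv).
apply: PoleEq (PoleAdd ti tj) => [|T Y xi [gTY reg]].
  by rewrite normrN1 mul1r mulr1 mulr_natl -mulr2n lerMn2r.
have ij' : i != j by apply: contra ij => /eqP->.
have := pole_neq ni nj ij' gTY; have := reg _ ni; have := reg _ nj.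
rewrite rmorph_int -polesE rmorphN1 !expr1.
set A := xi - _; set B := xi - _ => A0 B0.
have -> : pole i T Y - pole j T Y = A - B by rewrite /A /B; ring.
by move=> AB0; field; rewrite A0 B0 AB0.
Qed.

Lemma pole_sum_two_rows r s : nu r != 0 -> nu s != 0 -> r != s ->
  pole_sum 2 4 (2 * Q%:R) (fun T Y xi => (row r T Y xi * row s T Y xi)^-1).
Proof.
move=> nr ns rs.
have pr e f := @pole_pair (r, e) (s, f) nr ns rs.
have p4 := PoleAdd (PoleAdd (pr true true) (pole_sumZ (-1) (pr true false)))
  (PoleAdd (pole_sumZ (-1) (pr false true)) (pr false false)).
have := pole_sumZ ((2 * (nu r)%:~R ^+ 2)^-1 * (2 * (nu s)%:~R ^+ 2)^-1)
  (pole_sum_divT (pole_sum_divT p4)).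
apply: PoleEq => [|T Y xi reg].
  have := ler_pM (mulr_ge0 (normr_ge0 _) (ler0n _ 2)) (mulr_ge0 (normr_ge0 _) (ler0n _ 2))
    (half_sqr_le nr) (half_sqr_le ns).
  rewrite normrM normrN1 !mul1r.
  move: (`|_^-1|) => x; move: (`|_^-1|) => y h.
  have Q0 : 0 <= Q%:R :> rat by [].
  nra.
rewrite [RHS]invfM (row_factor nr reg) (row_factor ns reg) rmorphM/= rmorphN1; ring.
Qed.

Lemma pole_sum_rows (s : seq I) r r' :
    (forall r, nu r = 0 -> absz (mu r) = 1%N) ->
    nu r != 0 -> nu r' != 0 -> r != r' -> r \in s -> r' \in s ->
  pole_sum (size s) (2 * size s) (step_cost (2 * size s) ^ size s)%:R
    (fun T Y xi => (\prod_(k <- s) row k T Y xi)^-1).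
Proof.
move=> mu1 nr nr' rr' rs r's.
have r's' : r' \in rem r s by rewrite rem_mem// eq_sym.
set s' := rem r' (rem r s); set V := step_cost _.
have sz : size s = (size s').+2.
  rewrite (perm_size (perm_to_rem rs)) /= (perm_size (perm_to_rem r's')) //.
have szE : (4 + 2 * size s' = 2 * size s)%N by rewrite sz; lia.
have := @pole_sum_div_rows s' V _ _ _ _ mu1 _ (pole_sum_two_rows nr nr' rr').
rewrite szE => /(_ (leqnn _)); rewrite add2n -sz; apply: PoleEq => [|T Y xi _].
  have QV : (2 * Q <= V)%N.
    rewrite /V /step_cost; apply: (@leq_trans ((2 * Q * (2 * size s).+1) ^ 1)).
      by rewrite expn1 leq_pmulr.
    by apply: leq_pexp2l; rewrite ?muln_gt0 ?Q1// sz; lia.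
  have V1 : (0 < V)%N by apply: leq_trans QV; rewrite muln_gt0 Q1.
  rewrite -[2]/(2%:R) -!natrM ler_nat sz !expnS [leqLHS]mulnC mulnA leq_mul2r.
  by apply/orP; right; apply: leq_trans QV _; rewrite leq_pmull.
by rewrite (big_rem r rs) /= (big_rem r' r's') /= mulrA -invfM.
Qed.

End RowExpansion.

(** * Derivatives of the real functions that occur in primitives *)

Section RealDerivatives.
Variable R : realType.
Implicit Types (f g : R -> R) (x c e : R).

Lemma derD f g x a b : is_derive x (1:R) f a -> is_derive x (1:R) g b ->
  is_derive x (1:R) (fun y => f y + g y) (a + b).
Proof. by move=> fa gb; exact: is_deriveD. Qed.

Lemma derM f g x a b : is_derive x (1:R) f a -> is_derive x (1:R) g b ->
  is_derive x (1:R) (fun y => f y * g y) (a * g x + f x * b).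
Proof.
by move=> fa gb; apply: is_derive_eq (is_deriveM fa gb) _; rewrite addrC [_ *: a]mulrC.
Qed.

Lemma derZ f x (k a : R) : is_derive x (1:R) f a ->
  is_derive x (1:R) (fun y => k * f y) (k * a).
Proof. by move=> fa; exact: is_deriveZ. Qed.

Lemma derV f x a : f x != 0 -> is_derive x (1:R) f a ->
  is_derive x (1:R) (fun y => (f y)^-1) (- a / f x ^+ 2).
Proof.
move=> fx fa; apply: is_derive_eq (is_deriveV fx fa) _.
by rewrite /GRing.scale /= mulNr mulrC mulNr.
Qed.

Lemma der_shift x c : is_derive x (1:R) (fun y => y + c) 1.
Proof.
apply: is_derive_eq (is_deriveD (is_derive_id x 1) (is_derive_cst c x 1)) _.
by rewrite addr0.
Qed.

Lemma der_sqr_shift x c e : is_derive x (1:R) (fun y => e + (y + c) ^+ 2) (2 * (x + c)).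
Proof.
have s := der_shift x c.
apply: is_derive_eq (is_deriveD (is_derive_cst e x 1) (derM s s)) _.
by rewrite add0r; ring.
Qed.

Lemma der_atan x c e : e != 0 ->
  is_derive x (1:R) (fun y => atan ((y + c) / e)) (e / (e ^+ 2 + (x + c) ^+ 2)).
Proof.
move=> e0.
have s : is_derive x (1:R) (fun y => (y + c) / e) e^-1.
  apply: is_derive_eq (derM (der_shift x c) (is_derive_cst e^-1 x 1)) _.
  by rewrite mul1r mulr0 addr0.
apply: is_derive_eq (is_derive1_comp (is_derive1_atan _) s) _.
have n0 : e ^+ 2 + (x + c) ^+ 2 != 0.
  by rewrite gt_eqF// ltr_wpDr ?sqr_ge0// exprn_even_gt0.
have [y yE] : exists y : R, y = x + c by exists (x + c).
rewrite -yE in n0 *; rewrite [LHS]mulrC.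
have -> : 1 + (y / e) ^+ 2 = (e ^+ 2 + y ^+ 2) / e ^+ 2 by field.
by field; rewrite e0 n0.
Qed.

Lemma der_ln x c e : 0 < e ->
  is_derive x (1:R) (fun y => ln (e + (y + c) ^+ 2)) (2 * (x + c) / (e + (x + c) ^+ 2)).
Proof.
move=> e0; have n0 : 0 < e + (x + c) ^+ 2 by rewrite ltr_wpDr ?sqr_ge0.
apply: is_derive_eq (@is_derive1_comp _ (@ln R) (fun y => e + (y + c) ^+ 2) _ _ _ (is_derive1_ln n0) (der_sqr_shift x c e)) _.
by rewrite mulrC.
Qed.

End RealDerivatives.

(** * Complex-valued functions of a real variable, by real and imaginary parts *)

Section ComplexValued.
Variable R : realType.
Local Notation CR := R[i].
Local Open Scope complex_scope.
Implicit Types (f g : R -> CR) (z w : CR).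

Lemma cReD z w : complex.Re (z + w) = complex.Re z + complex.Re w.
Proof. by case: z w => [? ?] [? ?]. Qed.

Lemma cImD z w : complex.Im (z + w) = complex.Im z + complex.Im w.
Proof. by case: z w => [? ?] [? ?]. Qed.

Lemma cReM z w : complex.Re (z * w) =
  complex.Re z * complex.Re w - complex.Im z * complex.Im w.
Proof. by case: z w => [? ?] [? ?]. Qed.

Lemma cImM z w : complex.Im (z * w) =
  complex.Re z * complex.Im w + complex.Im z * complex.Re w.
Proof. by case: z w => [? ?] [? ?]. Qed.

Lemma complex_eqP z w : complex.Re z = complex.Re w -> complex.Im z = complex.Im w -> z = w.
Proof. by case: z w => [? ?] [? ?] /= -> ->. Qed.

Lemma complexV (a b : R) :
  (a +i* b)^-1 = (a / (a ^+ 2 + b ^+ 2)) +i* (- b / (a ^+ 2 + b ^+ 2)).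
Proof. by rewrite mulNr. Qed.

Definition cderive f (x : R) (d : CR) :=
  is_derive x (1:R) (fun y => complex.Re (f y)) (complex.Re d) /\
  is_derive x (1:R) (fun y => complex.Im (f y)) (complex.Im d).

Lemma cderiveM f g x d e : cderive f x d -> cderive g x e ->
  cderive (fun y => f y * g y) x (d * g x + f x * e).
Proof.
move=> [f1 f2] [g1 g2]; split.
  rewrite (_ : (fun _ => _) = (fun y => complex.Re (f y) * complex.Re (g y) +
    (-1) * (complex.Im (f y) * complex.Im (g y)))).
    apply: is_derive_eq (derD (derM f1 g1) (derZ (-1) (derM f2 g2))) _.
    by rewrite cReD !cReM; ring.
  by apply/funext => y; rewrite cReM; ring.
rewrite (_ : (fun _ => _) = (fun y => complex.Re (f y) * complex.Im (g y) +
  (complex.Im (f y) * complex.Re (g y)))).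
  apply: is_derive_eq (derD (derM f1 g2) (derM f2 g1)) _.
  by rewrite cImD !cImM; ring.
by apply/funext => y; rewrite cImM.
Qed.

Lemma cderive_cst w x : cderive (fun=> w) x 0.
Proof. by split; apply: is_derive_cst. Qed.

Lemma cderive_lin_inv (e c x : R) : e != 0 ->
  cderive (fun y => (e +i* (- (y + c)))^-1) x
    ((0 +i* 1) * (e +i* (- (x + c)))^-1 ^+ 2).
Proof.
move=> e0.
have pos y : 0 < e ^+ 2 + (y + c) ^+ 2.
  by rewrite ltr_wpDr ?sqr_ge0// exprn_even_gt0.
have n0 := lt0r_neq0 (pos x).
have dV := @derV R (fun y => e ^+ 2 + (y + c) ^+ 2) x _ n0 (der_sqr_shift x c (e ^+ 2)).
split.
  rewrite (_ : (fun _ => _) = (fun y => e * (e ^+ 2 + (y + c) ^+ 2)^-1)).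
    apply: is_derive_eq (derZ e dV) _.
    by rewrite complexV expr2 !cReM !cImM/= sqrrN; field.
  by apply/funext => y; rewrite complexV/= sqrrN.
rewrite (_ : (fun _ => _) = (fun y => (y + c) * (e ^+ 2 + (y + c) ^+ 2)^-1)).
  apply: is_derive_eq (derM (der_shift x c) dV) _.
  by rewrite complexV expr2 !cImM !cReM/= sqrrN; field.
by apply/funext => y; rewrite complexV/= sqrrN opprK.
Qed.

Lemma cderive_lin_exp (e c x : R) (k : nat) : e != 0 ->
  cderive (fun y => (e +i* (- (y + c)))^-1 ^+ k) x
    ((0 +i* 1) * k%:R * (e +i* (- (x + c)))^-1 ^+ k.+1).
Proof.
move=> e0; elim: k => [|k IH].
  rewrite mulr0 mul0r (_ : (fun _ => _) = fun=> 1); first exact: cderive_cst.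
  by apply/funext => y; rewrite expr0.
rewrite (_ : (fun _ => _) =
    fun y => (e +i* (- (y + c)))^-1 ^+ k * (e +i* (- (y + c)))^-1); last first.
  by apply/funext => y; rewrite exprSr.
have := cderiveM IH (cderive_lin_inv c x e0); congr cderive.
move: (_^-1) => z; rewrite !exprS -[k.+1%:R]natr1; ring.
Qed.

End ComplexValued.

(** * Limits at the ends of symmetric windows *)

Section Limits.
Variable R : realType.
Implicit Types (a c e : R).

Lemma seq_eq (f g : nat -> R) (l : R) : f =1 g -> f @ \oo --> l -> g @ \oo --> l.
Proof. by move=> /funext ->. Qed.

Lemma seqD (f g : nat -> R) (a b : R) : f @ \oo --> a -> g @ \oo --> b ->
  (fun n => f n + g n) @ \oo --> a + b.
Proof. by move=> fa gb; exact: cvgD. Qed.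

Lemma seqM (f g : nat -> R) (a b : R) : f @ \oo --> a -> g @ \oo --> b ->
  (fun n => f n * g n) @ \oo --> a * b.
Proof. by move=> fa gb; exact: cvgM. Qed.

Lemma seqZ (f : nat -> R) (a k : R) : f @ \oo --> a ->
  (fun n => k * f n) @ \oo --> k * a.
Proof. by apply: seqM; exact: cvg_cst. Qed.

Lemma cvg0_bound (f : nat -> R) (A : R) (N : nat) :
  (forall M, (N <= M)%N -> `|f M| <= A / M.+1%:R) -> f @ \oo --> (0 : R).
Proof.
move=> fA; apply/norm_cvg0P.
have hA : (fun M => A * harmonic M) @ \oo --> (0 : R).
  by rewrite -(mulr0 A); apply: seqZ; exact: cvg_harmonic.
apply: (@squeeze_cvgr _ _ _ _ (fun=> 0) _ _ _ _ _ hA); last exact: cvg_cst.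
by exists N => // M /fA ->; rewrite normr_ge0.
Qed.

Lemma shift_lower_bound a : exists N, forall M, (N <= M)%N ->
  M.+1%:R / 4 <= `|M%:R + a| /\ M.+1%:R / 4 <= `|- M%:R + a|.
Proof.
(* For such M one has |a| <= M/2, so |M + a| and |-M + a| are at least M/2 >= (M + 1)/4. *)
exists (2 * (Num.truncn `|a|).+1)%N => M NM.
have aM : 2 * `|a| <= M%:R.
  have := truncnS_gt `|a|; move: NM; rewrite -(ler_nat R) natrM; lra.
have M1 : 1 <= M%:R :> R by rewrite ler1n; lia.
rewrite -[M.+1%:R]natr1.
have := ler_norm a; have := ler_norm (- a); rewrite normrN => h1 h2.
split.
  by apply: le_trans (ler_norm _); lra.
by rewrite -normrN; apply: le_trans (ler_norm _); lra.
Qed.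

Lemma cvg_shift_inv (s : bool) (c e : R) : e != 0 -> forall u : nat -> R,
  (forall M, u M = (-1) ^+ s * M%:R + c) ->
  (fun M => e / (e ^+ 2 + u M ^+ 2)) @ \oo --> (0 : R) /\
  (fun M => u M / (e ^+ 2 + u M ^+ 2)) @ \oo --> (0 : R).
Proof.
move=> e0 u uE; have [N hN] := shift_lower_bound c.
have lb M : (N <= M)%N -> M.+1%:R / 4 <= `|u M|.
  by move=> /hN []; rewrite uE; case: (s); rewrite ?expr0 ?expr1 ?mulN1r ?mul1r.
have pos M : 0 < e ^+ 2 + u M ^+ 2.
  by rewrite ltr_wpDr ?sqr_ge0// exprn_even_gt0.
split; apply: (@cvg0_bound _ 4 N) => M /lb lbM.
- have uM : 0 < `|u M| by apply: lt_le_trans lbM; rewrite divr_gt0.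
  rewrite normrM normfV (gtr0_norm (pos M)) ler_pdivrMr// mulrAC ler_pdivlMr//.
  have := sqr_ge0 (`|e| - `|u M|); rewrite -[e ^+ 2]real_normK ?num_real// -[u M ^+ 2]real_normK ?num_real//.
  have := normr_ge0 e; nra.
- rewrite normrM normfV (gtr0_norm (pos M)) ler_pdivrMr// mulrAC ler_pdivlMr//.
  rewrite -[u M ^+ 2]real_normK ?num_real//.
  have := sqr_ge0 e; have := normr_ge0 (u M); nra.
Qed.

(** The two logarithms diverge separately; at symmetric ends the quotient of their arguments is 1 +
    4aM/(e + (a - M)^2), which tends to 1. *)
Lemma cvg_ln_diff a e : 0 < e ->
  (fun M : nat => ln (e + (M%:R + a) ^+ 2) - ln (e + (- M%:R + a) ^+ 2)) @ \oo --> (0 : R).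
Proof.
move=> e0.
have pos u : 0 < e + u ^+ 2 :> R by rewrite ltr_wpDr ?sqr_ge0.
have -> : (fun M : nat => ln (e + (M%:R + a) ^+ 2) - ln (e + (- M%:R + a) ^+ 2)) =
    (fun M : nat => ln (1 + 4 * a * M%:R / (e + (- M%:R + a) ^+ 2))).
  apply/funext => M; rewrite -ln_div ?posrE//; congr ln.
  by field; rewrite gt_eqF.
rewrite -[X in _ --> X](@ln1 R); apply: (cvg_comp _ (@ln R) (G := nbhs (1 : R))); last first.
  exact: continuous_ln.
suff h : (fun M : nat => 1 + 4 * a * M%:R / (e + (- M%:R + a) ^+ 2)) @ \oo --> (1 + 0 : R).
  by rewrite addr0 in h.
apply: seqD; first exact: cvg_cst.
have [N hN] := shift_lower_bound a.
(* 64 is 4 times 4^2, from the factor 4 and the lower bound (M + 1)/4 on |a - M|. *)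
apply: (@cvg0_bound _ (64 * `|a|) N) => M /hN [_ h].
rewrite normrM normfV (gtr0_norm (pos _)) ler_pdivrMr// [leRHS]mulrAC ler_pdivlMr//.
rewrite !normrM normr_nat (ger0_norm (ler0n _ M)) -[(- _ + a) ^+ 2]real_normK ?num_real//.
move: h; rewrite -[M.+1%:R]natr1; move: `|- _ + a| => z h.
have M0 : 0 <= M%:R :> R by [].
have : 4 * M%:R * (M%:R + 1) <= 64 * (e + z ^+ 2) by nra.
have := normr_ge0 a; nra.
Qed.

Lemma cvg_atan_shift a e : 0 < e ->
  (fun M : nat => atan ((M%:R + a) / e) - atan ((- M%:R + a) / e)) @ \oo --> (pi : R).
Proof.
move=> e0.
have h b : (fun M : nat => atan ((M%:R + b) / e)) @ \oo --> (pi / 2 : R).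
  apply: (cvg_comp _ (@atan R) (G := +oo%R)); last exact: cvgy_atan.
  apply/cvgryPge => A.
  exists (Num.truncn `|A * e - b|).+1 => // M /= hM.
  rewrite ler_pdivlMr//; have := truncnS_gt `|A * e - b|; move: hM; rewrite -(ler_nat R).
  have := ler_norm (A * e - b); lra.
have -> : (fun M : nat => atan ((M%:R + a) / e) - atan ((- M%:R + a) / e)) =
    (fun M : nat => atan ((M%:R + a) / e) + atan ((M%:R + (- a)) / e)).
  apply/funext => M; rewrite -[(M%:R - a) / e]opprK atanN.
  by congr (_ - _); congr atan; field; rewrite gt_eqF.
have -> : pi = pi / 2 + pi / 2 :> R by field.
by apply: cvgD; apply: h.
Qed.

Local Open Scope complex_scope.

Definition cvanish (f : nat -> R[i]) :=
  (fun M => complex.Re (f M)) @ \oo --> (0 : R) /\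
  (fun M => complex.Im (f M)) @ \oo --> (0 : R).

Lemma cvanishM f g : cvanish f -> cvanish g -> cvanish (fun M => f M * g M).
Proof.
move=> [f1 f2] [g1 g2]; split.
  have := seqD (seqM f1 g1) (seqZ (k := -1) (seqM f2 g2)); rewrite !mulr0 addr0.
  by apply: seq_eq => M; rewrite cReM mulN1r.
have := seqD (seqM f1 g2) (seqM f2 g1); rewrite !mulr0 addr0.
by apply: seq_eq => M; rewrite cImM.
Qed.

Lemma cvanish_lin (s : bool) (c e : R) (k : nat) : e != 0 ->
  cvanish (fun M => (e +i* (- ((-1) ^+ s * M%:R + c)))^-1 ^+ k.+1).
Proof.
move=> e0.
have base : cvanish (fun M => (e +i* (- ((-1) ^+ s * M%:R + c)))^-1).
  have [h1 h2] := @cvg_shift_inv s c e e0 _ (fun M => erefl).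
  split.
    by apply: seq_eq h1 => M; rewrite complexV/= sqrrN.
  by apply: seq_eq h2 => M; rewrite complexV/= sqrrN opprK.
elim: k => [|k IH].
  by move: base; congr cvanish; apply/funext => M; rewrite expr1.
by have := cvanishM base IH; congr cvanish; apply/funext => M; rewrite [in RHS]exprS.
Qed.

Lemma cvanish_Re_mul (w : R[i]) f : cvanish f ->
  (fun M => complex.Re (w * f M)) @ \oo --> (0 : R).
Proof.
move=> [f1 f2].
have := seqD (seqZ (k := complex.Re w) f1) (seqZ (k := - complex.Im w) f2).
rewrite !mulr0 addr0.
by apply: seq_eq => M; rewrite cReM mulNr.
Qed.

End Limits.

Arguments seqZ {R f a} k _.

(** * Integrals over the real line through primitives and their jumps *)

Section Primitive.
Variables (R : realType) (I : eqType) (nu mu : I -> int) (S : pred int).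
Local Open Scope complex_scope.
Implicit Types (t x : R) (d : int).

(* The rotated variables: with Y = -id and xi = -ix all poles have rational
   coefficients in Y and T. *)
Definition rot x : R[i] := 0 +i* (- x).

Lemma real_intr (n : int) : (n%:~R : R[i]) = (n%:~R : R)%:C.
Proof. by rewrite rmorph_int. Qed.

Lemma rot_sub_pole (j : I * bool) t d x :
  rot x - pole nu mu j t%:C (rot d%:~R) =
  (- ((-1) ^+ j.2 * t)) +i* (- (x + (mu j.1)%:~R / (nu j.1)%:~R * d%:~R)).
Proof.
rewrite /pole !real_intr -fmorph_div.
have -> : ((-1) ^+ j.2 : R[i]) = ((-1) ^+ j.2)%:C by rewrite rmorphXn rmorphN1.
apply: complex_eqP; rewrite /= ; ring.
Qed.

Lemma rot_generic t d : 0 < t -> d != 0 -> generic (t%:C : R[i]) (rot d%:~R).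
Proof.
move=> t0 d0; split; first by rewrite -[0]/(0%:C) (inj_eq (@complexI R)) gt_eqF.
move=> k; apply/eqP => /(congr1 (@complex.Im R)) /=.
have -> : 2 * k%:~R * t%:C = (2 * k%:~R * t)%:C :> R[i].
  by rewrite real_intr !rmorphM rmorph_nat.
rewrite /= addr0 => /eqP.
by rewrite oppr_eq0 intr_eq0 (negPf d0).
Qed.

Lemma rot_regular t d x : 0 < t -> d != 0 -> regular nu mu (t%:C : R[i]) (rot d%:~R) (rot x).
Proof.
move=> t0 d0; split; first exact: rot_generic.
move=> j nj; rewrite rot_sub_pole; apply/eqP => /(congr1 (@complex.Re R)) /= /eqP.
by rewrite oppr_eq0 mulf_eq0 signr_eq0 gt_eqF.
Qed.

(** J is the integral over the line as a principal value: a single simple pole of the partial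
    fraction expansion decays only like 1/x. All shifts [a] are included because unfolding with step
    g produces g shifted windows. *)
Definition primitive_with_jump (f : R -> R) (J : R) := exists G : R -> R,
  (forall x, is_derive x (1:R) G (f x)) /\
  forall a, (fun M : nat => G (M%:R + a) - G (- M%:R + a)) @ \oo --> J.

(** Re w enters the primitive through an arctangent, which yields the factor pi, and Im w through a
    logarithm, whose jump is zero by [cvg_ln_diff]. *)
Lemma primitive_simple_pole (w : R[i]) (s : bool) t c : 0 < t ->
  primitive_with_jump
    (fun x => complex.Re (w / ((- ((-1) ^+ s * t)) +i* (- (x + c)))))
    (pi * complex.Re ((- (-1) ^+ s) * w)).
Proof.
move=> t0; set e := (-1) ^+ s : R; set p := complex.Re w; set q := complex.Im w.
have e2 : e ^+ 2 = 1 by rewrite /e sqrr_sign.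
exists (fun x => - e * p * atan ((x + c) / t) + (- (q / 2)) * ln (t ^+ 2 + (x + c) ^+ 2)).
split=> [x|a].
  have t2 : 0 < t ^+ 2 by rewrite exprn_gt0.
  have t0' := lt0r_neq0 t0.
  apply: is_derive_eq (derD (derZ (- e * p) (der_atan x c t0')) (derZ (- (q / 2)) (der_ln x c t2))) _.
  rewrite complexV cReM /= -/p -/q !sqrrN exprMn e2 mul1r opprK.
  have n0 : t ^+ 2 + (x + c) ^+ 2 != 0 by rewrite gt_eqF// ltr_wpDr ?sqr_ge0.
  by field.
have -> : pi * complex.Re (- (-1) ^+ s * w) = (- e * p) * pi + (- (q / 2)) * 0.
  have -> : ((-1) ^+ s : R[i]) = e%:C by rewrite rmorphXn rmorphN1.
  by rewrite cReM/= -/p; ring.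
have t2 : 0 < t ^+ 2 by rewrite exprn_gt0.
have := seqD (seqZ (- e * p) (cvg_atan_shift (a + c) t0)) (seqZ (- (q / 2)) (cvg_ln_diff (a + c) t2)).
by apply: seq_eq => M; rewrite !addrA; ring.
Qed.

(** The primitive is a negative power of the linear factor and vanishes at both ends. *)
Lemma primitive_multiple_pole (w : R[i]) (s : bool) t c (m : nat) : 0 < t ->
  primitive_with_jump
    (fun x => complex.Re (w / ((- ((-1) ^+ s * t)) +i* (- (x + c))) ^+ m.+2)) 0.
Proof.
move=> t0; set e := - ((-1) ^+ s * t).
have e0 : e != 0 by rewrite oppr_eq0 mulf_eq0 signr_eq0 gt_eqF.
set k : R[i] := w / ((0 +i* 1) * m.+1%:R).
have k0 : (0 +i* 1) * m.+1%:R != 0 :> R[i].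
  rewrite mulf_neq0 ?pnatr_eq0//.
  by apply/eqP => /(congr1 (@complex.Im R)) /= /eqP; rewrite oner_eq0.
exists (fun x => complex.Re (k * (e +i* (- (x + c)))^-1 ^+ m.+1)); split=> [x|a].
  have [h _] := cderiveM (cderive_cst k x) (cderive_lin_exp c x m.+1 e0).
  apply: is_derive_eq h _; congr complex.Re.
  by rewrite mul0r add0r /k mulrA divfK// exprVn.
have lim0 (u : bool) : (fun M : nat => complex.Re (k * (e +i* (- ((-1) ^+ u * M%:R + a + c)))^-1 ^+ m.+1)) @ \oo --> (0 : R).
  apply: cvanish_Re_mul; have := @cvanish_lin R u (a + c) e m e0.
  by congr cvanish; apply/funext => M; rewrite addrA.
have := seqD (lim0 false) (seqZ (-1) (lim0 true)); rewrite mulr0 addr0.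
by apply: seq_eq => M; rewrite expr0 expr1 mul1r !mulN1r.
Qed.

Lemma primitiveD f g J1 J2 : primitive_with_jump f J1 -> primitive_with_jump g J2 ->
  primitive_with_jump (fun x => f x + g x) (J1 + J2).
Proof.
move=> [F [F1 F2]] [G [G1 G2]]; exists (fun x => F x + G x); split=> [x|a].
  exact: derD.
by have := seqD (F2 a) (G2 a); apply: seq_eq => M; ring.
Qed.

(** Only simple poles contribute, as in the residue theorem. Removing one factor [xi - pole] lowers
    both H and b by one, which brings the pole orders at nonzero slopes down to w - 1. *)
Lemma pole_sum_primitive b H B P : pole_sum nu mu S b H B P ->
  exists F : R[i] -> R[i] -> R[i], coef S H.-1 b.-1 B F /\
  forall t d, 0 < t -> d != 0 ->
    primitive_with_jump (fun x => complex.Re (P t%:C (rot d%:~R) (rot x)))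
      (pi * complex.Re (F t%:C (rot d%:~R))).
Proof.
elim=> {B P}[j m h c B F nj m0 hm cm cF|B1 B2 P1 P2 _ [F1 [c1 h1]] _ [F2 [c2 h2]]
  |B1 B2 P1 P2 B12 P12 _ [F [cF hF]]].
- have B0 : 0 <= B by case: cF => s [_ + _]; apply: le_trans; apply: sumr_ge0.
  case: m m0 hm cm => // -[|m] _ hm cm.
    exists (fun T Y => ratr (- (-1) ^+ j.2) * F T Y); split=> [|t d t0 d0].
      rewrite -hm addn1 /=; apply: coef_weaken (coef_scale _ cF); first by lia.
      by rewrite normrN normr_sign mul1r.
    rewrite rmorphN rmorphXn rmorphN1.
    have := @primitive_simple_pole (F t%:C (rot d%:~R)) j.2 t ((mu j.1)%:~R / (nu j.1)%:~R * d%:~R) t0.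
    by congr primitive_with_jump; apply/funext => x; rewrite expr1 rot_sub_pole.
  exists (fun _ _ => 0); split=> [|t d t0 d0].
    by apply: coef_weaken (coef_zero _ _ _ 0).
  rewrite mulr0.
  have := @primitive_multiple_pole (F t%:C (rot d%:~R)) j.2 t ((mu j.1)%:~R / (nu j.1)%:~R * d%:~R) m t0.
  by congr primitive_with_jump; apply/funext => x; rewrite rot_sub_pole.
- exists (fun T Y => F1 T Y + F2 T Y); split; first exact: coef_add.
  move=> t d t0 d0; rewrite cReD mulrDr.
  have := primitiveD (h1 _ _ t0 d0) (h2 _ _ t0 d0).
  by congr primitive_with_jump; apply/funext => x; rewrite cReD.
- exists F; split; first exact: coef_weaken cF.
  move=> t d t0 d0; have := hF _ _ t0 d0.
  by congr primitive_with_jump; apply/funext => x; rewrite P12//; exact: rot_regular.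
Qed.

End Primitive.

(** * Series: dominated convergence, termwise differentiation, exponential majorants *)

Section SeriesTools.
Variable R : realType.
Implicit Types (f g b u : nat -> R).

Lemma cvg_series_dom f b : (forall k, `|f k| <= b k) -> cvgn (series b) -> cvgn (series f).
Proof.
move=> fb cb; apply: normed_cvg; apply: (series_le_cvg _ _ _ cb) => n //=.
  exact: le_trans (fb n).
Qed.

Lemma series_sub (f : nat -> R) K n : (K <= n)%N ->
  series f n - series f K = \sum_(K <= k < n) f k.
Proof. exact: sub_series_geq. Qed.

Lemma series_tail f b K : (forall k, `|f k| <= b k) -> cvgn (series b) ->
  `|limn (series f) - series f K| <= limn (series b) - series b K.
Proof.
move=> fb cb; have cf := cvg_series_dom fb cb.
have c1 : (fun n => `|series f n - series f K|) @ \oo --> `|limn (series f) - series f K|.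
  apply: cvg_norm; apply: cvgB => //; exact: cvg_cst.
have c2 : (fun n => series b n - series b K) @ \oo --> limn (series b) - series b K.
  by apply: cvgB => //; exact: cvg_cst.
rewrite -(cvg_lim _ c1)// -(cvg_lim _ c2)//; apply: ler_lim.
- by apply/cvg_ex; eexists; exact: c1.
- by apply/cvg_ex; eexists; exact: c2.
exists K => // n /= Kn; rewrite !series_sub//.
by apply: le_trans (ler_norm_sum _ _ _) _; apply: ler_sum.
Qed.

Lemma cvg_series_partial (T : Type) (F : set_system T) (FF : Filter F)
    (f : T -> nat -> R) g K :
  (forall k, f ^~ k @ F --> g k) -> (fun x => series (f x) K) @ F --> series g K.
Proof.
move=> fg; rewrite /series /=; elim: K => [|K IH].
  rewrite big_geq//; under eq_fun do rewrite big_geq//.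
  exact: cvg_cst.
rewrite big_nat_recr//=; under eq_fun do rewrite big_nat_recr//=.
by apply: cvgD.
Qed.

(** Beyond a fixed K the tails of all the series are dominated by the tail of [b], and the first K
    terms converge as a finite sum. *)
Lemma tannery (T : Type) (F : set_system T) (FF : ProperFilter F)
    (f : T -> nat -> R) g b :
  (forall k, f ^~ k @ F --> g k) -> (\forall x \near F, forall k, `|f x k| <= b k) ->
  cvgn (series b) -> (fun x => limn (series (f x))) @ F --> limn (series g).
Proof.
move=> fg fb cb.
have gb k : `|g k| <= b k.
  have c : `|f x k| @[x --> F] --> `|g k| by apply: cvg_norm; exact: fg.
  rewrite -(cvg_lim _ c)//; apply: limr_le; first by apply/cvg_ex; eexists; exact: c.
  by apply: filterS fb => x; apply.
apply/cvgrPdist_le => e e0.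
have e4 : 0 < e / 4 by rewrite divr_gt0.
move/cvgrPdist_le : (cb) => /(_ _ e4) [K _ /(_ K (leqnn K)) hK].
have := cvg_series_partial (K := K) FF fg => /cvgrPdist_le /(_ _ e4) hp.
apply: filterS2 hp fb => x hp fbx.
have t1 := series_tail K gb cb; have t2 := series_tail K fbx cb.
move: hK hp t1 t2; move: (limn (series b)) (limn (series g)) (limn _) => B G H.
move: (series b K) (series g K) (series _ K) => p q r.
rewrite !ler_norml => /andP[? ?] /andP[? ?] /andP[? ?] /andP[? ?].
apply/andP; split; lra.
Qed.

Lemma is_deriveP (f : R -> R) c d :
  is_derive c (1:R) f d <-> (fun h => h^-1 * (f (h + c) - f c)) @ 0^' --> d.
Proof.
have E : (fun h : R => h^-1 *: (f (h *: (1:R) + c) - f c)) = (fun h => h^-1 * (f (h + c) - f c)).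
  by apply/funext => h; rewrite [h *: 1]mulr1.
split=> [[ex <-]|cv].
  by rewrite -E; exact: ex.
have ex : derivable f c 1.
  by rewrite /derivable; apply/cvg_ex; exists d; rewrite -E in cv; exact: cv.
apply: DeriveDef => //; rewrite /derive; apply: cvg_lim => //.
by rewrite -E in cv; exact: cv.
Qed.

Lemma mean_value_le (f df : R -> R) (B c e x y : R) :
  (forall z, `|z - c| < e -> is_derive z (1:R) f (df z)) ->
  (forall z, `|z - c| < e -> `|df z| <= B) ->
  `|x - c| < e -> `|y - c| < e -> `|f y - f x| <= B * `|y - x|.
Proof.
move=> fd dB; wlog xy : x y / x <= y.
  move=> W hx hy; have [xy|/ltW yx] := leP x y; first exact: W.
  by rewrite distrC [`|y - x|]distrC; apply: W.
rewrite !ltr_norml => /andP[x1 x2] /andP[y1 y2].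
have inI z : x <= z <= y -> `|z - c| < e.
  by move=> /andP[z1 z2]; rewrite ltr_norml; apply/andP; split; lra.
have [z zI ->] : exists2 z, z \in `[x, y] & f y - f x = df z * (y - x).
  apply: MVT_segment => //.
    move=> z; rewrite in_itv/= => /andP[z1 z2]; apply: fd; apply: inI.
    by rewrite !ltW.
  apply: derivable_within_continuous => z; rewrite in_itv/= => zI.
  by have [] := fd _ (inI _ zI).
rewrite normrM ler_wpM2r//; apply: dB; apply: inI.
by move: zI; rewrite in_itv.
Qed.

(** Dominated convergence applied to the difference quotients, which the mean value inequality
    bounds by [b n]. *)
Lemma series_is_derive (f df : nat -> R -> R) b (c e : R) : 0 < e ->
  (forall n x, `|x - c| < e -> is_derive x (1:R) (f n) (df n x)) ->
  (forall n x, `|x - c| < e -> `|df n x| <= b n) -> cvgn (series b) ->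
  (forall x, `|x - c| < e -> cvgn (series (f ^~ x))) ->
  is_derive c (1:R) (fun x => limn (series (fun n => f n x))) (limn (series (fun n => df n c))).
Proof.
move=> e0 fd dB cb cf; apply/is_deriveP.
have cc : `|c - c| < e by rewrite subrr normr0.
have near_e : \forall h \near (0 : R)^', `|h + c - c| < e /\ h != 0.
  exists e => //= h; rewrite /= sub0r normrN => he h0; split=> //.
  by rewrite addrK.
have := @tannery R (0 : R)^' _ (fun h n => h^-1 * (f n (h + c) - f n c)) (fun n => df n c) b.
move=> T; apply: cvg_trans (T _ _ _ cb) => {T}.
- apply: near_eq_cvg; apply: filterS near_e => h [he h0].
  apply: cvg_lim => //.
  have := seqZ h^-1 (seqD (cf _ he) (seqZ (-1) (cf _ cc))); rewrite mulN1r.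
  by apply: seq_eq => n; rewrite /series /= mulN1r -sumrB mulr_sumr.
- by move=> n; apply/is_deriveP; apply: fd.
- apply: filterS near_e => h [he h0] n.
  rewrite normrM normfV ler_pdivrMl ?normr_gt0// mulrC.
  by have := mean_value_le (fd n) (dB n) cc he; rewrite addrK.
Qed.

Definition inv_sqr (k : nat) : R := (k.+1%:R ^+ 2)^-1.

Lemma inv_sqr_ge0 k : 0 <= inv_sqr k.
Proof. by rewrite /inv_sqr invr_ge0 exprn_ge0. Qed.

Lemma cvg_series_bounded u (B : R) : (forall n, 0 <= u n) -> (forall n, series u n <= B) ->
  cvgn (series u).
Proof.
move=> u0 uB; apply: nondecreasing_is_cvgn.
  by apply: nondecreasing_series => n _ _.
by exists B => _ [n _ <-].
Qed.

Lemma series_inv_sqr_le n : series inv_sqr n.+1 <= 2 - n.+1%:R^-1.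
Proof.
elim: n => [|n IH].
  by rewrite /series /= big_nat1 /inv_sqr expr1n invr1; lra.
rewrite /series /= big_nat_recr//= -/(series inv_sqr n.+1).
apply: (le_trans (lerD IH (lexx _))); rewrite /inv_sqr.
rewrite -[n.+2%:R]natr1; set x := n.+1%:R.
have x0 : 0 < x by rewrite ltr0n.
rewrite -subr_ge0.
have -> : 2 - (x + 1)^-1 - (2 - x^-1 + ((x + 1) ^+ 2)^-1) = (x * (x + 1) ^+ 2)^-1.
  by field; rewrite !gt_eqF//; lra.
by rewrite invr_ge0 mulr_ge0 ?sqr_ge0// ltW.
Qed.

Lemma inv_sqr_cvg : cvgn (series inv_sqr).
Proof.
apply: (@cvg_series_bounded _ 2) => [|[|n]]; first exact: inv_sqr_ge0.
  by rewrite /series /= big_geq.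
by apply: (le_trans (series_inv_sqr_le n)); rewrite gerBl invr_ge0.
Qed.

Lemma cvg_seriesZ (k : R) u : cvgn (series u) -> cvgn (series (fun n => k * u n)).
Proof. by move=> cu; exact: (@is_cvg_seriesZ _ _ k). Qed.

(** With y = a(q + 1), exp(y) = exp(y/(k+2))^(k+2) >= (y/(k+2))^(k+2); the exponent k + 2 leaves the
    summable factor (q + 1)^-2. *)
Lemma pow_exp_le (a : R) (k q : nat) : 0 < a ->
  q.+1%:R ^+ k * expR (- (a * q.+1%:R)) <= (k.+2%:R / a) ^+ k.+2 * inv_sqr q.
Proof.
move=> a0; rewrite /inv_sqr; set x := q.+1%:R.
have x0 : 0 < x by rewrite ltr0n.
have k0 : 0 < k.+2%:R :> R by rewrite ltr0n.
have h : (a * x / k.+2%:R) ^+ k.+2 <= expR (a * x).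
  have -> : expR (a * x) = expR (a * x / k.+2%:R) ^+ k.+2.
    by rewrite -expRM_natl [_%:R * _]mulrC divfK// gt_eqF.
  rewrite lerXn2r ?nnegrE ?expR_ge0//.
    by rewrite divr_ge0 ?mulr_ge0// ltW.
  by apply: le_trans (expR_ge1Dx _); rewrite lerDr.
rewrite expRN ler_pdivrMr ?expR_gt0// mulrAC ler_pdivlMr ?exprn_gt0// -exprD addn2.
have -> : x ^+ k.+2 = (k.+2%:R / a) ^+ k.+2 * (a * x / k.+2%:R) ^+ k.+2.
  by rewrite -exprMn; congr (_ ^+ _); field; rewrite !gt_eqF.
by rewrite ler_wpM2l// exprn_ge0// divr_ge0// ltW.
Qed.

Lemma cvg_pow_exp (a : R) (k : nat) : 0 < a ->
  cvgn (series (fun q => q.+1%:R ^+ k * expR (- (a * q.+1%:R)))).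
Proof.
move=> a0; apply: (@cvg_series_dom _ (fun q => (k.+2%:R / a) ^+ k.+2 * inv_sqr q)).
  move=> q; rewrite ger0_norm; first exact: pow_exp_le.
  by rewrite mulr_ge0 ?exprn_ge0 ?expR_ge0.
by apply: cvg_seriesZ; exact: inv_sqr_cvg.
Qed.

End SeriesTools.

(** * The partial fraction series of the hyperbolic cotangent *)

Section CothSeries.
Variable R : realType.
Implicit Types (c r x y t : R).

(** The derivative of sin x - x cos x is x sin x, which is nonnegative on the interval. *)
Lemma mul_cos_le_sin y : 0 <= y <= pi / 2 -> y * cos y <= sin y.
Proof.
move=> /andP[y0 y2]; rewrite -subr_ge0.
have d z : is_derive z (1:R) (fun x => sin x + (-1) * (x * cos x)) (z * sin z).
  apply: is_derive_eq (derD (is_derive_sin z) (derZ (-1) (derM (is_derive_id z 1) (is_derive_cos z)))) _.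
  ring.
have [z zI] : exists2 z, z \in `[0, y] &
    (sin y + (-1) * (y * cos y)) - (sin 0 + (-1) * (0 * cos 0)) = z * sin z * (y - 0).
  apply: (@MVT_segment _ (fun x => sin x + (-1) * (x * cos x)) (fun z => z * sin z)) => //.
  apply: derivable_within_continuous => z _.
  by have [] := d z.
rewrite sin0 mul0r mulr0 addr0 subr0 subr0 !mulN1r => ->.
move: zI; rewrite in_itv/= => /andP[z0 zy].
have zpi : z <= pi by apply: (le_trans zy); apply: (le_trans y2); have := pi_gt0 R; lra.
by rewrite !mulr_ge0// sin_ge0_pi// z0.
Qed.

(** sin x = 2 sin(x/2) cos(x/2) >= x cos(x/2)^2, and cos x >= 0 means cos(x/2)^2 >= 1/2. *)
Lemma half_le_sin x : 0 <= x <= pi / 2 -> x / 2 <= sin x.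
Proof.
move=> /andP[x0 x2]; have p0 := pi_gt0 R.
have h0 : 0 <= x / 2 <= pi / 2 by apply/andP; split; lra.
have h1 := mul_cos_le_sin h0.
have xE : x = (x / 2) *+ 2 by rewrite mulr2n; field.
have c0 : 0 <= cos x by apply: cos_ge0_pihalf; apply/andP; split; lra.
have ch : 0 <= cos (x / 2) by apply: cos_ge0_pihalf; apply/andP; split; lra.
rewrite {2}xE sin_mulr2n; move: c0; rewrite {1}xE cos_mulr2n.
move: h1 ch; move: (cos _) (sin _) => u v h1 u0 c0.
have : x / 2 * u * u <= v * u by rewrite ler_wpM2r.
nra.
Qed.

Lemma sin_pi_natmul (n : nat) : sin (n%:R * pi) = 0 :> R.
Proof.
elim: n => [|n IH]; first by rewrite mul0r sin0.
by rewrite -natr1 mulrDl mul1r sinDpi IH oppr0.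
Qed.

Lemma cos_2pi_natmul (n : nat) : cos (n%:R * (2 * pi)) = 1 :> R.
Proof.
have -> : n%:R * (2 * pi) = (n%:R * pi) *+ 2 :> R by rewrite -mulr_natr; ring.
have := cos2Dsin2 (n%:R * pi : R); rewrite sin_pi_natmul expr0n addr0 => h.
by rewrite cos_mulr2n h mulr2n addrK.
Qed.

Lemma dirichlet_kernel (phi : R) (M : nat) :
  sin (phi / 2) * (1 + 2 * \sum_(d < M) cos (d.+1%:R * phi)) = sin (M%:R * phi + phi / 2).
Proof.
elim: M => [|M IH]; first by rewrite big_ord0 mulr0 addr0 mulr1 mul0r add0r.
rewrite big_ord_recr /= [2 * (_ + _)]mulrDr addrA [sin _ * _]mulrDr IH.
set A := M.+1%:R * phi.
have -> : M%:R * phi + phi / 2 = A - phi / 2.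
  by rewrite /A -natr1; field.
rewrite sinD [in RHS]sinD cosN sinN; ring.
Qed.

Lemma sum_cos_odd (n M : nat) : (0 < n < 2 * M + 1)%N ->
  1 + 2 * \sum_(d < M) cos (n%:R * (d.+1%:R * (2 * pi / (2 * M + 1)%:R))) = 0 :> R.
Proof.
move=> /andP[n0 nN]; set N := (2 * M + 1)%:R.
have N0 : 0 < N :> R by rewrite ltr0n addn1.
set phi := n%:R * (2 * pi / N).
have p0 := pi_gt0 R.
have n0' : 0 < n%:R :> R by rewrite ltr0n.
have nN' : n%:R < N :> R by rewrite ltr_nat.
have s0 : sin (phi / 2) != 0.
  have -> : phi / 2 = pi * (n%:R / N) by rewrite /phi; field; rewrite gt_eqF.
  rewrite gt_eqF// sin_gt0_pi// mulr_gt0 ?divr_gt0//=.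
  by rewrite gtr_pMr// ltr_pdivrMr// mul1r.
apply: (mulfI s0); rewrite mulr0.
under eq_bigr do rewrite mulrCA -/phi.
rewrite dirichlet_kernel.
have -> : M%:R * phi + phi / 2 = n%:R * pi.
  have NE : N = 2 * M%:R + 1 by rewrite /N natrD natrM.
  rewrite /phi NE; field; rewrite -NE gt_eqF//.
exact: sin_pi_natmul.
Qed.

(** The real part of (1 - z^N)(1 - conj z) for z = r e^(it); the last bracket is cos((N - 1)t),
    expanded by the addition formula. *)
Lemma sum_pow_cos r t (N : nat) :
  (1 - 2 * r * cos t + r ^+ 2) * \sum_(n < N) r ^+ n * cos (n%:R * t) =
  1 - r * cos t - r ^+ N * cos (N%:R * t) +
    r ^+ N * r * (cos (N%:R * t) * cos t + sin (N%:R * t) * sin t).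
Proof.
elim: N => [|N IH].
  by rewrite big_ord0 mul0r cos0 sin0 expr0; ring.
rewrite big_ord_recr /= [X in X = _]mulrDr IH.
have -> : N.+1%:R * t = N%:R * t + t by rewrite -natr1 mulrDl mul1r.
rewrite cosD sinD [r ^+ N.+1]exprS; move: (cos (N%:R * t)) (sin (N%:R * t)) => C S.
have := cos2Dsin2 t; move: (cos t) (sin t) => u v uv.
have -> : (C * u - S * v) * u + (S * u + C * v) * v = C by rewrite -[RHS]mulr1 -uv; ring.
ring.
Qed.

Definition poisson r t := (1 - r ^+ 2) / (1 - 2 * r * cos t + r ^+ 2).

Lemma poisson_den_gt0 r t : 0 < r < 1 -> 0 < 1 - 2 * r * cos t + r ^+ 2.
Proof.
move=> /andP[r0 r1]; have := cos_le1 t; nra.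
Qed.

(** When Nt is a multiple of 2 pi, the right-hand side of [sum_pow_cos] becomes (1 - r^N)(1 - r cos
    t), and the numerator 1 - r^2 of the kernel is 2(1 - r cos t) minus its denominator. *)
Lemma poisson_root_of_unity r (d N : nat) : 0 < r < 1 -> (0 < N)%N ->
  poisson r (d%:R * (2 * pi / N%:R)) =
  2 / (1 - r ^+ N) * (\sum_(n < N) r ^+ n * cos (n%:R * (d%:R * (2 * pi / N%:R)))) - 1.
Proof.
move=> r01 N0; set t := d%:R * _; have D0 := poisson_den_gt0 t r01.
have Nt : N%:R * t = d%:R * (2 * pi) by rewrite /t; field; rewrite pnatr_eq0 -lt0n.
have := sum_pow_cos r t N; rewrite Nt cos_2pi_natmul.
have -> : sin (d%:R * (2 * pi)) = 0 :> R.
  by rewrite mulrCA -[2 * _]/(2 * (d%:R * pi)) mulrA -natrM sin_pi_natmul.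
rewrite /poisson; move: (\sum_(_ < _) _) => S.
have rN : 1 - r ^+ N != 0.
  rewrite subr_eq0 eq_sym lt_eqF// exprn_ilt1// ?gtn_eqF//; case/andP: r01 => *; lra.
move: D0; set D := 1 - _ + _ => D0 h.
have -> : S = (1 - r ^+ N) * (1 - r * cos t) / D.
  apply: (mulfI (lt0r_neq0 D0)); rewrite h [RHS]mulrC divfK ?gt_eqF//; ring.
have E : D = 1 - 2 * r * cos t + r ^+ 2 by [].
have -> : 1 - r ^+ 2 = 2 * (1 - r * cos t) - D by rewrite E; ring.
by clearbody D; field; rewrite rN gt_eqF.
Qed.

(* The points are the N-th roots of unity, over which the geometric expansion of
   the Poisson kernel keeps the exponents divisible by N = 2M + 1. *)
Lemma poisson_sum r (M : nat) : 0 < r < 1 ->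
  poisson r 0 + 2 * \sum_(d < M) poisson r (d.+1%:R * (2 * pi / (2 * M + 1)%:R)) =
  (2 * M + 1)%:R * (1 + r ^+ (2 * M + 1)) / (1 - r ^+ (2 * M + 1)).
Proof.
move=> r01; set N := (2 * M + 1)%N.
have N0 : (0 < N)%N by rewrite /N addn1.
have rN : 1 - r ^+ N != 0.
  rewrite subr_eq0 eq_sym lt_eqF// exprn_ilt1// ?gtn_eqF//; case/andP: r01 => *; lra.
rewrite -[X in poisson r X](mul0r (2 * pi / N%:R)) -[X in poisson r (X * _)]/(0%:R).
rewrite poisson_root_of_unity//.
under [X in _ + 2 * X]eq_bigr do rewrite poisson_root_of_unity//.
rewrite big_split /= -mulr_sumr sumr_const card_ord.
set A := \sum_(n < N) _; set B := \sum_(i < M) _.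
have AB : A + 2 * B = N%:R.
  rewrite /B exchange_big /= mulr_sumr /A -big_split /=.
  rewrite (bigD1 (Ordinal N0)) //= [X in _ + X]big1 ?addr0 => [|i i0].
    rewrite expr0 !mul0r cos0 mulr1 (eq_bigr (fun=> 1)); last by move=> i _; rewrite mul0r cos0 mulr1.
    by rewrite sumr_const card_ord /N natrD natrM addrC.
  rewrite -mulr_sumr mul0r mulr0 cos0 mulr1.
  rewrite mulrCA -{1}[r ^+ _]mulr1 -mulrDr sum_cos_odd ?mulr0//.
  by rewrite ltn_ord andbT lt0n.
have -> : 2 / (1 - r ^+ N) * A - 1 + 2 * (2 / (1 - r ^+ N) * B + - 1 *+ M) =
   2 / (1 - r ^+ N) * (A + 2 * B) - (1 + 2 * M%:R).
  by rewrite -[_ *+ M]mulr_natr; ring.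
rewrite AB; have -> : 1 + 2 * M%:R = N%:R :> R by rewrite /N natrD natrM addrC.
by field.
Qed.

Lemma limn_series_finite (f : nat -> R) (M : nat) : (forall k, (M <= k)%N -> f k = 0) ->
  limn (series f) = series f M.
Proof.
move=> f0; apply: cvg_lim => //.
apply: (@cvg_near_cst _ _ _ _ _ _); exists M => // n /= Mn.
apply/eqP; rewrite -subr_eq0 series_sub// big_nat big1// => k /andP[Mk _].
exact: f0.
Qed.

Lemma cvg_odd_inv : (fun M : nat => ((2 * M + 1)%:R : R)^-1) @ \oo --> (0 : R).
Proof.
apply: (@cvg0_bound _ _ 1 0) => M _.
rewrite ger0_norm ?invr_ge0// mul1r lef_pV2 ?posrE ?ltr0n ?addn1// ler_nat; lia.
Qed.

Lemma cvg_scaled_derive (f : R -> R) (df x : R) : is_derive (0 : R) (1:R) f df -> f 0 = 0 ->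
  (fun M : nat => (2 * M + 1)%:R * f (x / (2 * M + 1)%:R)) @ \oo --> x * df.
Proof.
move=> /is_deriveP fd f0; have [->|x0] := eqVneq x 0.
  rewrite mul0r; apply: seq_eq (cvg_cst 0) => M.
  by rewrite mul0r f0 mulr0.
have N0 M : (2 * M + 1)%:R != 0 :> R by rewrite pnatr_eq0 addn1.
have c0 : (fun M : nat => x / (2 * M + 1)%:R) @ \oo --> (0 : R)^'.
  have c1 := seqZ x cvg_odd_inv; rewrite mulr0 in c1.
  move=> A hA; have := c1 _ hA; rewrite /nbhs /=; apply: filterS => M.
  by apply; rewrite mulf_neq0// invr_eq0.
have := seqZ x (cvg_comp _ _ c0 fd); apply: seq_eq => M /=.
by rewrite f0 subr0 addr0 invfM invrK mulrA mulrA divff// mul1r.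
Qed.

Lemma lim_seriesZ (k : R) (u : nat -> R) : cvgn (series u) ->
  limn (series (fun n => k * u n)) = k * limn (series u).
Proof.
move=> cu; apply: cvg_lim => //; apply: seq_eq (seqZ k cu) => n.
by rewrite /series /= mulr_sumr.
Qed.

Definition coth_term c (d : nat) : R := c / (c ^+ 2 + d.+1%:R ^+ 2).

Lemma coth_term_cvg c : 0 < c -> cvgn (series (coth_term c)).
Proof.
move=> c0; apply: (@cvg_series_dom _ _ (fun d => c * inv_sqr R d)).
  move=> d; rewrite /coth_term /inv_sqr ger0_norm.
    rewrite ler_wpM2l ?(ltW c0)// lef_pV2 ?posrE ?exprn_gt0 ?ltr0n//.
      by rewrite lerDr sqr_ge0.
    by rewrite ltr_wpDl ?sqr_ge0// exprn_gt0// ltr0n.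
  by rewrite divr_ge0 ?addr_ge0 ?sqr_ge0// ltW.
by apply: cvg_seriesZ; exact: inv_sqr_cvg.
Qed.

(* Obtained from poisson_sum at r = exp(-2 pi c/N) by letting N tend to infinity. *)
Lemma coth_series c : 0 < c ->
  c^-1 + 2 * limn (series (coth_term c)) =
  pi * ((1 + expR (- (2 * pi * c))) / (1 - expR (- (2 * pi * c)))).
Proof.
move=> c0; have p0 := pi_gt0 R; have pn := lt0r_neq0 p0; set rho := expR _.
pose N M : R := (2 * M + 1)%:R.
have N0 M : 0 < N M by rewrite ltr0n addn1.
pose r M := expR (- (2 * pi * c) / N M).
have r01 M : 0 < r M < 1.
  by rewrite expR_gt0 expR_lt1 mulNr oppr_lt0 divr_gt0// !mulr_gt0.
have rN M : r M ^+ (2 * M + 1) = rho.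
  by rewrite /r -expRM_natl mulrC divfK// gt_eqF.
have der_exp : is_derive (0:R) (1:R) (fun x => expR x + (-1)) 1.
  apply: is_derive_eq (derD (is_derive_expR (0:R)) (is_derive_cst (-1 : R) (0:R) 1)) _.
  by rewrite expR0 addr0.
have exp00 : expR 0 + (-1) = 0 :> R by rewrite expR0 subrr.
have cb := seqZ (-1) (cvg_scaled_derive (x := - (2 * pi * c)) der_exp exp00).
have ca := seqZ (-1) (cvg_scaled_derive (x := - (4 * pi * c)) der_exp exp00).
have r2 M : expR (- (4 * pi * c) / N M) = r M ^+ 2.
  by rewrite /r -expRM_natl; congr expR; ring.
have {ca}ca : (fun M => N M * (1 - r M ^+ 2)) @ \oo --> 4 * pi * c.
  have -> : 4 * pi * c = -1 * (- (4 * pi * c) * 1) by ring.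
  by apply: seq_eq ca => M; rewrite -r2 /N; ring.
have {cb}cb : (fun M => N M * (1 - r M)) @ \oo --> 2 * pi * c.
  have -> : 2 * pi * c = -1 * (- (2 * pi * c) * 1) by ring.
  by apply: seq_eq cb => M; rewrite /r /N; ring.
have cr : r @ \oo --> (1 : R).
  have c1 : (fun _ : nat => 1 : R) @ \oo --> (1 : R) by exact: cvg_cst.
  have := seqD c1 (seqZ (-1) (seqM cb cvg_odd_inv)).
  rewrite !mulr0 addr0; apply: seq_eq => M /=.
  rewrite -/(N M) mulrAC divff ?gt_eqF//; ring.
have cs d : (fun M => N M * sin (d.+1%:R * pi / N M)) @ \oo --> d.+1%:R * pi.
  have := @cvg_scaled_derive (@sin R) _ (d.+1%:R * pi) (is_derive_sin 0) (sin0 R).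
  by rewrite cos0 mulr1; exact.
(* The denominator of the kernel at angle t is (1 - r)^2 + 4 r sin(t/2)^2; after scaling by N both
   squares have a limit. *)
have poissonE M d : poisson (r M) (d%:R * (2 * pi / N M)) / N M =
    N M * (1 - r M ^+ 2) /
    ((N M * (1 - r M)) ^+ 2 + 4 * r M * (N M * sin (d%:R * pi / N M)) ^+ 2).
  have h : cos (d%:R * (2 * pi / N M)) = 1 - 2 * sin (d%:R * pi / N M) ^+ 2.
    have -> : d%:R * (2 * pi / N M) = (d%:R * pi / N M) *+ 2 by rewrite -mulr_natr; ring.
    by rewrite cos_mulr2n cos2sin2 mulr2n; ring.
  have := poisson_den_gt0 (d%:R * (2 * pi / N M)) (r01 M); rewrite /poisson h => D0.
  have D1 : (N M * (1 - r M)) ^+ 2 + 4 * r M * (N M * sin (d%:R * pi / N M)) ^+ 2 =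
    N M ^+ 2 * (1 - 2 * r M * (1 - 2 * sin (d%:R * pi / N M) ^+ 2) + r M ^+ 2) by ring.
  rewrite D1; move: (1 - 2 * r M * _ + _) D0 => D D0.
  by field; rewrite !gt_eqF.
(* Extension by zero turns the finite sums into series, as [tannery] requires. *)
pose f M d := if (d < M)%N then poisson (r M) (d.+1%:R * (2 * pi / N M)) / N M else 0.
have lim_f : (fun M => limn (series (f M))) @ \oo --> limn (series (fun d => pi^-1 * coth_term c d)).
  apply: (@tannery _ _ _ _ _ _ (fun d => 4 * pi * c * expR (2 * pi * c) / pi ^+ 2 * inv_sqr R d)).
  - move=> d.
    have : (fun M => poisson (r M) (d.+1%:R * (2 * pi / N M)) / N M) @ \oo --> pi^-1 * coth_term c d.
      have -> : pi^-1 * coth_term c d =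
          4 * pi * c / ((2 * pi * c) ^+ 2 + 4 * 1 * (d.+1%:R * pi) ^+ 2).
        rewrite /coth_term; set x := d.+1%:R.
        have : 0 < c ^+ 2 + x ^+ 2 by rewrite ltr_wpDr ?sqr_ge0// exprn_gt0.
        have -> : (2 * pi * c) ^+ 2 + 4 * 1 * (x * pi) ^+ 2 = 4 * pi ^+ 2 * (c ^+ 2 + x ^+ 2) by ring.
        move: (c ^+ 2 + x ^+ 2) (pi : R) pn => D P Pn D0.
        by field; rewrite Pn gt_eqF.
      apply: seq_eq (seqM ca (cvgV _ (seqD (seqM cb cb) (seqM (seqZ 4 cr) (seqM (cs d) (cs d)))))) => [M|].
        by rewrite poissonE !expr2.
      by rewrite gt_eqF// ltr_pwDl ?mulr_ge0 ?(ltW c0) ?(ltW p0)// !mulr_gt0.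
    move=> h; apply: cvg_trans h; apply: near_eq_cvg; exists d.+1 => // M /= dM.
    by rewrite /f dM.
  - near=> M => d; rewrite /f; case: ifP => dM; last first.
      by rewrite normr0 !mulr_ge0 ?invr_ge0 ?expR_ge0 ?sqr_ge0 ?inv_sqr_ge0// ltW.
    rewrite poissonE.
    have [r0 r1] := andP (r01 M).
    set x : R := d.+1%:R; have x0 : 0 < x by rewrite ltr0n.
    have num_ge0 : 0 <= N M * (1 - r M ^+ 2).
      by rewrite mulr_ge0 ?(ltW (N0 M))// subr_ge0 expr_le1// ltW.
    have num_le : N M * (1 - r M ^+ 2) <= 4 * pi * c.
      rewrite -r2 mulrC -ler_pdivlMr//.
      by have := expR_ge1Dx (- (4 * pi * c) / N M); rewrite mulNr; lra.
    have sin_ge : pi * x / 2 <= N M * sin (x * pi / N M).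
      have xN : x * pi / N M <= pi / 2.
        have xN2 : 2 * x <= N M by rewrite /x /N -natrM ler_nat; lia.
        rewrite ler_pdivrMr// -subr_ge0 (_ : _ - _ = pi / 2 * (N M - 2 * x)).
          by rewrite mulr_ge0 ?subr_ge0// divr_ge0// ltW.
        by field.
      have := @half_le_sin (x * pi / N M); rewrite xN andbT => /(_ _) h.
      have {}h : x * pi / N M / 2 <= sin (x * pi / N M).
        by apply: h; rewrite divr_ge0 ?mulr_ge0 ?(ltW (N0 M)) ?ltW.
      have := ler_wpM2l (ltW (N0 M)) h; apply: le_trans.
      by rewrite le_eqVlt; apply/orP; left; apply/eqP; field; rewrite gt_eqF.
    have r_ge : expR (- (2 * pi * c)) <= r M.
      rewrite ler_expR !mulNr lerN2 ler_pdivrMr// ler_peMr ?mulr_ge0 ?(ltW p0) ?(ltW c0)//.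
      by rewrite /N ler1n addn1.
    (* A lower bound uniform in M: the first square is dropped, r is at least exp(-2 pi c), and the
       sine is bounded below by [half_le_sin]. *)
    have den : expR (- (2 * pi * c)) * (pi * x) ^+ 2 <=
        (N M * (1 - r M)) ^+ 2 + 4 * r M * (N M * sin (x * pi / N M)) ^+ 2.
      apply: (@le_trans _ _ (4 * r M * (N M * sin (x * pi / N M)) ^+ 2)); last by rewrite lerDr sqr_ge0.
      have s2 : (pi * x / 2) ^+ 2 <= (N M * sin (x * pi / N M)) ^+ 2.
        by rewrite lerXn2r ?nnegrE// ?(le_trans _ sin_ge)// divr_ge0// mulr_ge0 ?ltW.
      have -> : expR (- (2 * pi * c)) * (pi * x) ^+ 2 = 4 * expR (- (2 * pi * c)) * (pi * x / 2) ^+ 2 by field.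
      by rewrite ler_pM ?sqr_ge0 ?mulr_ge0 ?expR_ge0// ler_wpM2l.
    have den0 : 0 < expR (- (2 * pi * c)) * (pi * x) ^+ 2.
      by rewrite mulr_gt0 ?expR_gt0// exprn_gt0// mulr_gt0.
    rewrite ger0_norm; last by rewrite divr_ge0// (le_trans (ltW den0)).
    have -> : 4 * pi * c * expR (2 * pi * c) / pi ^+ 2 * inv_sqr R d =
        (4 * pi * c) / (expR (- (2 * pi * c)) * (pi * x) ^+ 2).
      rewrite /inv_sqr -/x expRN; have := expR_gt0 (2 * pi * c).
      move: (expR (2 * pi * c)) => e e0; move: (pi : R) pn => P Pn.
      by field; rewrite Pn !gt_eqF.
    rewrite ler_pM// ?invr_ge0 ?(le_trans (ltW den0))//.
    by rewrite lef_pV2// posrE// (lt_le_trans den0).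
  - by apply: cvg_seriesZ; exact: inv_sqr_cvg.
have lim0 : (fun M => poisson (r M) 0 / N M) @ \oo --> (pi * c)^-1.
  have -> : (pi * c)^-1 = 4 * pi * c / ((2 * pi * c) * (2 * pi * c)).
    by move: (pi : R) pn => P Pn; field; rewrite Pn gt_eqF.
  have den0 : 2 * pi * c * (2 * pi * c) != 0 by rewrite gt_eqF// !mulr_gt0.
  apply: seq_eq (seqM ca (cvgV den0 (seqM cb cb))) => M.
  have := poissonE M 0; rewrite !mul0r sin0 mulr0 expr0n mulr0 addr0 => ->.
  by rewrite expr2.
have rho1 : 1 - rho != 0.
  by rewrite subr_eq0 eq_sym lt_eqF// expR_lt1 oppr_lt0 !mulr_gt0.
have E M : poisson (r M) 0 / N M + 2 * limn (series (f M)) = (1 + rho) / (1 - rho).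
  have -> : limn (series (f M)) = (\sum_(d < M) poisson (r M) (d.+1%:R * (2 * pi / N M))) / N M.
    rewrite (limn_series_finite (M := M)); last by move=> k Mk; rewrite /f ltnNge Mk.
    rewrite /series /= big_mkord mulr_suml; apply: eq_bigr => i _.
    by rewrite /f ltn_ord.
  rewrite mulrA -mulrDl poisson_sum// rN -/(N M).
  by field; rewrite rho1 gt_eqF.
have := seqD lim0 (seqZ 2 lim_f).
under eq_fun do rewrite E.
move=> /(cvg_unique _ (cvg_cst _)) => /(_ (@Rhausdorff R)).
have -> : limn (series (fun d => pi^-1 * coth_term c d)) = pi^-1 * limn (series (coth_term c)).
  by apply: lim_seriesZ; apply: coth_term_cvg.
move=> ->; move: (pi : R) pn => P Pn.
by field; rewrite Pn gt_eqF.
Unshelve. all: by end_near. Qed.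

End CothSeries.

(** * Lipschitz' formula at positive real arguments *)

Section Lipschitz.
Variable R : realType.
Local Open Scope complex_scope.
Implicit Types (a c x : R) (k d q : nat).

Lemma is_derive_eq_pos (f g : R -> R) c (u v : R) : 0 < c ->
  (forall x, 0 < x -> f x = g x) ->
  is_derive c (1:R) f u -> is_derive c (1:R) g v -> u = v.
Proof.
move=> c0 fg /is_deriveP fu /is_deriveP gv.
apply: (cvg_unique _ fu) => //.
apply: cvg_trans gv; apply: near_eq_cvg.
exists c => //= h; rewrite /= sub0r normrN => hc h0.
by rewrite !fg//; move: hc; rewrite ltr_norml => /andP[]; lra.
Qed.

Lemma derX (f : R -> R) k x a : is_derive x (1:R) f a ->
  is_derive x (1:R) (fun y => f y ^+ k) (k%:R * f x ^+ k.-1 * a).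
Proof.
move=> fa; elim: k => [|k IH].
  rewrite !mul0r (_ : (fun y => _) = fun=> 1); first exact: is_derive_cst.
  by apply/funext => y; rewrite expr0.
rewrite (_ : (fun y => _) = fun y => f y * f y ^+ k); last by apply/funext => y; rewrite exprS.
apply: is_derive_eq (derM fa IH) _; rewrite /= -[k.+1%:R]natr1.
by case: k {IH} => [|k] /=; rewrite ?expr0 ?exprS; ring.
Qed.

Definition sqnorm (z : R[i]) : R := complex.Re z ^+ 2 + complex.Im z ^+ 2.

Lemma sqnormM z w : sqnorm (z * w) = sqnorm z * sqnorm w.
Proof. by rewrite /sqnorm cReM cImM; ring. Qed.

Lemma sqnormX z k : sqnorm (z ^+ k) = sqnorm z ^+ k.
Proof.
elim: k => [|k IH]; first by rewrite /sqnorm !expr0 /= expr1n expr0n addr0.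
by rewrite !exprS sqnormM IH.
Qed.

Lemma sqnorm_lin_inv (a b : R) : b != 0 -> sqnorm ((a +i* b)^-1) <= (b ^+ 2)^-1.
Proof.
move=> b0; rewrite complexV /sqnorm /=.
have b2 : 0 < b ^+ 2 by rewrite exprn_even_gt0.
have n0 : 0 < a ^+ 2 + b ^+ 2 by rewrite ltr_wpDl ?sqr_ge0.
have -> : (a / (a ^+ 2 + b ^+ 2)) ^+ 2 + (- b / (a ^+ 2 + b ^+ 2)) ^+ 2 = (a ^+ 2 + b ^+ 2)^-1.
  by field; rewrite gt_eqF.
by rewrite lef_pV2// lerDr sqr_ge0.
Qed.

Definition lattice_term a k d : R := complex.Re ((a +i* d.+1%:R)^-1 ^+ k).

Lemma lattice_term_le a k d : (2 <= k)%N -> `|lattice_term a k d| <= inv_sqr R d.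
Proof.
move=> k2; rewrite /lattice_term; set z := (_ +i* _)^-1.
have zb : sqnorm z <= inv_sqr R d.
  by apply: sqnorm_lin_inv; rewrite pnatr_eq0.
have z0 : 0 <= sqnorm z by rewrite addr_ge0 ?sqr_ge0.
have b1 : inv_sqr R d <= 1.
  by rewrite /inv_sqr invf_le1 ?exprn_gt0 ?ltr0n// exprn_ege1// ler1n.
rewrite -(@ler_pXn2r _ 2)// ?nnegrE ?inv_sqr_ge0// real_normK ?num_real//.
apply: (@le_trans _ _ (sqnorm (z ^+ k))); first by rewrite lerDl sqr_ge0.
rewrite sqnormX; apply: (@le_trans _ _ (inv_sqr R d ^+ k)).
  by rewrite lerXn2r ?nnegrE ?inv_sqr_ge0.
by rewrite ler_wiXn2l ?inv_sqr_ge0.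
Qed.

Lemma lattice_term1 a d : lattice_term a 1 d = coth_term a d.
Proof. by rewrite /lattice_term expr1 complexV. Qed.

Lemma lattice_term_cvg a k : 0 < a -> (0 < k)%N -> cvgn (series (lattice_term a k)).
Proof.
move=> a0; case: k => // -[|k] _.
  under [lattice_term a 1]funext do rewrite lattice_term1.
  exact: coth_term_cvg.
apply: (@cvg_series_dom _ _ (inv_sqr R)); last exact: inv_sqr_cvg.
by move=> d; exact: lattice_term_le.
Qed.

Lemma lattice_term_derive k d x :
  is_derive x (1:R) (fun a => lattice_term a k d) (- k%:R * lattice_term x k.+1 d).
Proof.
have d0 : d.+1%:R != 0 :> R by rewrite pnatr_eq0.
(* Writing a + in = i(n - ia) moves the variable into the imaginary part, as [cderive_lin_exp]
   expects. *)
have E a : (a +i* d.+1%:R)^-1 = (0 +i* (-1)) * (d.+1%:R +i* (- (a + 0)))^-1.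
  by rewrite !complexV; apply: complex_eqP; rewrite ?cReM ?cImM /= addr0 sqrrN [d.+1%:R ^+ 2 + _]addrC; ring.
have [h _] := cderiveM (cderive_cst ((0 +i* (-1)) ^+ k) x) (cderive_lin_exp 0 x k d0).
rewrite (_ : (fun a => lattice_term a k d) =
   fun a => complex.Re ((0 +i* (-1)) ^+ k * (d.+1%:R +i* (- (a + 0)))^-1 ^+ k)); last first.
  by apply/funext => a; rewrite /lattice_term E exprMn.
apply: is_derive_eq h _; rewrite mul0r add0r /lattice_term E exprMn.
have -> : - k%:R * complex.Re ((0 -i* 1) ^+ k.+1 * (d.+1%:R -i* (x + 0))^-1 ^+ k.+1) =
   complex.Re ((- k%:R)%:C * ((0 -i* 1) ^+ k.+1 * (d.+1%:R -i* (x + 0))^-1 ^+ k.+1)).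
  by rewrite [in RHS]cReM /= mul0r subr0.
congr complex.Re; rewrite !mulrA; congr (_ * _).
rewrite rmorphN rmorph_nat exprS.
have -> : (0 -i* 1 : R[i]) = - (0 +i* 1) by apply: complex_eqP; rewrite /= ?oppr0.
ring.
Qed.

Definition exp_term c k q : R := q.+1%:R ^+ k * expR (- (2 * pi * c * q.+1%:R)).

Lemma exp_term_cvg c k : 0 < c -> cvgn (series (exp_term c k)).
Proof. by move=> c0; apply: cvg_pow_exp; rewrite !mulr_gt0 ?pi_gt0. Qed.

Lemma exp_term_derive k q x :
  is_derive x (1:R) (fun c => exp_term c k q) (- (2 * pi) * exp_term x k.+1 q).
Proof.
have d1 : is_derive x (1:R) (fun c => (- (2 * pi * q.+1%:R)) * c) (- (2 * pi * q.+1%:R) * 1).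
  exact: derZ (is_derive_id x 1).
have d2 := is_derive1_comp (is_derive_expR (- (2 * pi * q.+1%:R) * x)) d1.
have := derZ (q.+1%:R ^+ k) d2.
rewrite (_ : (fun y => _) = fun c => exp_term c k q); last first.
  by apply/funext => c; rewrite /exp_term /=; congr (_ * expR _); ring.
move=> h; apply: is_derive_eq h _; rewrite /exp_term exprS.
have -> : - (2 * pi * q.+1%:R) * x = - (2 * pi * x * q.+1%:R) by ring.
ring.
Qed.

Lemma lim_exp_term0 c : 0 < c ->
  limn (series (exp_term c 0)) = expR (- (2 * pi * c)) / (1 - expR (- (2 * pi * c))).
Proof.
move=> c0; set rho := expR _.
have r0 : 0 < rho by rewrite expR_gt0.
have r1 : rho < 1 by rewrite expR_lt1 oppr_lt0 !mulr_gt0 ?pi_gt0.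
apply: cvg_lim => //.
have -> : exp_term c 0 = geometric rho rho.
  apply/funext => q; rewrite /exp_term /= expr0 mul1r -exprS /rho -expRM_natl.
  by congr expR; ring.
by apply: cvg_geometric_series; rewrite gtr0_norm.
Qed.

(** For k = 0 this is the cotangent series together with the geometric series of exponentials.
    Differentiating both sides termwise in c raises k, and the constant pi disappears at the first
    differentiation. *)
Lemma lipschitz_formula c k : 0 < c ->
  c^-1 ^+ k.+1 + 2 * limn (series (lattice_term c k.+1)) =
  (if k == 0%N then pi else 0) +
  (2 * pi) ^+ k.+1 / k`!%:R * limn (series (exp_term c k)).
Proof.
move=> c0; elim: k c c0 => [|k IH] c c0.
  under [lattice_term c 1]funext do rewrite lattice_term1.
  rewrite expr1 coth_series// lim_exp_term0// eqxx fact0 invr1.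
  have : 1 - expR (- (2 * pi * c)) != 0.
    by rewrite subr_eq0 eq_sym lt_eqF// expR_lt1 oppr_lt0 !mulr_gt0 ?pi_gt0.
  by move: (expR _) => r r1; field.
(* On the ball of radius c/2 around c the exponential terms are dominated by their values at c/2. *)
have c2 : 0 < c / 2 by rewrite divr_gt0.
have ball x : `|x - c| < c / 2 -> c / 2 < x.
  by rewrite ltr_norml => /andP[]; lra.
have dL : is_derive c (1:R) (fun x => limn (series (fun d => lattice_term x k.+1 d)))
    (limn (series (fun d => - k.+1%:R * lattice_term c k.+2 d))).
  apply: (@series_is_derive _ (fun d x => lattice_term x k.+1 d)
    (fun d x => - k.+1%:R * lattice_term x k.+2 d) (fun d => k.+1%:R * inv_sqr R d) _ _ c2).
  - by move=> d x _; exact: lattice_term_derive.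
  - move=> d x _; rewrite normrM normrN normr_nat ler_wpM2l//.
    exact: lattice_term_le.
  - by apply: cvg_seriesZ; exact: inv_sqr_cvg.
  - move=> x /ball xc; apply: lattice_term_cvg => //; exact: lt_trans xc.
have dE : is_derive c (1:R) (fun x => limn (series (fun q => exp_term x k q)))
    (limn (series (fun q => - (2 * pi) * exp_term c k.+1 q))).
  apply: (@series_is_derive _ (fun q x => exp_term x k q)
    (fun q x => - (2 * pi) * exp_term x k.+1 q)
    (fun q => 2 * pi * exp_term (c / 2) k.+1 q) _ _ c2).
  - by move=> q x _; exact: exp_term_derive.
  - move=> q x /ball xc; rewrite normrM normrN [`|2 * pi|]ger0_norm ?mulr_ge0 ?pi_ge0//.
    rewrite ler_wpM2l ?mulr_ge0 ?pi_ge0//.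
    rewrite /exp_term ger0_norm ?mulr_ge0 ?expR_ge0 ?exprn_ge0//.
    by rewrite ler_wpM2l ?exprn_ge0// ler_expR lerN2 ler_wpM2r// ler_wpM2l ?mulr_ge0 ?pi_ge0// ltW.
  - by apply: cvg_seriesZ; exact: exp_term_cvg.
  - move=> x /ball xc; apply: exp_term_cvg => //; exact: lt_trans xc.
have dV0 : is_derive c (1:R) (fun x => x^-1 ^+ k.+1) (- k.+1%:R * c^-1 ^+ k.+2).
  have dv := @derV R id c 1 (lt0r_neq0 c0) (is_derive_id c 1).
  apply: is_derive_eq (derX k.+1 dv) _.
  by rewrite /= !exprS; field; rewrite gt_eqF.
have dF := derD dV0 (derZ 2 dL).
have dG := derD (is_derive_cst (if k == 0%N then pi else 0 : R) c 1)
  (derZ ((2 * pi) ^+ k.+1 / k`!%:R) dE).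
have := is_derive_eq_pos c0 IH dF dG.
rewrite !lim_seriesZ; [|exact: exp_term_cvg|exact: lattice_term_cvg].
move=> h; apply: (mulfI (_ : - k.+1%:R != 0)); first by rewrite oppr_eq0 pnatr_eq0.
rewrite add0r mulrDr; transitivity
  (- k.+1%:R * c^-1 ^+ k.+2 + 2 * (- k.+1%:R * limn (series (lattice_term c k.+2)))); first by ring.
rewrite h add0r factS natrM [(2 * pi) ^+ k.+2]exprS.
have f0 : k`!%:R != 0 :> R by rewrite pnatr_eq0 -lt0n fact_gt0.
have k0 : k.+1%:R != 0 :> R by rewrite pnatr_eq0.
move: (2 * pi) (k`!%:R) f0 (k.+1%:R) k0 => P F F0 K K0.
by field; rewrite F0 K0.
Qed.

End Lipschitz.

(** * The three propagators attached to a primitive vector *)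

Section LatticeRows.
Variables (nu1 nu2 mu1 mu2 : int).
Hypothesis det1 : nu1 * mu2 - nu2 * mu1 = 1.

(** Momentum conservation makes the third row minus the sum of the other two, so the single
    condition [det1] makes all three pairs unimodular. *)
Definition row3 (x y : int) (r : option bool) : int :=
  match r with None => - (x + y) | Some false => x | Some true => y end.
Local Notation nu := (row3 nu1 nu2).
Local Notation mu := (row3 mu1 mu2).

Lemma row3_unimodular r s : r != s -> absz (nu r * mu s - nu s * mu r)%R = 1%N.
Proof. by case: r s => [[]|] [[]|] //= _; lia. Qed.

(* Satisfied by nu_r nu_s for distinct rows with nu_r, nu_s <> 0, since the three
   nu add up to 0. *)
Definition dominating : pred int := fun k =>
  (k == 0) || ((`|nu1| <= 2 * `|k|) && (`|nu2| <= 2 * `|k|)).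

(** Each |nu_i| is at most |nu_r| + |nu_s|, and this is at most 2 |nu_r nu_s| for nonzero
    integers. *)
Lemma row3_dominating r s : r != s -> nu r != 0 -> nu s != 0 ->
  dominating (nu r * nu s) /\ dominating (- (nu r * nu s)).
Proof.
rewrite /dominating => rs r0 s0; suff h : (`|nu1| <= 2 * `|nu r * nu s|) && (`|nu2| <= 2 * `|nu r * nu s|).
  by rewrite normrN h !orbT.
rewrite normrM; have r1 : 1 <= `|nu r| by lia.
have s1 : 1 <= `|nu s| by lia.
by case: r s rs r1 s1 {r0 s0} => [[]|] [[]|] //= _ r1 s1; apply/andP; split; nia.
Qed.

Definition row_bound : nat := ((absz nu1 + absz nu2) ^ 2)%N.

Lemma row3_bound r s : r != s -> (absz (nu r * nu s)%R <= row_bound)%N.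
Proof.
move=> _; rewrite abszM /row_bound expnS expn1.
by apply: leq_mul; [case: r => [[]|] | case: s => [[]|]] => /=; lia.
Qed.

Lemma row_bound_gt0 : (0 < row_bound)%N.
Proof.
rewrite /row_bound expn_gt0; have [h1|] := eqVneq nu1 0; last by lia.
have [h2|] := eqVneq nu2 0; last by lia.
by move: det1; rewrite h1 h2 !mul0r subrr.
Qed.

Lemma int_mul_eq1 (x y : int) : x * y = 1 -> absz y = 1%N.
Proof.
by move=> /(congr1 absz) /eqP; rewrite abszM muln_eq1 => /andP[_ /eqP].
Qed.

Lemma row3_zero r : nu r = 0 -> absz (mu r) = 1%N.
Proof.
case: r => [[]|] /= h; move: det1.
- by rewrite h mul0r subr0 => /int_mul_eq1.
- rewrite h mul0r sub0r -mulNr => /int_mul_eq1 //.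
- have -> : nu2 = - nu1 by lia.
  move=> d; have /int_mul_eq1 : nu1 * (mu1 + mu2) = 1 by lia.
  by rewrite abszN.
Qed.

Lemma two_nonzero_rows : exists r s : option bool, [/\ nu r != 0, nu s != 0 & r != s].
Proof.
have [h1|h1] := eqVneq nu1 0.
  exists (Some true), None; split=> //=; lia.
have [h2|h2] := eqVneq nu2 0.
  exists (Some false), None; split=> //=; lia.
by exists (Some false), (Some true).
Qed.

Variable R : realType.
Local Open Scope complex_scope.

Definition row_factor_real (n m d : int) (t x : R) : R :=
  ((n%:~R * x + m%:~R * d%:~R) ^+ 2 + (n%:~R * t) ^+ 2)^-1.

Lemma row_rot r (t x : R) (d : int) :
  (row nu mu r t%:C (rot d%:~R) (rot x))^-1 = (row_factor_real (nu r) (mu r) d t x)%:C.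
Proof.
rewrite /row_factor_real fmorphV; congr (_^-1).
rewrite /row !real_intr -!rmorphXn; apply: complex_eqP; rewrite /= ; ring.
Qed.

Definition weight_rows (a1 a2 a3 : nat) : seq (option bool) :=
  nseq a1 (Some false) ++ nseq a2 (Some true) ++ nseq a3 None.

Lemma size_weight_rows a1 a2 a3 : size (weight_rows a1 a2 a3) = (a1 + a2 + a3)%N.
Proof. by rewrite /weight_rows !size_cat !size_nseq addnA. Qed.

Lemma prod_weight_rows (K : comPzRingType) (F : option bool -> K) a1 a2 a3 :
  \prod_(r <- weight_rows a1 a2 a3) F r = F (Some false) ^+ a1 * F (Some true) ^+ a2 * F None ^+ a3.
Proof.
by rewrite /weight_rows !big_cat /= !big_nseq mulrA; rewrite !iter_mulr_1.
Qed.

Lemma mem_weight_rows a1 a2 a3 r : (0 < a1)%N -> (0 < a2)%N -> (0 < a3)%N ->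
  r \in weight_rows a1 a2 a3.
Proof.
move=> h1 h2 h3; rewrite /weight_rows !mem_cat !mem_nseq h1 h2 h3.
by case: r => [[]|].
Qed.

Definition jump_term (h : nat) (t : R) (d : int) (x : rat * int * nat) : R :=
  ratr x.1.1 * t ^+ x.2 / t ^+ h *
    complex.Re (((2 * x.1.2%:~R * t) +i* (- d%:~R))^-1 ^+ x.2).

Lemma Re_coef_term h (t : R) (d : int) x :
  complex.Re (coef_term h (t%:C : R[i]) (rot d%:~R) x) = jump_term h t d x.
Proof.
rewrite /coef_term /jump_term.
have -> : ratr x.1.1 = (ratr x.1.1 : R)%:C :> R[i] by rewrite fmorph_rat.
have -> : rot d%:~R + 2 * x.1.2%:~R * t%:C = (2 * x.1.2%:~R * t) +i* (- d%:~R) :> R[i].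
  rewrite /rot; have -> : 2 * x.1.2%:~R * t%:C = (2 * x.1.2%:~R * t)%:C :> R[i].
    by rewrite real_intr !rmorphM rmorph_nat.
  by apply: complex_eqP; rewrite /= ?addr0 ?add0r.
rewrite [in RHS]exprVn; move: ((_ -i* _) ^+ _)^-1 => z.
have -> : (ratr x.1.1 : R)%:C * t%:C ^+ x.2 / t%:C ^+ h = (ratr x.1.1 * t ^+ x.2 / t ^+ h)%:C :> R[i].
  rewrite -!rmorphXn -fmorphV -!rmorphM.
  by [].
by rewrite cReM /= mul0r subr0.
Qed.

Lemma complex_Re_sum (T : Type) (s : seq T) (F : T -> R[i]) :
  complex.Re (\sum_(x <- s) F x) = \sum_(x <- s) complex.Re (F x).
Proof.
by elim: s => [|x s IH]; rewrite ?big_nil// !big_cons cReD IH.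
Qed.

(** Since all three exponents are positive, every row occurs in the product, in particular two with
    nonzero nu, whichever these are; they start the partial fraction expansion. *)
Lemma row_expansion (a1 a2 a3 : nat) : (0 < a1)%N -> (0 < a2)%N -> (0 < a3)%N ->
  let w := (a1 + a2 + a3)%N in
  exists s : seq (rat * int * nat),
  [/\ all (admissible dominating (2 * w).-1 w.-1) s,
      \sum_(x <- s) `|x.1.1| <= ((step_cost row_bound (2 * w)) ^ w)%:R
    & forall (t : R) (d : int), 0 < t -> d != 0 ->
      primitive_with_jump (fun x => row_factor_real nu1 mu1 d t x ^+ a1 *
         row_factor_real nu2 mu2 d t x ^+ a2 *
         row_factor_real (- (nu1 + nu2)) (- (mu1 + mu2)) d t x ^+ a3)
       (pi * \sum_(x <- s) jump_term (2 * w).-1 t d x)].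
Proof.
move=> h1 h2 h3 w.
have [r [r' [nr nr' rr']]] := two_nonzero_rows.
have := @pole_sum_rows R[i] _ nu mu dominating row_bound isT row_bound_gt0
  row3_unimodular row3_dominating row3_bound (weight_rows a1 a2 a3) r r' row3_zero nr nr' rr'
  (mem_weight_rows _ h1 h2 h3) (mem_weight_rows _ h1 h2 h3).
rewrite size_weight_rows -/w => /pole_sum_primitive [F [[s [sa sB sF]] jump]].
exists s; split=> // t d t0 d0.
have := jump t d t0 d0; rewrite sF; last exact: rot_generic.
rewrite complex_Re_sum; under eq_bigr do rewrite Re_coef_term.
congr primitive_with_jump; apply/funext => x.
rewrite -prodfV prod_weight_rows !row_rot -!rmorphXn -!rmorphM /=.
by [].
Qed.

End LatticeRows.

(** * Unordered sums as limits along exhausting lists *)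

Section Exhaustion.
Variable R : realType.
Variable T : choiceType.
Implicit Types (a : T -> R) (A : nat -> seq T).

Lemma le_sum_subseq a (s1 s2 : seq T) : (forall x, 0 <= a x) -> uniq s1 -> uniq s2 ->
  {subset s1 <= s2} -> \sum_(x <- s1) a x <= \sum_(x <- s2) a x.
Proof.
move=> a0 u1 u2 s12; rewrite [leRHS](bigID (mem s1)) /= -[X in _ <= X + _]big_filter.
have p : perm_eq [seq i <- s2 | i \in s1] s1.
  apply: uniq_perm => //; first exact: filter_uniq.
  by move=> x; rewrite mem_filter /=; case: (boolP (x \in s1)) => //= /s12 ->.
by rewrite (perm_big _ p) /= lerDl sumr_ge0.
Qed.

(** Every finite set is contained in all late lists, which is what the comparison with the supremum
    over finite subsets uses. *)
Definition exhausting A := (forall M, uniq (A M)) /\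
  forall x, exists N, forall M, (N <= M)%N -> x \in A M.

Lemma exhausting_subset A (s : seq T) : exhausting A ->
  exists N, forall M, (N <= M)%N -> {subset s <= A M}.
Proof.
move=> [_ ex]; elim: s => [|x s [N hN]]; first by exists 0%N.
have [N' hN'] := ex x; exists (maxn N N') => M; rewrite geq_max => /andP[h1 h2] y.
by rewrite in_cons => /orP[/eqP->|]; [exact: hN'|exact: hN].
Qed.

Lemma sum_EFin_seq a (s : seq T) : uniq s ->
  (\sum_(x \in [set` s]) (a x)%:E = (\sum_(x <- s) a x)%:E)%E.
Proof. by move=> us; rewrite -fsbig_seq// sumEFin. Qed.

Lemma esum_of_cvg a A (l : R) : (forall x, 0 <= a x) -> exhausting A ->
  (fun M => \sum_(x <- A M) a x) @ \oo --> l ->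
  (\esum_(x in [set: T]) (a x)%:E = l%:E)%E.
Proof.
move=> a0 exA cA; have [uA _] := exA; apply/eqP; rewrite eq_le; apply/andP; split.
  apply: ge_ereal_sup => _ [X [finX _] <-].
  rewrite fsbig_finite//= sumEFin lee_fin.
  have [N hN] := exhausting_subset (finmap.enum_fset (fset_set X)) exA.
  rewrite -(cvg_lim _ cA)//; apply: limr_ge; first by apply/cvg_ex; eexists; exact: cA.
  exists N => // M /= NM.
  exact: le_sum_subseq a0 (finmap.fset_uniq _) (uA M) (hN M NM).
have le M : ((\sum_(x <- A M) a x)%:E <= \esum_(x in [set: T]) (a x)%:E)%E.
  apply: esum_ge; exists [set` A M]; last by rewrite sum_EFin_seq.
  by split=> //; exact: finite_seq.
case E : (\esum_(x in [set: T]) (a x)%:E)%E le => [s| |] le.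
- rewrite lee_fin -(cvg_lim _ cA)//; apply: limr_le; first by apply/cvg_ex; eexists; exact: cA.
  by exists 0%N => // M _; rewrite -lee_fin.
- by rewrite leey.
- by have := le 0%N; rewrite leeNy_eq.
Qed.

Lemma cvg_of_esum a A (l : R) : (forall x, 0 <= a x) -> exhausting A ->
  (\esum_(x in [set: T]) (a x)%:E = l%:E)%E ->
  (fun M => \sum_(x <- A M) a x) @ \oo --> l.
Proof.
move=> a0 exA E; have [uA _] := exA.
have le M : \sum_(x <- A M) a x <= l.
  rewrite -lee_fin -E; apply: esum_ge; exists [set` A M]; last by rewrite sum_EFin_seq.
  by split=> //; exact: finite_seq.
apply/cvgrPdist_le => e e0.
have : (ereal_sup [set \sum_(x \in X) (a x)%:E | X in fsets [set: T]] > (l - e)%:E)%E.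
  by rewrite -/(esum _ _) E lte_fin; lra.
move=> /ereal_sup_gt [_ [X [finX _] <-]].
rewrite fsbig_finite//= sumEFin lte_fin => lX.
have [N hN] := exhausting_subset (finmap.enum_fset (fset_set X)) exA.
exists N => // M /= NM; rewrite ger0_norm ?subr_ge0//.
have := le_sum_subseq a0 (finmap.fset_uniq _) (uA M) (hN M NM); lra.
Qed.

End Exhaustion.

(** * Unfolding the integral over the unit interval *)

Section Unfolding.
Variable R : realType.

Lemma telescope_shift (H : nat -> R) (g L : nat) :
  \sum_(l < L) (H (l + g)%N - H l) = \sum_(i < g) (H (L + i)%N - H i).
Proof.
elim: L => [|L IH]; first by rewrite big_ord0 big1// => i _; rewrite subrr.
rewrite big_ord_recr /= IH.
have : \sum_(i < g.+1) H (L + i)%N = \sum_(i < g) H (L + i)%N + H (L + g)%N by rewrite big_ord_recr.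
rewrite big_ord_recl /= addn0; under eq_bigr do rewrite /bump /= add1n addnS -addSn.
rewrite !sumrB; move: (\sum_(i < g) H _) => x; lra.
Qed.

Definition window (M : nat) : seq int := [seq l%:Z - M%:Z | l <- iota 0 (2 * M)].

Lemma window_exhausting : exhausting window.
Proof.
split=> [M|j]; first by rewrite map_inj_uniq ?iota_uniq// => i k /addIr [].
exists (absz j).+1 => M jM; apply/mapP; exists (absz (j + M%:Z)).
  by rewrite mem_iota; lia.
by lia.
Qed.

(** The intervals [j, j + g] cover the line g times, while the substitution contributes 1/g. Over a
    window of j the differences of the primitive telescope to g boundary differences, each of which
    tends to J. *)
Lemma unfold_integral (f : R -> R) (J : R) (g : nat) : (0 < g)%N ->
  (forall x, 0 <= f x) -> continuous f -> primitive_with_jump f J ->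
  (forall j : int, exists v : R, \int[lebesgue_measure]_(x in `[0%R, 1%R]) (f (j%:~R + g%:R * x))%:E = v%:E)%E /\
  (\esum_(j in [set: int]) \int[lebesgue_measure]_(x in `[0%R, 1%R]) (f (j%:~R + g%:R * x))%:E = J%:E)%E.
Proof.
move=> g0 f0 cf [G [dG cG]].
have g0' : g%:R != 0 :> R by rewrite pnatr_eq0 -lt0n.
have intE (j : int) : (\int[lebesgue_measure]_(x in `[0%R, 1%R]) (f (j%:~R + g%:R * x))%:E =
   ((G (j%:~R + g%:R) - G j%:~R) / g%:R)%:E)%E.
  pose F (x : R) := g%:R^-1 * G (g%:R * x + j%:~R).
  have dF (x : R) : is_derive x (1:R) F (f (j%:~R + g%:R * x)).
    have d1 : is_derive x (1:R) (fun y => g%:R * y + j%:~R) (g%:R * 1 + 0).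
      exact: derD (derZ g%:R (is_derive_id x 1)) (is_derive_cst _ x 1).
    have := derZ g%:R^-1 (@is_derive1_comp _ G (fun y => g%:R * y + j%:~R) x _ _ (dG (g%:R * x + j%:~R)) d1).
    move=> h; apply: is_derive_eq h _.
    by rewrite mulr1 addr0 mulrC mulfK// addrC.
  have cF x : {for x, continuous F}.
    apply: differentiable_continuous; apply/derivable1_diffP.
    by have [] := dF x.
  have cfj : continuous (fun x : R => f (j%:~R + g%:R * x)).
    move=> x; apply: (cvg_comp (fun y : R => j%:~R + g%:R * y) f _ (cf _)).
    by apply: cvgD; [exact: cvg_cst|apply: cvgM; [exact: cvg_cst|exact: cvg_id]].
  rewrite (@continuous_FTC2 _ _ F) //.
  - by rewrite -EFinB /F mulr1 mulr0 add0r [g%:R + _]addrC -mulrBr mulrC.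
  - exact: continuous_subspaceT.
  - split.
    + by move=> x _; have [] := dF x.
    + exact: cvg_at_right_filter (cF 0).
    + exact: cvg_at_left_filter (cF 1).
  - by move=> x _; rewrite derive1E; have [_ ->] := dF x.
split=> [j|]; first by eexists; exact: intE.
under eq_esum do rewrite intE.
apply: (esum_of_cvg _ window_exhausting) => [j|].
  by rewrite -lee_fin -intE; apply: integral_ge0 => x _; rewrite lee_fin.
have cJ : (fun M : nat => g%:R^-1 * series (fun i => G (M%:R + i%:R) - G (- M%:R + i%:R)) g) @ \oo --> J.
  have := seqZ g%:R^-1 (@cvg_series_partial R nat \oo _
    (fun M i => G (M%:R + i%:R) - G (- M%:R + i%:R)) (fun=> J) g (fun i => cG i%:R)).
  have -> : series (fun=> J) g = g%:R * J.
    by rewrite /series /= sumr_const_nat subn0 mulr_natl.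
  by rewrite mulKf//; apply.
apply: seq_eq cJ => M; have iE : iota 0 (2 * M) = index_iota 0 (2 * M) by rewrite /index_iota subn0.
rewrite /window big_map /series /= iE !big_mkord.
pose H (l : nat) := G (l%:R - M%:R).
transitivity (g%:R^-1 * \sum_(i < g) (H (2 * M + i)%N - H i)).
  congr (_ * _); apply: eq_bigr => i _; rewrite /H; congr (G _ - G _).
    by rewrite natrD natrM; ring.
  by rewrite addrC.
rewrite -telescope_shift mulr_sumr; apply: eq_bigr => l _.
by rewrite /H mulrC intrB; congr ((G _ - G _) / _); rewrite natrD; ring.
Qed.

End Unfolding.

(** * The total contribution of one primitive direction *)

Section RowTotal.
Variable R : realType.
Local Open Scope complex_scope.

Lemma primitive_eq (f g : R -> R) (J J' : R) : f =1 g -> J = J' ->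
  primitive_with_jump f J -> primitive_with_jump g J'.
Proof. by move=> /funext -> ->. Qed.

Lemma primitiveZ (k : R) (f : R -> R) J : primitive_with_jump f J ->
  primitive_with_jump (fun x => k * f x) (k * J).
Proof.
move=> [G [dG cG]]; exists (fun x => k * G x); split=> [x|a]; first exact: derZ.
by apply: seq_eq (seqZ k (cG a)) => M; ring.
Qed.

Lemma cvg_inv_sqr_shift (s : bool) (a T : R) : 0 < T ->
  (fun M : nat => (T ^+ 2 + ((-1) ^+ s * M%:R + a) ^+ 2)^-1) @ \oo --> (0 : R) /\
  (fun M : nat => ((-1) ^+ s * M%:R + a) / (T ^+ 2 + ((-1) ^+ s * M%:R + a) ^+ 2)) @ \oo --> (0 : R).
Proof.
move=> T0; have Tn := lt0r_neq0 T0.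
have [h1 h2] := @cvg_shift_inv R s a T Tn _ (fun M => erefl); split=> //.
have := seqZ T^-1 h1; rewrite mulr0; apply: seq_eq => M.
by rewrite mulrA mulVf// mul1r.
Qed.

(* Integration by parts: (x (x^2+T^2)^-w)' relates the exponents w and w+1. *)
Lemma primitive_inv_sqr_pow (w : nat) : exists K : R, forall T, 0 < T ->
  primitive_with_jump (fun x => (T ^+ 2 + x ^+ 2)^-1 ^+ w.+1) (K / T ^+ (2 * w).+1).
Proof.
elim: w => [|w [K IH]].
  exists pi => T T0; have Tn := lt0r_neq0 T0.
  exists (fun x => T^-1 * atan ((x + 0) / T)); split=> [x|a].
    apply: is_derive_eq (derZ T^-1 (der_atan x 0 Tn)) _.
    rewrite addr0 expr1; have : T ^+ 2 + x ^+ 2 != 0.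
      by rewrite gt_eqF// ltr_wpDr ?sqr_ge0// exprn_gt0.
    by move=> n0; field; rewrite n0 Tn.
  have := seqZ T^-1 (cvg_atan_shift (a + 0) T0); rewrite expr1 [_^-1 * pi]mulrC.
  by apply: seq_eq => M; rewrite mulrBr !addrA.
exists ((2 * w%:R + 1) / (2 * w.+1%:R) * K) => T T0; have Tn := lt0r_neq0 T0.
have [G [dG cG]] := IH T T0.
pose A : R := (2 * w.+1%:R * T ^+ 2)^-1.
exists (fun x => A * (x * (T ^+ 2 + x ^+ 2)^-1 ^+ w.+1 + (2 * w%:R + 1) * G x)).
split=> [x|a].
  have n0 : T ^+ 2 + x ^+ 2 != 0.
    by rewrite gt_eqF// ltr_wpDr ?sqr_ge0// exprn_gt0.
  have d0 : is_derive x (1:R) (fun y => T ^+ 2 + y ^+ 2) (2 * x).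
    rewrite (_ : (fun _ => _) = fun y => T ^+ 2 + (y + 0) ^+ 2); last first.
      by apply/funext => y; rewrite addr0.
    by apply: is_derive_eq (der_sqr_shift x 0 (T ^+ 2)) _; rewrite addr0.
  have d1 := derX w.+1 (@derV R (fun y => T ^+ 2 + y ^+ 2) x _ n0 d0).
  have d2 := derZ A (derD (derM (is_derive_id x 1) d1) (derZ (2 * w%:R + 1) (dG x))).
  apply: is_derive_eq d2 _; rewrite /= mul1r.
  have E : x ^+ 2 = (T ^+ 2 + x ^+ 2) - T ^+ 2 by ring.
  move: (T ^+ 2 + x ^+ 2) n0 E => D D0 E.
  have xx : x * (w.+1%:R * D^-1 ^+ w * (- (2 * x) / D ^+ 2)) =
      - 2 * w.+1%:R * (D - T ^+ 2) * D^-1 ^+ w.+2.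
    by rewrite -E !exprS; field.
  have w0 : w.+1%:R != 0 :> R by rewrite pnatr_eq0.
  have wE : w.+1%:R = w%:R + 1 :> R by rewrite natr1.
  rewrite xx /A !exprS wE; rewrite wE in w0.
  by field; rewrite D0 Tn w0.
have lim (s : bool) : (fun M : nat => ((-1) ^+ s * M%:R + a) * (T ^+ 2 + ((-1) ^+ s * M%:R + a) ^+ 2)^-1 ^+ w.+1)
    @ \oo --> (0 : R).
  have [h1 h2] := cvg_inv_sqr_shift s a T0.
  elim: w {IH cG K A G dG} => [|w IH]; first by move: h2; apply: seq_eq => M; rewrite expr1.
  by have := seqM IH h1; rewrite mulr0; apply: seq_eq => M; rewrite [in RHS]exprSr mulrA.
have := seqZ A (seqD (seqD (lim false) (seqZ (-1) (lim true))) (seqZ (2 * w%:R + 1) (cG a))).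
rewrite mulr0 !add0r => h.
have -> : (2 * w%:R + 1) / (2 * w.+1%:R) * K / T ^+ (2 * w.+1).+1 = A * ((2 * w%:R + 1) * (K / T ^+ (2 * w).+1)).
  have -> : (2 * w.+1).+1 = ((2 * w).+1 + 2)%N by lia.
  have w0 : w.+1%:R != 0 :> R by rewrite pnatr_eq0.
  rewrite /A exprD; have := expf_neq0 (2 * w).+1 Tn.
  by move: (T ^+ (2 * w).+1) (w.+1%:R) w0 => u v v0 u0; field; rewrite u0 v0 Tn.
by apply: seq_eq h => M; rewrite expr0 expr1 mul1r mulN1r; ring.
Qed.

Lemma row_factor_continuous (n m d : int) (T : R) : 0 < T ->
  continuous (row_factor_real n m d T).
Proof.
move=> T0; rewrite /row_factor_real.
have [->|n0] := eqVneq n 0.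
  rewrite (_ : (fun _ => _) = fun=> ((m%:~R * d%:~R) ^+ 2 + (0 * T) ^+ 2)^-1); first exact: cst_continuous.
  by apply/funext => x; rewrite mul0r add0r.
move=> x; apply: cvgV.
  rewrite gt_eqF// ltr_wpDl ?sqr_ge0// exprn_even_gt0//=.
  by rewrite mulf_neq0 ?intr_eq0// gt_eqF.
apply: cvgD; last exact: cvg_cst.
rewrite expr2; under eq_fun do rewrite expr2.
by apply: cvgM; (apply: cvgD; [apply: cvgM; [exact: cvg_cst|exact: cvg_id]|exact: cvg_cst]).
Qed.

Lemma row_factor_ge0 (n m d : int) (T x : R) : 0 <= row_factor_real n m d T x.
Proof. by rewrite /row_factor_real invr_ge0 addr_ge0 ?sqr_ge0. Qed.

Lemma exp_fun_continuous (f : R -> R) k : continuous f -> continuous (fun x => f x ^+ k).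
Proof.
move=> cf; elim: k => [|k IH].
  by under eq_fun do rewrite expr0; exact: cst_continuous.
by under eq_fun do rewrite exprS; move=> x; apply: cvgM; [exact: cf|exact: IH].
Qed.

Lemma conj_lin_inv (a b : R) k :
  complex.Re ((a +i* (- b))^-1 ^+ k) = complex.Re ((a +i* b)^-1 ^+ k).
Proof.
have -> : (a +i* (- b)) = conjc (a +i* b) by [].
by rewrite -fmorphV -rmorphXn; case: (_ ^+ _).
Qed.

Lemma neg_lin_inv (a b : R) k :
  complex.Re ((- a +i* b)^-1 ^+ k) = (-1) ^+ k * complex.Re ((a +i* b)^-1 ^+ k).
Proof.
have -> : (- a +i* b) = - (a +i* (- b)) by apply: complex_eqP; rewrite /= ?opprK.
rewrite invrN [X in complex.Re X = _]exprNn.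
have -> : ((-1) ^+ k : R[i]) = ((-1) ^+ k)%:C by rewrite rmorphXn rmorphN1.
by rewrite cReM /= mul0r subr0 conj_lin_inv.
Qed.

Lemma lattice_termN (a : R) k d : lattice_term (- a) k d = (-1) ^+ k * lattice_term a k d.
Proof. exact: neg_lin_inv. Qed.

Lemma lattice_term_is_cvg (a : R) k : (0 < k)%N -> cvgn (series (lattice_term a k)).
Proof.
move=> k0; have [a0|a0|->] := ltgtP a 0.
- have cN := @lattice_term_cvg R (- a) k; rewrite oppr_gt0 in cN.
  have := cvg_seriesZ (k := (-1) ^+ k) (cN a0 k0).
  by under eq_fun do rewrite -lattice_termN opprK.
- exact: lattice_term_cvg.
- case: k k0 => // -[|k] _.
    under [lattice_term 0 1]funext do rewrite lattice_term1.
    apply: (@cvg_series_dom _ _ (inv_sqr R)); last exact: inv_sqr_cvg.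
    by move=> d; rewrite /coth_term mul0r normr0 inv_sqr_ge0.
  apply: (@cvg_series_dom _ _ (inv_sqr R)); last exact: inv_sqr_cvg.
  by move=> d; exact: lattice_term_le.
Qed.

Definition lattice_sum (a : R) k : R := limn (series (lattice_term a k)).

Lemma jump_term_pm h (T : R) (l : nat) x :
  jump_term h T l.+1%:Z x + jump_term h T (- l.+1%:Z) x =
  2 * (ratr x.1.1 * T ^+ x.2 / T ^+ h) * lattice_term (2 * x.1.2%:~R * T) x.2 l.
Proof.
rewrite /jump_term /lattice_term mulrNz opprK conj_lin_inv /=; ring.
Qed.

Definition sym_window (M : nat) : seq int :=
  0 :: [seq l.+1%:Z | l <- iota 0 M] ++ [seq - l.+1%:Z | l <- iota 0 M].

Lemma sym_window_exhausting : exhausting sym_window.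
Proof.
split=> [M|j].
  rewrite /sym_window /= cat_uniq mem_cat negb_or.
  rewrite !map_inj_uniq ?iota_uniq//=; last 2 first.
  - by move=> i k; lia.
  - by move=> i k; lia.
  apply/and3P; split=> //.
    by apply/andP; split; apply/mapP => -[l _]; lia.
  apply/hasPn => x /mapP[l _ ->]; apply/mapP => -[l' _]; lia.
exists (absz j) => M jM; rewrite /sym_window in_cons mem_cat.
have [//|j0] := eqVneq j 0; rewrite /=; apply/orP; have [jp|jn] := leP 0 j.
  by left; apply/mapP; exists (absz j).-1; [rewrite mem_iota; lia|lia].
by right; apply/mapP; exists (absz j).-1; [rewrite mem_iota; lia|lia].
Qed.

Lemma sum_sym_window (f : int -> R) (M : nat) :
  \sum_(d <- sym_window M) f d = f 0 + series (fun l => f l.+1%:Z + f (- l.+1%:Z)) M.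
Proof.
rewrite /sym_window big_cons big_cat /= !big_map -big_split /=.
by rewrite /series /= /index_iota subn0.
Qed.

Definition row_product (nu1 nu2 mu1 mu2 : int) (a1 a2 a3 : nat) (d : int) (T x : R) : R :=
  row_factor_real nu1 mu1 d T x ^+ a1 * row_factor_real nu2 mu2 d T x ^+ a2 *
  row_factor_real (- (nu1 + nu2)) (- (mu1 + mu2)) d T x ^+ a3.

Lemma row_product_ge0 nu1 nu2 mu1 mu2 a1 a2 a3 d T x :
  0 <= row_product nu1 nu2 mu1 mu2 a1 a2 a3 d T x.
Proof. by rewrite /row_product !mulr_ge0// exprn_ge0// row_factor_ge0. Qed.

Lemma row_product_continuous nu1 nu2 mu1 mu2 a1 a2 a3 d T : 0 < T ->
  continuous (row_product nu1 nu2 mu1 mu2 a1 a2 a3 d T).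
Proof.
move=> T0 x; rewrite /row_product.
by apply: cvgM; [apply: cvgM|]; apply: exp_fun_continuous; exact: row_factor_continuous.
Qed.

Lemma row_total (nu1 nu2 mu1 mu2 : int) (a1 a2 a3 : nat) :
  nu1 * mu2 - nu2 * mu1 = 1 -> (0 < a1)%N -> (0 < a2)%N -> (0 < a3)%N ->
  let w := (a1 + a2 + a3)%N in
  exists (s : seq (rat * int * nat)) (K : R),
  [/\ all (admissible (dominating nu1 nu2) (2 * w).-1 w.-1) s,
      \sum_(x <- s) `|x.1.1| <= ((step_cost (row_bound nu1 nu2) (2 * w)) ^ w)%:R
    & forall (T : R) (g : nat), 0 < T -> (0 < g)%N ->
      (\esum_(d in [set: int]) \esum_(j in [set: int])
         \int[lebesgue_measure]_(x in `[0%R, 1%R])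
           (row_product nu1 nu2 mu1 mu2 a1 a2 a3 d T (j%:~R + g%:R * x))%:E =
      (K / T ^+ (2 * w).-1 + \sum_(x <- s) 2 * pi * (ratr x.1.1 * T ^+ x.2 / T ^+ (2 * w).-1) *
         lattice_sum (2 * x.1.2%:~R * T) x.2)%:E)%E].
Proof.
move=> det1 h1 h2 h3 w.
have [s [sa sB sJ]] := row_expansion det1 R h1 h2 h3; rewrite -/w in sa sB sJ.
have [K hK] := primitive_inv_sqr_pow w.-1.
have w0 : (0 < w)%N by rewrite /w; lia.
(* If some row has nu = 0, then c0 = 0 by the convention [0^-1 = 0]; the product at d = 0 vanishes
   for the same reason, in accordance with the exclusion of zero momenta. *)
pose c0 : R := (nu1%:~R ^+ 2)^-1 ^+ a1 * (nu2%:~R ^+ 2)^-1 ^+ a2 * ((- (nu1 + nu2))%:~R ^+ 2)^-1 ^+ a3.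
exists s, (c0 * K); split=> // T g T0 g0.
(* At d = 0 the poles of different rows coincide and [generic] fails; the product is then a multiple
   of (T^2 + x^2)^-w. *)
pose J (d : int) : R := if d == 0 then c0 * K / T ^+ (2 * w).-1 else
  pi * \sum_(x <- s) jump_term (2 * w).-1 T d x.
have primJ d : primitive_with_jump (row_product nu1 nu2 mu1 mu2 a1 a2 a3 d T) (J d).
  rewrite /J; have [->|d0] := eqVneq d 0; last exact: sJ.
  apply: primitive_eq (primitiveZ c0 (hK T T0)) => [x|].
    rewrite prednK// /c0 /row_product /row_factor_real !mulr0 !addr0.
    have E (n : int) : ((n%:~R * x) ^+ 2 + (n%:~R * T) ^+ 2)^-1 = (n%:~R ^+ 2)^-1 * (T ^+ 2 + x ^+ 2)^-1.
      by rewrite -invfM; congr (_^-1); ring.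
    rewrite !E !exprMn /w !exprD; ring.
  by rewrite mulrA; congr (_ / T ^+ _); lia.
have U d := unfold_integral g0 (row_product_ge0 nu1 nu2 mu1 mu2 a1 a2 a3 d T)
  (@row_product_continuous nu1 nu2 mu1 mu2 a1 a2 a3 d T T0) (primJ d).
under eq_esum do rewrite (proj2 (U _)).
have J0 d : 0 <= J d.
  rewrite -lee_fin -(proj2 (U d)); apply: esum_ge0 => j _.
  by apply: integral_ge0 => x _; rewrite lee_fin row_product_ge0.
apply: (esum_of_cvg J0 sym_window_exhausting).
under eq_fun do rewrite sum_sym_window.
have -> : J 0 = c0 * K / T ^+ (2 * w).-1 by rewrite /J eqxx.
apply: seqD; first exact: cvg_cst.
have h : (fun M => \sum_(x <- s) (2 * pi * (ratr x.1.1 * T ^+ x.2 / T ^+ (2 * w).-1)) *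
    series (lattice_term (2 * x.1.2%:~R * T) x.2) M) @ \oo -->
    \sum_(x <- s) 2 * pi * (ratr x.1.1 * T ^+ x.2 / T ^+ (2 * w).-1) *
         lattice_sum (2 * x.1.2%:~R * T) x.2; last first.
  apply: seq_eq h => M; rewrite /series /=.
  under eq_bigr do rewrite mulr_sumr.
  rewrite exchange_big /=; apply: eq_bigr => l _.
  rewrite /J /= -mulrDr -big_split /= mulr_sumr; apply: eq_bigr => x _.
  by rewrite jump_term_pm; ring.
elim: s sa {sB sJ J primJ U J0} => [|x s IH] /=.
  by move=> _; rewrite big_nil; under eq_fun do rewrite big_nil; exact: cvg_cst.
move=> /andP[/and4P[_ x0 _ _] sa]; rewrite big_cons; under eq_fun do rewrite big_cons.
apply: seqD; last exact: IH.
by apply: seqZ; exact: lattice_term_is_cvg.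
Qed.

End RowTotal.

(** * Absolute convergence of the lattice sum, uniformly for tau_1 in [0, 1] *)

Section Summability.
Variable R : realType.

Lemma le_esumT (T : choiceType) (a b : T -> R) (l : R) : (forall x, 0 <= a x <= b x) ->
  (\esum_(x in [set: T]) (b x)%:E = l%:E)%E ->
  exists2 l', (\esum_(x in [set: T]) (a x)%:E = l'%:E)%E & l' <= l.
Proof.
move=> ab bl.
have le : (\esum_(x in [set: T]) (a x)%:E <= l%:E)%E.
  by rewrite -bl; apply: le_esum => x _; rewrite lee_fin; case/andP: (ab x).
have ge : (0 <= \esum_(x in [set: T]) (a x)%:E)%E.
  by apply: esum_ge0 => x _; rewrite lee_fin; case/andP: (ab x).
case: (\esum_(x in [set: T]) (a x)%:E)%E le ge => [l'| |] //=.
by move=> le _; exists l'; rewrite // -lee_fin.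
Qed.

Lemma esumT_scale (T : choiceType) (a : T -> R) (l k : R)
    (A : nat -> seq T) : exhausting A ->
  (forall x, 0 <= a x) -> 0 <= k ->
  (\esum_(x in [set: T]) (a x)%:E = l%:E)%E ->
  (\esum_(x in [set: T]) (k * a x)%:E = (k * l)%:E)%E.
Proof.
move=> exA a0 k0 al; apply: (esum_of_cvg _ exA) => [x|]; first exact: mulr_ge0.
by apply: seq_eq (seqZ k (cvg_of_esum a0 exA al)) => M; rewrite mulr_sumr.
Qed.

Definition box (M : nat) : seq (int * int) :=
  [seq (x, y) | x <- sym_window M, y <- sym_window M].

Lemma box_exhausting : exhausting box.
Proof.
have [u ex] := sym_window_exhausting; split=> [M|[x y]].
  by apply: allpairs_uniq => // -[? ?] [? ?].
have [N hN] := ex x; have [N' hN'] := ex y.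
exists (maxn N N') => M; rewrite geq_max => /andP[h1 h2].
by apply/allpairsP; exists (x, y); split; [exact: hN|exact: hN'|].
Qed.

Definition inv_abs (k : int) : R := (1 + `|k|%:~R)^-1.
(* The power 3/2 is summable over the integers and is what the inequality
   x y z <= (x y)^(3/2) + (x z)^(3/2) + (y z)^(3/2) produces. *)
Definition inv_abs32 (k : int) : R := inv_abs k * Num.sqrt (inv_abs k).

Lemma inv_abs_gt0 k : 0 < inv_abs k.
Proof. by rewrite /inv_abs invr_gt0 ltr_pwDl// ler0z. Qed.

Lemma inv_abs32_ge0 k : 0 <= inv_abs32 k.
Proof. by rewrite /inv_abs32 mulr_ge0 ?sqrtr_ge0// ltW// inv_abs_gt0. Qed.

Lemma inv_abs_le1 k : inv_abs k <= 1.
Proof. by rewrite /inv_abs invf_le1 ?ltr_pwDl ?ler0z// lerDl ler0z. Qed.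

(** With x = (l+1)^(-1/2) and y = (l+2)^(-1/2) one has x^2 - y^2 = x^2 y^2, so y^3 <= 2(x - y)
    reduces to y(x + y) <= 2x^2. *)
Lemma inv_abs32_telescope (l : nat) :
  inv_abs32 l.+1%:Z <= 2 * (Num.sqrt (l.+1%:R)^-1 - Num.sqrt (l.+2%:R)^-1).
Proof.
rewrite /inv_abs32 /inv_abs ger0_norm// -[l.+1%:~R]/(l.+1%:R) -[1]/(1%:R) -natrD add1n.
set x := Num.sqrt (l.+1%:R)^-1; set y := Num.sqrt (l.+2%:R)^-1.
have x2 : x ^+ 2 = (l.+1%:R)^-1 by rewrite sqr_sqrtr// invr_ge0.
have y2 : y ^+ 2 = (l.+2%:R)^-1 by rewrite sqr_sqrtr// invr_ge0.
have x0 : 0 < x by rewrite sqrtr_gt0 invr_gt0 ltr0n.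
have y0 : 0 < y by rewrite sqrtr_gt0 invr_gt0 ltr0n.
have xy : y <= x by rewrite ler_wsqrtr// lef_pV2 ?posrE ?ltr0n// ler_nat.
rewrite -y2.
have E : x ^+ 2 - y ^+ 2 = x ^+ 2 * y ^+ 2.
  rewrite x2 y2 -[l.+2%:R]natr1.
  have n0 : l.+1%:R != 0 :> R by rewrite pnatr_eq0.
  have n1 : l.+1%:R + 1 != 0 :> R by rewrite natr1 pnatr_eq0.
  by move: (l.+1%:R : R) n0 n1 => v n0 n1; field; rewrite n0 n1.
have h : (x - y) * (x + y) = x ^+ 2 * y ^+ 2 by rewrite -E; ring.
rewrite -(@ler_pM2r _ (x + y)); last by rewrite addr_gt0.
rewrite -[leRHS]mulrA h.
have : y ^+ 2 * y * (x + y) <= y ^+ 2 * (2 * x ^+ 2).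
  rewrite -mulrA ler_wpM2l ?sqr_ge0//; nra.
by move=> /le_trans; apply; rewrite le_eqVlt; apply/orP; left; apply/eqP; ring.
Qed.

Lemma esum_inv_abs32 : exists V : R, (\esum_(k in [set: int]) (inv_abs32 k)%:E = V%:E)%E.
Proof.
have c : cvgn (series (fun l : nat => inv_abs32 l.+1%:Z)).
  apply: (@cvg_series_bounded _ _ 2) => [l|n]; first exact: inv_abs32_ge0.
  suff : series (fun l : nat => inv_abs32 l.+1%:Z) n <= 2 * (1 - Num.sqrt (n.+1%:R)^-1).
    move=> /le_trans; apply; have := sqrtr_ge0 ((n.+1%:R)^-1 : R); lra.
  elim: n => [|n IH]; first by rewrite /series /= big_geq// invr1 sqrtr1; lra.
  rewrite /series /= big_nat_recr//=; have := inv_abs32_telescope n.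
  rewrite /series /= in IH; lra.
exists (inv_abs32 0 + limn (series (fun l : nat => inv_abs32 l.+1%:Z + inv_abs32 (- l.+1%:Z)))).
apply: (esum_of_cvg inv_abs32_ge0 sym_window_exhausting).
under eq_fun do rewrite sum_sym_window.
apply: seqD; first exact: cvg_cst.
have E : (fun l : nat => inv_abs32 l.+1%:Z + inv_abs32 (- l.+1%:Z)) = (fun l => 2 * inv_abs32 l.+1%:Z).
  by apply/funext => l; rewrite /inv_abs32 /inv_abs normrN; ring.
by rewrite E; apply: cvg_seriesZ.
Qed.

Definition inv_abs3 (p : int * int) : R := inv_abs p.1 * inv_abs p.2 * inv_abs (p.1 + p.2).

(** If c is the smallest of the three numbers and a, b are the others, then c^2 <= ab, so the
    left-hand side is at most (ab)^3. *)
Lemma mul3_le (x y z : R) : 0 <= x -> 0 <= y -> 0 <= z ->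
  x ^+ 2 * y ^+ 2 * z ^+ 2 <= (x * y) ^+ 3 + (x * z) ^+ 3 + (y * z) ^+ 3.
Proof.
move=> x0 y0 z0.
have key (a b c : R) : 0 <= a -> 0 <= b -> 0 <= c -> c <= a -> c <= b ->
    a ^+ 2 * b ^+ 2 * c ^+ 2 <= (a * b) ^+ 3.
  move=> a0 b0 c0 ca cb.
  have -> : (a * b) ^+ 3 = a ^+ 2 * b ^+ 2 * (a * b) by ring.
  rewrite ler_wpM2l ?mulr_ge0 ?sqr_ge0//; nra.
have p1 : 0 <= (x * y) ^+ 3 by rewrite exprn_ge0// mulr_ge0.
have p2 : 0 <= (x * z) ^+ 3 by rewrite exprn_ge0// mulr_ge0.
have p3 : 0 <= (y * z) ^+ 3 by rewrite exprn_ge0// mulr_ge0.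
have [zx|/ltW xz] := leP z x; have [zy|/ltW yz] := leP z y.
- have := key x y z x0 y0 z0 zx zy; lra.
- have := key x z y x0 z0 y0 (le_trans yz zx) yz.
  have -> : x ^+ 2 * z ^+ 2 * y ^+ 2 = x ^+ 2 * y ^+ 2 * z ^+ 2 by ring.
  lra.
- have := key y z x y0 z0 x0 (le_trans xz zy) xz.
  have -> : y ^+ 2 * z ^+ 2 * x ^+ 2 = x ^+ 2 * y ^+ 2 * z ^+ 2 by ring.
  lra.
- have [xy|/ltW yx] := leP x y.
    have := key y z x y0 z0 x0 xy xz.
    have -> : y ^+ 2 * z ^+ 2 * x ^+ 2 = x ^+ 2 * y ^+ 2 * z ^+ 2 by ring.
    lra.
  have := key x z y x0 z0 y0 yx yz.
  have -> : x ^+ 2 * z ^+ 2 * y ^+ 2 = x ^+ 2 * y ^+ 2 * z ^+ 2 by ring.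
  lra.
Qed.

Lemma inv_abs3_le p : inv_abs3 p <= inv_abs32 p.1 * inv_abs32 p.2 +
  inv_abs32 p.1 * inv_abs32 (p.1 + p.2) + inv_abs32 p.2 * inv_abs32 (p.1 + p.2).
Proof.
rewrite /inv_abs3 /inv_abs32.
have sE k : inv_abs k = Num.sqrt (inv_abs k) ^+ 2 by rewrite sqr_sqrtr// ltW// inv_abs_gt0.
have := mul3_le (sqrtr_ge0 (inv_abs p.1)) (sqrtr_ge0 (inv_abs p.2)) (sqrtr_ge0 (inv_abs (p.1 + p.2))).
move: (sE p.1) (sE p.2) (sE (p.1 + p.2)).
move: (Num.sqrt (inv_abs p.1)) (Num.sqrt (inv_abs p.2)) (Num.sqrt (inv_abs (p.1 + p.2))) => x y z.
move=> -> -> -> /le_trans; apply; rewrite le_eqVlt; apply/orP; left; apply/eqP; ring.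
Qed.

(** Each of the three products in [inv_abs3_le] is, after a unimodular change of variables, a
    product of two convergent single sums. *)
Lemma esum_inv_abs3 : exists V : R, (\esum_(p in [set: int * int]) (inv_abs3 p)%:E = V%:E)%E.
Proof.
have [V hV] := esum_inv_abs32.
have pairs : (\esum_(p in [set: int * int]) (inv_abs32 p.1 * inv_abs32 p.2)%:E = (V * V)%:E)%E.
  have <- : [set: int] `*`` (fun=> [set: int]) = [set: int * int].
    by apply/seteqP; split.
  rewrite -(@esum_esum _ _ _ _ _ (fun a b => (inv_abs32 a * inv_abs32 b)%:E)); last first.
    by move=> a b _ _; rewrite lee_fin mulr_ge0 ?inv_abs32_ge0.
  under eq_esum do rewrite (esumT_scale sym_window_exhausting inv_abs32_ge0 (inv_abs32_ge0 _) hV) mulrC.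
  apply: (esumT_scale sym_window_exhausting inv_abs32_ge0 _ hV).
  rewrite -lee_fin -hV; apply: esum_ge0 => k _; rewrite lee_fin; exact: inv_abs32_ge0.
have shift (e : int * int -> int * int) : set_bij setT setT e ->
    (\esum_(p in [set: int * int]) (inv_abs32 (e p).1 * inv_abs32 (e p).2)%:E = (V * V)%:E)%E.
  by move=> be; rewrite -pairs (@reindex_esum _ _ _ _ _ e (fun p => (inv_abs32 p.1 * inv_abs32 p.2)%:E) be).
have b1 : set_bij setT setT (fun p : int * int => (p.1, p.1 + p.2)).
  split=> //.
  - by move=> [a b] [c d] _ _ /= [-> /addrI ->].
  - by move=> [a b] _; exists (a, b - a) => //=; rewrite addrC subrK.
have b2 : set_bij setT setT (fun p : int * int => (p.2, p.1 + p.2)).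
  split=> //.
  - by move=> [a b] [c d] _ _ /= [-> /addIr ->].
  - by move=> [a b] _; exists (b - a, a) => //=; rewrite subrK.
have tot : (\esum_(p in [set: int * int]) (inv_abs32 p.1 * inv_abs32 p.2 +
  inv_abs32 p.1 * inv_abs32 (p.1 + p.2) + inv_abs32 p.2 * inv_abs32 (p.1 + p.2))%:E = (V * V + V * V + V * V)%:E)%E.
  under eq_esum do rewrite !EFinD.
  have p0 a b : (0 <= (inv_abs32 a * inv_abs32 b)%:E)%E by rewrite lee_fin mulr_ge0 ?inv_abs32_ge0.
  rewrite !esumD//; last by move=> x _; rewrite adde_ge0.
  by rewrite pairs (shift _ b1) (shift _ b2).
have le p : 0 <= inv_abs3 p <= inv_abs32 p.1 * inv_abs32 p.2 +
  inv_abs32 p.1 * inv_abs32 (p.1 + p.2) + inv_abs32 p.2 * inv_abs32 (p.1 + p.2).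
  by rewrite inv_abs3_le andbT /inv_abs3 !mulr_ge0// ltW// inv_abs_gt0.
by have [l' hl' _] := le_esumT le tot; exists l'; exact: hl'.
Qed.

Lemma inv_abs3_ge0 p : 0 <= inv_abs3 p.
Proof. by rewrite /inv_abs3 !mulr_ge0// ltW// inv_abs_gt0. Qed.

Lemma row_factor_bound (t : R) : 0 < t -> exists2 K : R, 0 <= K &
  forall (n m : int) x, 0 <= x <= 1 ->
    row_factor_real n m 1 t x <= K * (inv_abs m * inv_abs n).
Proof.
(* The constant comes from m^2 <= 2(nx + m)^2 + 2n^2 for x in [0, 1] and n^2 = (nt)^2/t^2; the
   further factor 3 comes from (1 + |m|)(1 + |n|) <= 3(m^2 + n^2) for (m, n) nonzero. *)
move=> t0; pose c := 2 + 3 / t ^+ 2; have t2 : 0 < t ^+ 2 by rewrite exprn_gt0.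
have c0 : 0 < c by rewrite addr_gt0// divr_gt0.
exists (3 * c) => [|n m x /andP[x0 x1]]; first by rewrite mulr_ge0// ltW.
have rhs0 : 0 <= 3 * c * (inv_abs m * inv_abs n).
  by rewrite !mulr_ge0 ?(ltW c0)// ltW// inv_abs_gt0.
rewrite /row_factor_real mulr1; set D := _ ^+ 2 + _ ^+ 2.
have [nm|nm] := boolP ((n == 0) && (m == 0)).
  case/andP: nm => /eqP n0 /eqP m0.
  by rewrite /D n0 m0 !mul0r addr0 expr0n addr0 invr0; move: rhs0; rewrite n0 m0.
have key : (1 + `|m|%:~R) * (1 + `|n|%:~R) <= 3 * c * D :> R.
  have i1 : 1 + `|m| + `|n| + `|m| * `|n| <= 3 * (m ^+ 2 + n ^+ 2) by nia.
  have i2 : (1 + `|m|%:~R) * (1 + `|n|%:~R) <= 3 * (m%:~R ^+ 2 + n%:~R ^+ 2) :> R.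
    have : (1 + `|m| + `|n| + `|m| * `|n|)%:~R <= (3 * (m ^+ 2 + n ^+ 2))%:~R :> R by rewrite ler_int.
    by rewrite !(intrD, intrM, rmorphXn) /=; lra.
  apply: (le_trans i2); rewrite -mulrA ler_wpM2l//.
  have : 3 * n%:~R ^+ 2 = 3 / t ^+ 2 * (n%:~R * t) ^+ 2 :> R.
    by field; rewrite gt_eqF.
  have : m%:~R ^+ 2 <= 2 * (n%:~R * x + m%:~R) ^+ 2 + 2 * n%:~R ^+ 2 :> R.
    have := sqr_ge0 (2 * (n%:~R * x) + m%:~R : R).
    have : n%:~R ^+ 2 * x ^+ 2 <= n%:~R ^+ 2 :> R.
      by rewrite ler_piMr ?sqr_ge0// exprn_ile1.
    nra.
  have q0 : 0 <= 3 / t ^+ 2 by rewrite divr_ge0// ltW.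
  rewrite /c /D; have := sqr_ge0 (n%:~R * x + m%:~R : R); have := sqr_ge0 (n%:~R * t : R).
  move: ((n%:~R * t) ^+ 2) ((n%:~R * x + m%:~R) ^+ 2) (3 / t ^+ 2) q0 => u v q q0.
  nra.
have A0 : 0 < (1 + `|m|%:~R) * (1 + `|n|%:~R) :> R.
  by rewrite mulr_gt0// ltr_pwDl// ler0z.
have D0 : 0 < D.
  by move: (lt_le_trans A0 key); rewrite pmulr_rgt0 ?mulr_gt0.
rewrite /inv_abs -invfM -[leLHS]mul1r ler_pdivrMr// mulrAC ler_pdivlMr// mul1r.
exact: key.
Qed.

Lemma inv_absN k : inv_abs (- k) = inv_abs k.
Proof. by rewrite /inv_abs normrN. Qed.

(** The majorant of a propagator is a constant times a number in [0, 1]; keeping only its first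
    power reduces all exponents to the slowest case, where each is 1. *)
Lemma row_product_bound (t : R) (a1 a2 a3 : nat) : 0 < t ->
  (0 < a1)%N -> (0 < a2)%N -> (0 < a3)%N -> exists2 B : R, 0 <= B &
  forall (n m : int * int) x, 0 <= x <= 1 ->
    row_product n.1 n.2 m.1 m.2 a1 a2 a3 1 t x <= B * (inv_abs3 n * inv_abs3 m).
Proof.
move=> t0 h1 h2 h3; have [K K0 hK] := row_factor_bound t0.
exists (K ^+ a1 * K ^+ a2 * K ^+ a3) => [|n m x x01]; first by rewrite !mulr_ge0// exprn_ge0.
have pw (a : nat) (p q : int) : (0 < a)%N ->
    row_factor_real p q 1 t x ^+ a <= K ^+ a * (inv_abs q * inv_abs p).
  move=> a0; have u0 : 0 <= inv_abs q * inv_abs p by rewrite mulr_ge0// ltW// inv_abs_gt0.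
  have u1 : inv_abs q * inv_abs p <= 1.
    by rewrite -[1]mulr1 ler_pM ?inv_abs_le1// ltW// inv_abs_gt0.
  apply: (@le_trans _ _ ((K * (inv_abs q * inv_abs p)) ^+ a)).
    by rewrite lerXn2r ?nnegrE ?row_factor_ge0 ?(mulr_ge0 K0 u0)// hK.
  rewrite exprMn ler_wpM2l ?exprn_ge0//.
  by case: a a0 => // a _; rewrite exprS ler_piMr// exprn_ile1.
have q1 := pw a1 n.1 m.1 h1; have q2 := pw a2 n.2 m.2 h2.
have q3 := pw a3 (- (n.1 + n.2)) (- (m.1 + m.2)) h3; rewrite !inv_absN in q3.
have f0 a p q : 0 <= row_factor_real p q 1 t x ^+ a by rewrite exprn_ge0// row_factor_ge0.
have := ler_pM (mulr_ge0 (f0 a1 n.1 m.1) (f0 a2 n.2 m.2)) (f0 a3 _ _) (ler_pM (f0 _ _ _) (f0 _ _ _) q1 q2) q3.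
move=> /le_trans; apply; rewrite /inv_abs3 le_eqVlt; apply/orP; left; apply/eqP; ring.
Qed.

Lemma esum_row_product_bound (t : R) (a1 a2 a3 : nat) : 0 < t ->
  (0 < a1)%N -> (0 < a2)%N -> (0 < a3)%N -> exists B : R, forall x, 0 <= x <= 1 ->
  exists2 v : R, (\esum_(q in [set: (int * int) * (int * int)])
    (row_product q.1.1 q.1.2 q.2.1 q.2.2 a1 a2 a3 1 t x)%:E = v%:E)%E & v <= B.
Proof.
move=> t0 h1 h2 h3; have [B B0 hB] := row_product_bound t0 h1 h2 h3.
have [V hV] := esum_inv_abs3.
have V0 : 0 <= V.
  by rewrite -lee_fin -hV; apply: esum_ge0 => p _; rewrite lee_fin inv_abs3_ge0.
have tot : (\esum_(q in [set: (int * int) * (int * int)])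
    (B * (inv_abs3 q.1 * inv_abs3 q.2))%:E = (B * V * V)%:E)%E.
  have <- : [set: int * int] `*`` (fun=> [set: int * int]) = [set: (int * int) * (int * int)].
    by apply/seteqP; split.
  rewrite -(@esum_esum _ _ _ _ _ (fun p q => (B * (inv_abs3 p * inv_abs3 q))%:E)); last first.
    by move=> p q _ _; rewrite lee_fin (mulr_ge0 B0)// mulr_ge0 ?inv_abs3_ge0.
  have inner p : (\esum_(q in [set: int * int]) (B * (inv_abs3 p * inv_abs3 q))%:E = (B * V * inv_abs3 p)%:E)%E.
    under eq_esum do rewrite mulrA.
    rewrite (esumT_scale box_exhausting inv_abs3_ge0 (mulr_ge0 B0 (inv_abs3_ge0 p)) hV).
    by congr (_%:E); ring.
  under eq_esum do rewrite inner.
  by apply: (esumT_scale box_exhausting inv_abs3_ge0 _ hV); rewrite mulr_ge0.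
exists (B * V * V) => x x01.
have le (q : (int * int) * (int * int)) : 0 <= row_product q.1.1 q.1.2 q.2.1 q.2.2 a1 a2 a3 1 t x <=
    B * (inv_abs3 q.1 * inv_abs3 q.2).
  by rewrite row_product_ge0 hB.
by have [v hv vB] := le_esumT le tot; exists v.
Qed.

End Summability.

(** * The constant mode as a sum over n *)

Section ConstantMode.
Variable R : realType.
Local Open Scope complex_scope.

(** The enumeration makes the unordered sum a series over nat, for which monotone convergence allows
    exchange with the integral. *)
Lemma esum_pickle (T : countType) (a : T -> \bar R) : (forall x, (0 <= a x)%E) ->
  (\esum_(x in [set: T]) a x = \sum_(0 <= k <oo) oapp a 0 (pickle_inv k : option T))%E.
Proof.
move=> a0; have b0 k : (0 <= oapp a 0 (pickle_inv k : option T))%E by case: (pickle_inv k : option T).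
rewrite nneseries_esumT//.
have bij : set_bij [set: T] (range (@pickle T)) (@pickle T).
  by split=> //; move=> x y _ _ /(pcan_inj (@pickleK T)).
transitivity (\esum_(k in range (@pickle T)) oapp a 0 (pickle_inv k : option T))%E.
  by rewrite (reindex_esum _ _ _ _ bij); apply: eq_esum => x _; rewrite pickleK_inv.
rewrite esum_mkcond; apply: eq_esum => k _; case: ifPn => // /negP kr.
have := @pickle_invK T k; case: (pickle_inv k : option T) => //= x xk.
by exfalso; apply: kr; rewrite inE; exists x.
Qed.

Lemma integral_esum_swap (T : countType) (f : T -> R -> R) :
  (forall i, continuous (f i)) -> (forall i x, 0 <= f i x) ->
  (\int[lebesgue_measure]_(x in `[0%R, 1%R]) (\esum_(i in [set: T]) (f i x)%:E) =
   \esum_(i in [set: T]) \int[lebesgue_measure]_(x in `[0%R, 1%R]) (f i x)%:E)%E.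
Proof.
move=> cf f0.
rewrite esum_pickle; last by move=> i; apply: integral_ge0 => x _; rewrite lee_fin.
transitivity (\int[lebesgue_measure]_(x in `[0%R, 1%R])
    \sum_(0 <= k <oo) oapp (fun i => (f i x)%:E) 0 (pickle_inv k : option T))%E.
  by apply: eq_integral => x _; rewrite esum_pickle// => i; rewrite lee_fin.
rewrite integral_nneseries//.
- apply: eq_eseriesr => k _; case: (pickle_inv k : option T) => //=.
  by rewrite integral0.
- move=> k; case: (pickle_inv k : option T) => //= i.
  apply/measurable_EFinP; apply: measurable_funTS; exact: continuous_measurable_fun.
- by move=> k x _; case: (pickle_inv k : option T) => //= i; rewrite lee_fin.
Qed.

Lemma esum_measurable (T : countType) (f : T -> R -> R) :
  (forall i, continuous (f i)) -> (forall i x, 0 <= f i x) ->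
  measurable_fun (`[0%R, 1%R]%classic : set (measurableTypeR R))
    (fun x : measurableTypeR R => (\esum_(i in [set: T]) (f i x)%:E)%E).
Proof.
move=> cf f0; rewrite (_ : (fun _ => _) = fun x =>
    \sum_(0 <= k <oo) oapp (fun i => (f i x)%:E) 0 (pickle_inv k : option T))%E; last first.
  by apply/funext => x; rewrite esum_pickle// => i; rewrite lee_fin.
apply: ge0_emeasurable_sum => [k x _ _|k _].
  by case: (pickle_inv k : option T) => //= i; rewrite lee_fin.
case: (pickle_inv k : option T) => //= i.
apply/measurable_EFinP; apply: measurable_funTS; exact: continuous_measurable_fun.
Qed.

Lemma propagatorE (t1 t : R) (p : int * int) :
  propagator (t1 +i* t) p = t / pi * row_factor_real p.2 p.1 1 t t1.
Proof.
rewrite /propagator /row_factor_real /= invfM mulrA; congr (_ / _).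
have -> : (p.1%:~R + p.2%:~R * (t1 +i* t) : R[i]) = (p.2%:~R * t1 + p.1%:~R) +i* (p.2%:~R * t).
  by rewrite !real_intr; apply: complex_eqP; rewrite /= ; ring.
by rewrite /= sqr_sqrtr ?addr_ge0 ?sqr_ge0// mulr1.
Qed.

Lemma row_factor00 (t x : R) : row_factor_real 0 0 1 t x = 0.
Proof. by rewrite /row_factor_real !mul0r addr0 expr0n addr0 invr0. Qed.

(** The sum may run over all (n, m): if one momentum is zero, its propagator is [0^-1 = 0] and the
    positive exponent keeps the product zero. *)
Lemma esum_momenta (a1 a2 a3 : nat) (t1 t : R) : 0 < t ->
  (0 < a1)%N -> (0 < a2)%N -> (0 < a3)%N ->
  (\esum_(p in momenta)
    (propagator (t1 +i* t) p.1.1 ^+ a1 * propagator (t1 +i* t) p.1.2 ^+ a2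
      * propagator (t1 +i* t) p.2 ^+ a3)%:E =
   \esum_(q in [set: (int * int) * (int * int)])
     ((t / pi) ^+ (a1 + a2 + a3) * row_product q.1.1 q.1.2 q.2.1 q.2.2 a1 a2 a3 1 t t1)%:E)%E.
Proof.
move=> t0 h1 h2 h3.
pose e (q : (int * int) * (int * int)) :=
  ((q.2.1, q.1.1), (q.2.2, q.1.2), (- (q.2.1 + q.2.2), - (q.1.1 + q.1.2))).
pose D := [set q | momenta (e q)].
have bij : set_bij D momenta e.
  split=> //.
  - by move=> [[a b] [c d]] [[a' b'] [c' d']] _ _ [-> -> -> ->].
  - move=> [[[m1 n1] [m2 n2]] [m3 n3]] hp; exists ((n1, n2), (m1, m2)).
      have [_ _ _ hs] := hp; have e1 := congr1 fst hs; have e2 := congr1 snd hs.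
      have E : (m3, n3) = (- (m1 + m2), - (n1 + n2)) by move: e1 e2 => /= e1 e2; congr pair; lia.
      by rewrite /D /e /= -E.
    have [_ _ _ hs] := hp; have e1 := congr1 fst hs; have e2 := congr1 snd hs.
    by rewrite /e /=; congr pair; move: e1 e2 => /= e1 e2; congr pair; lia.
rewrite (reindex_esum _ _ _ _ bij) esum_mkcond; apply: eq_esum => -[[n1 n2] [m1 m2]] _.
rewrite /= !propagatorE !exprMn /= /row_product.
case: ifPn => [_|].
  by congr (_%:E); rewrite !exprD; ring.
rewrite notin_setE => nD.
have z3 : [|| (m1, n1) == 0, (m2, n2) == 0 | (- (m1 + m2), - (n1 + n2)) == 0].
  apply/negPn; rewrite !negb_or; apply/negP => /and3P[x y z]; apply: nD.
  split=> //=; by rewrite -[LHS]/(m1 + m2 - (m1 + m2), n1 + n2 - (n1 + n2)) !subrr.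
by case/or3P: z3 => /eqP[-> ->]; rewrite row_factor00 expr0n gtn_eqF//= ?mul0r ?mulr0 ?mul0r ?mulr0.
Qed.

Lemma pair_box_exhausting :
  exhausting (fun M => [seq (x, y) | x <- box M, y <- box M]).
Proof.
have [u ex] := box_exhausting; split=> [M|[x y]].
  by apply: allpairs_uniq => // -[? ?] [? ?].
have [N hN] := ex x; have [N' hN'] := ex y.
exists (maxn N N') => M; rewrite geq_max => /andP[h1 h2].
by apply/allpairsP; exists (x, y); split; [exact: hN|exact: hN'|].
Qed.

Definition mode_sum (a1 a2 a3 : nat) (t : R) (n : int * int) : \bar R :=
  (\esum_(m in [set: int * int]) \int[lebesgue_measure]_(x in `[0%R, 1%R])
     (row_product n.1 n.2 m.1 m.2 a1 a2 a3 1 t x)%:E)%E.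

Lemma constant_mode_cvg (a1 a2 a3 : nat) (t : R) : 0 < t ->
  (0 < a1)%N -> (0 < a2)%N -> (0 < a3)%N ->
  (forall n, mode_sum a1 a2 a3 t n = (fine (mode_sum a1 a2 a3 t n))%:E) /\
  (fun M => \sum_(n <- box M) (t / pi) ^+ (a1 + a2 + a3) * fine (mode_sum a1 a2 a3 t n)) @ \oo -->
    constant_mode a1 a2 a3 t.
Proof.
move=> t0 h1 h2 h3; set w := (a1 + a2 + a3)%N.
have [B hB] := esum_row_product_bound t0 h1 h2 h3.
have k0 : 0 <= (t / pi) ^+ w by rewrite exprn_ge0// divr_ge0 ?pi_ge0// ltW.
pose S x := (\esum_(q in [set: (int * int) * (int * int)])
    (row_product q.1.1 q.1.2 q.2.1 q.2.2 a1 a2 a3 1 t x)%:E)%E.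
have swap : (\int[lebesgue_measure]_(x in `[0%R, 1%R]) S x = \esum_(n in [set: int * int]) mode_sum a1 a2 a3 t n)%E.
  rewrite /S integral_esum_swap; last 2 first.
  - by move=> q; exact: row_product_continuous.
  - by move=> q x; exact: row_product_ge0.
  rewrite /mode_sum esum_esum; last first.
    by move=> n m _ _; apply: integral_ge0 => x _; rewrite lee_fin row_product_ge0.
  by congr esum; apply/seteqP; split.
have ms0 n : (0 <= mode_sum a1 a2 a3 t n)%E.
  by apply: esum_ge0 => m _; apply: integral_ge0 => x _; rewrite lee_fin row_product_ge0.
have bound : (\esum_(n in [set: int * int]) mode_sum a1 a2 a3 t n <= B%:E)%E.
  rewrite -swap; apply: (@le_trans _ _ (\int[lebesgue_measure]_(x in `[0%R, 1%R]) (B%:E))%E).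
    apply: ge0_le_integral => //.
    - by move=> x _; apply: esum_ge0 => q _; rewrite lee_fin row_product_ge0.
    - by apply: esum_measurable => [q|q x]; [exact: row_product_continuous|exact: row_product_ge0].
    - by move=> x; rewrite /= in_itv/= => /hB [u hu uB]; rewrite /S hu lee_fin.
  rewrite integral_cst//= lebesgue_measure_itv/= lte_fin ltr01 -EFinB subr0 mule1//.
have fin n : mode_sum a1 a2 a3 t n = (fine (mode_sum a1 a2 a3 t n))%:E.
  rewrite fineK// ge0_fin_numE//.
  apply: le_lt_trans (ltry B); apply: le_trans bound.
  apply: esum_ge; exists [set n]; first by split=> //; exact: finite_set1.
  by rewrite fsbig_set1.
split=> //.
have [v hv] : exists v : R, (\esum_(n in [set: int * int]) (fine (mode_sum a1 a2 a3 t n))%:E = v%:E)%E.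
  under eq_esum do rewrite -fin.
  have : (0 <= \esum_(n in [set: int * int]) mode_sum a1 a2 a3 t n)%E by apply: esum_ge0.
  move: bound; case: (\esum_(n in _) _)%E => [v| |] //= _ _; by exists v.
have fine0 n : 0 <= fine (mode_sum a1 a2 a3 t n) by rewrite fine_ge0.
have -> : constant_mode a1 a2 a3 t = (t / pi) ^+ w * v.
  rewrite /constant_mode /Rintegral /C.
  (* [fine] loses nothing here, since the sum is finite at every x in [0, 1]. *)
  have -> : (\int[lebesgue_measure]_(x in `[0%R, 1%R])
      (fine (\esum_(p in momenta) (propagator (x +i* t) p.1.1 ^+ a1 *
        propagator (x +i* t) p.1.2 ^+ a2 * propagator (x +i* t) p.2 ^+ a3)%:E))%:E =
      \int[lebesgue_measure]_(x in `[0%R, 1%R]) (((t / pi) ^+ w)%:E * S x))%E.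
    apply: eq_integral => x; rewrite inE/= in_itv/= => x01.
    have [u hu _] := hB _ x01.
    rewrite esum_momenta// (esumT_scale pair_box_exhausting _ k0 hu)/=; last first.
      by move=> q; exact: row_product_ge0.
    by rewrite /S hu.
  rewrite ge0_integralZl_EFin//; last 2 first.
  - by move=> x _; apply: esum_ge0 => q _; rewrite lee_fin row_product_ge0.
  - by apply: esum_measurable => [q|q x]; [exact: row_product_continuous|exact: row_product_ge0].
  rewrite swap; under eq_esum do rewrite fin.
  by rewrite hv.
apply: cvg_of_esum => //.
- by move=> n; rewrite mulr_ge0.
- exact: box_exhausting.
- by apply: (esumT_scale box_exhausting).
Qed.

End ConstantMode.

(** * Splitting a lattice sum into Laurent and exponential parts *)

Section ModeExpansion.
Variable R : realType.
Implicit Types (t : R) (g w k N : nat).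

(** The partial sums agree at the indices [e * Q]. This merges the exponentials with frequencies in
    multiples of e into one series over all N. *)
Lemma series_sparse (h : nat -> R) (e : nat) : (0 < e)%N ->
  let H N := if (e %| N.+1)%N then h (N.+1 %/ e)%N else 0 in
  cvgn (series H) -> limn (series (fun q => h q.+1)) = limn (series H).
Proof.
case: e => // e _ H cH.
have E Q : series H (e.+1 * Q)%N = series (fun q => h q.+1) Q.
  elim: Q => [|Q IH]; first by rewrite muln0 /series /= !big_geq.
  rewrite [in RHS]/series /= big_nat_recr//= -[X in _ = X + _]/(series _ Q) -IH.
  suff D : series H (e.+1 * Q.+1)%N - series H (e.+1 * Q)%N = h Q.+1 by rewrite -D addrC subrK.
  rewrite series_sub; last by rewrite leq_mul2l leqnSn orbT.
  have -> : (e.+1 * Q.+1)%N = (e.+1 * Q + e).+1 by lia.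
  rewrite big_nat_recr/=; last by lia.
  rewrite big_nat big1 ?add0r => [|i /andP[i1 i2]].
    rewrite /H; have -> : (e.+1 * Q + e).+1 = (Q.+1 * e.+1)%N by lia.
    by rewrite dvdn_mull// mulnK.
  rewrite /H; case: ifP => // /dvdnP[q qE]; exfalso.
  have h1 : (Q * e.+1 < q * e.+1)%N by rewrite -qE; lia.
  have h2 : (q * e.+1 < Q.+1 * e.+1)%N by rewrite -qE; lia.
  by move: h1 h2; rewrite !ltn_pmul2r//; lia.
have sub : (fun Q : nat => (e.+1 * Q)%N) @ \oo --> \oo.
  move=> A [N0 _ hN]; exists N0 => // Q /= NQ; apply: hN => /=.
  by apply: (leq_trans NQ); rewrite leq_pmull.
apply: cvg_lim => //; apply: seq_eq (cvg_comp _ _ sub cH) => Q /=.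
exact: E.
Qed.

(** The frequency N is e times the summation index of Lipschitz' formula, and the sign comes from
    reflecting a negative slope. All powers of pi are left to the prefactor (pi t)^(k+1-w) in
    [lattice_part], so that this number is rational. *)
Definition exp_coef (w g : nat) (x : rat * int * nat) (N : nat) : rat :=
  let e := (g * absz x.1.2)%N in
  if (x.1.2 != 0) && (e %| N)%N then
    x.1.1 * (g%:R ^+ x.2 / g%:R ^+ (2 * w).-1) * (if x.1.2 < 0 then (-1) ^+ x.2 else 1) *
    (2 ^+ x.2 / (x.2.-1)`!%:R) * (N %/ e)%:R ^+ x.2.-1
  else 0.

Lemma lattice_sum_pos (a : R) (k : nat) : 0 < a -> (0 < k)%N ->
  2 * lattice_sum a k = - (a^-1 ^+ k) + (if k == 1%N then pi else 0) +
    (2 * pi) ^+ k / (k.-1)`!%:R * limn (series (exp_term a k.-1)).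
Proof.
move=> a0; case: k => // k _; have := lipschitz_formula k a0; rewrite /lattice_sum /= eqSS.
lra.
Qed.

Lemma lattice_sum_sign (a : R) (k : nat) : (0 < k)%N ->
  lattice_sum (- a) k = (-1) ^+ k * lattice_sum a k.
Proof.
move=> k0; rewrite /lattice_sum -lim_seriesZ; last exact: lattice_term_is_cvg.
by congr (limn (series _)); apply/funext => d; exact: lattice_termN.
Qed.

Definition exp_summand (r : nat -> rat) (t : R) (N : nat) : R :=
  ratr (r N.+1) * expR (- (4 * pi * t * N.+1%:R)).

Lemma exp_summand_le (r : nat -> rat) (A E : nat) (t : R) N :
  `|r N.+1| <= A%:R * N.+1%:R ^+ E ->
  `|exp_summand r t N| <= A%:R * (N.+1%:R ^+ E * expR (- (4 * pi * t * N.+1%:R))).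
Proof.
move=> rA; rewrite /exp_summand normrM mulrA.
have -> : `|expR (- (4 * pi * t * N.+1%:R))| = expR (- (4 * pi * t * N.+1%:R)).
  by rewrite ger0_norm ?expR_ge0.
rewrite ler_wpM2r ?expR_ge0//; move: rA; rewrite -(ler_rat R) rmorphM rmorphXn /= !ratr_nat.
by apply: le_trans; rewrite ratr_norm.
Qed.

Lemma exp_summand_cvg (r : nat -> rat) (A E : nat) (t : R) : 0 < t ->
  (forall N, `|r N.+1| <= A%:R * N.+1%:R ^+ E) -> cvgn (series (exp_summand r t)).
Proof.
move=> t0 rA; apply: (@cvg_series_dom _ _ (fun N => A%:R * (N.+1%:R ^+ E * expR (- (4 * pi * t * N.+1%:R))))).
  by move=> N; exact: exp_summand_le.
by apply: cvg_seriesZ; apply: cvg_pow_exp; rewrite !mulr_gt0 ?pi_gt0.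
Qed.

Lemma exp_coef_le w g x N : (0 < g)%N -> (0 < N)%N ->
  (x.2 <= (2 * w).-1)%N -> ((x.1.2 != 0) ==> (x.2 <= w.-1)%N) ->
  `|exp_coef w g x N| <= `|x.1.1| * (2 ^ w * N ^ w)%:R.
Proof.
move=> g0 N0 xh xw; rewrite /exp_coef; case: ifP => [/andP[k0 eN]|_]; last first.
  by rewrite normr0 mulr_ge0.
have {}xw := implyP xw k0.
have xw' : (x.2 <= w)%N by lia.
rewrite !normrM -!mulrA ler_wpM2l//.
have p1 : `|g%:R ^+ x.2| * `|(g%:R ^+ (2 * w).-1)^-1| <= 1 :> rat.
  rewrite -normrM ger0_norm ?divr_ge0 ?exprn_ge0// ler_pdivrMr ?exprn_gt0 ?ltr0n// mul1r.
  by apply: ler_weXn2l => //; rewrite ler1n.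
have p2 : `|if x.1.2 < 0 then (-1) ^+ x.2 else 1| <= 1 :> rat.
  by case: ifP => _; rewrite ?normrX ?normrN1 ?expr1n ?normr1.
have p3 : `|2 ^+ x.2| * `|((x.2.-1)`!%:R)^-1| <= 2 ^+ w :> rat.
  rewrite -normrM ger0_norm ?divr_ge0 ?exprn_ge0// ler_pdivrMr ?ltr0n ?fact_gt0//.
  rewrite -[leLHS]mulr1 ler_pM ?exprn_ge0//.
    by apply: ler_weXn2l => //; rewrite ler1n.
  by rewrite ler1n fact_gt0.
have p4 : `|(N %/ (g * `|x.1.2|%N))%:R ^+ x.2.-1| <= N%:R ^+ w :> rat.
  rewrite ger0_norm ?exprn_ge0//; apply: (@le_trans _ _ (N%:R ^+ x.2.-1)).
    by rewrite lerXn2r ?nnegrE// ler_nat leq_div.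
  by apply: ler_weXn2l; [rewrite ler1n|lia].
rewrite natrM !natrX mulrA.
have := ler_pM _ _ p1 (ler_pM _ _ p2 (ler_pM _ _ p3 p4)); rewrite !mul1r !mulrA; apply.
all: by rewrite ?mulr_ge0.
Qed.

(** The Laurent terms have three sources: for slope 0 the value [lattice_sum 0 k], and otherwise the
    term a^-k of Lipschitz' formula and, for k = 1, its constant pi. The power of t outside is w -
    (2w - 1) = 1 - w. *)
Lemma lattice_part w g (x : rat * int * nat) : (0 < g)%N -> (0 < x.2)%N ->
    (x.2 <= (2 * w).-1)%N -> ((x.1.2 != 0) ==> (x.2 <= w.-1)%N) -> (0 < w)%N ->
  exists2 p : {poly R}, (size p <= 2 * w)%N & forall t, 0 < t ->
    (t / pi) ^+ w * (2 * pi * (ratr x.1.1 * (g%:R * t) ^+ x.2 / (g%:R * t) ^+ (2 * w).-1) *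
       lattice_sum (2 * x.1.2%:~R * (g%:R * t)) x.2) =
    (t ^+ w.-1)^-1 * p.[t] +
    (pi * t) ^+ x.2.+1 / (pi * t) ^+ w * limn (series (exp_summand (exp_coef w g x) t)).
Proof.
case: x => [[c kap] k] /= g0 k0 kh kw w0.
have pin : pi != 0 :> R by rewrite gt_eqF ?pi_gt0.
have gn : g%:R != 0 :> R by rewrite pnatr_eq0 -lt0n.
have whE : (2 * w).-1 = (w + w.-1)%N by lia.
have [kap0|kap0] := eqVneq kap 0.
  exists ((2 * pi / pi ^+ w * (ratr c * g%:R ^+ k / g%:R ^+ (2 * w).-1) * lattice_sum 0 k) *: 'X^k).
    rewrite (leq_trans (size_scale_leq _ _))// size_polyXn; lia.
  move=> t t0; have tn := lt0r_neq0 t0.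
  have -> : series (exp_summand (exp_coef w g (c, kap, k)) t) = fun=> 0.
    apply/funext => n; rewrite /series /= big1// => i _.
    by rewrite /exp_summand /exp_coef /= kap0 eqxx /= rmorph0 mul0r.
  rewrite lim_cst// mulr0 addr0 kap0 mulr0 mul0r hornerZ hornerXn.
  rewrite !exprMn exprVn whE !exprD.
  have := expf_neq0 w tn; have := expf_neq0 w.-1 tn; have := expf_neq0 w pin.
  have := expf_neq0 w gn; have := expf_neq0 w.-1 gn.
  move: (t ^+ w) (t ^+ w.-1) (pi ^+ w) (g%:R ^+ w) (g%:R ^+ w.-1) => tw tw1 pw gw gw1 n1 n2 n3 n4 n5.
  move: (pi : R) pin => P Pn.
  by field; rewrite n1 n2 n3 n4 n5.
have sgE : exists2 sg : R, sg = (if kap < 0 then (-1) ^+ k else 1) &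
    forall a : R, 0 < a -> lattice_sum (kap%:~R * a) k = sg * lattice_sum (`|kap|%:~R * a) k.
  eexists; first by [].
  move=> a a0; have [kn|kn] := ltP kap 0; last by rewrite mul1r ger0_norm.
  have -> : kap%:~R * a = - (`|kap|%:~R * a) by rewrite ltr0_norm// mulrNz mulNr opprK.
  exact: lattice_sum_sign.
have [sg sgD sgE'] := sgE.
set m : R := `|kap|%:~R.
have m0 : 0 < m by rewrite /m ltr0z normr_gt0.
exists ((- (pi / pi ^+ w * (ratr c / g%:R ^+ (2 * w).-1) * sg * ((2 * m)^-1 ^+ k)))%:P +
   (if k == 1%N then pi * pi / pi ^+ w * (ratr c * g%:R / g%:R ^+ (2 * w).-1) * sg else 0) *: 'X).
  rewrite (leq_trans (size_polyD _ _))// geq_max; apply/andP; split.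
    by rewrite (leq_trans (size_polyC_leq1 _))//; lia.
  by rewrite (leq_trans (size_scale_leq _ _))// size_polyX; lia.
move=> t t0; have tn := lt0r_neq0 t0.
have gt0 : 0 < g%:R * t by rewrite mulr_gt0// ltr0n.
have -> : 2 * kap%:~R * (g%:R * t) = kap%:~R * (2 * (g%:R * t)) by ring.
have g0' : 0 < g%:R :> R by rewrite ltr0n.
rewrite sgE' ?mulr_gt0// -/m.
have a0 : 0 < m * (2 * (g%:R * t)) by rewrite !mulr_gt0.
have -> : forall u v : R, 2 * pi * u * (sg * v) = pi * u * sg * (2 * v) by move=> u v; ring.
rewrite lattice_sum_pos//.
have -> : limn (series (exp_summand (exp_coef w g (c, kap, k)) t)) =
   ratr c * (g%:R ^+ k / g%:R ^+ (2 * w).-1) * sg * (2 ^+ k / (k.-1)`!%:R) *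
     limn (series (exp_term (m * (2 * (g%:R * t))) k.-1)).
  pose e := (g * absz kap)%N; have e0 : (0 < e)%N by rewrite muln_gt0 g0 absz_gt0.
  pose h (q : nat) : R := q%:R ^+ k.-1 * expR (- (4 * pi * t * (e * q)%:R)).
  pose H (N : nat) : R := if (e %| N.+1)%N then h (N.+1 %/ e)%N else 0.
  have cH : cvgn (series H).
    apply: (@cvg_series_dom _ _ (fun N => N.+1%:R ^+ k.-1 * expR (- (4 * pi * t * N.+1%:R)))); last first.
      by apply: cvg_pow_exp; rewrite !mulr_gt0 ?pi_gt0.
    move=> N; rewrite /H; case: ifP => [eN|_]; last by rewrite normr0 mulr_ge0 ?exprn_ge0 ?expR_ge0.
    rewrite /h muln_divA// mulKn// ger0_norm ?mulr_ge0 ?exprn_ge0 ?expR_ge0//.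
    by rewrite ler_wpM2r ?expR_ge0// lerXn2r ?nnegrE// ler_nat leq_div.
  have -> : exp_term (m * (2 * (g%:R * t))) k.-1 = fun q => h q.+1.
    apply/funext => q; rewrite /exp_term /h; congr (_ * expR _).
    rewrite /e !natrM /m -[(absz kap)%:R]/((absz kap)%:Z%:~R) abszE; ring.
  rewrite (series_sparse e0 cH) -lim_seriesZ//; congr (limn (series _)).
  apply/funext => N; rewrite /exp_summand /exp_coef /= kap0 /= -/e /H.
  case: ifP => [eN|_]; last by rewrite rmorph0 mul0r mulr0.
  have r1 : ratr (g%:R ^+ k / g%:R ^+ (2 * w).-1) = g%:R ^+ k / g%:R ^+ (2 * w).-1 :> R.
    by rewrite fmorph_div/= !rmorphXn/= !ratr_nat.
  have r2 : ratr (2 ^+ k / (k.-1)`!%:R) = 2 ^+ k / (k.-1)`!%:R :> R.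
    by rewrite fmorph_div/= rmorphXn/= !ratr_nat.
  have r3 : ratr ((N.+1 %/ e)%:R ^+ k.-1) = (N.+1 %/ e)%:R ^+ k.-1 :> R.
    by rewrite rmorphXn/= ratr_nat.
  rewrite /h [(e * _)%N]mulnC divnK// 4!rmorphM /= r1 r2 r3.
  have -> : ratr (if kap < 0 then (-1) ^+ k else 1) = sg.
    by rewrite sgD; case: ifP => _; rewrite ?rmorphXn ?rmorphN1 ?rmorph1.
  by rewrite !mulrA.
rewrite hornerD hornerC hornerZ hornerX.
have -> : (m * (2 * (g%:R * t)))^-1 = (2 * m)^-1 * (g%:R * t)^-1 by rewrite -invfM; congr (_^-1); ring.
have -> : ((2 * m)^-1 * (g%:R * t)^-1) ^+ k = (2 * m)^-1 ^+ k * ((g%:R * t) ^- k).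
  by rewrite exprMn [X in _ * X]exprVn.
(* The algebra is isolated, with [u] standing for the constant in Lipschitz' formula and [E] for the
   exponential series. *)
have main : forall u E : R, (t / pi) ^+ w * (pi * (ratr c * (g%:R * t) ^+ k / (g%:R * t) ^+ (2 * w).-1) * sg *
   (- ((2 * m)^-1 ^+ k * ((g%:R * t) ^- k)) + u + (2 * pi) ^+ k / (k.-1)`!%:R * E)) =
   (t ^+ w.-1)^-1 * (- (pi / pi ^+ w * (ratr c / g%:R ^+ (2 * w).-1) * sg * ((2 * m)^-1 ^+ k))) +
   (t ^+ w.-1)^-1 * (u * (pi / pi ^+ w * (ratr c * g%:R ^+ k / g%:R ^+ (2 * w).-1) * sg) * t ^+ k) +
   (pi * t) ^+ k.+1 / (pi * t) ^+ w * (ratr c * (g%:R ^+ k / g%:R ^+ (2 * w).-1) * sg * (2 ^+ k / (k.-1)`!%:R) * E).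
  move=> u E; move: ((2 * m)^-1 ^+ k) => m2; rewrite [(pi * t) ^+ k.+1]exprS !exprMn !exprVn whE !exprD.
  have -> : t ^+ w = t * t ^+ w.-1 by rewrite -exprS prednK.
  have : (k.-1)`!%:R != 0 :> R by rewrite pnatr_eq0 -lt0n fact_gt0.
  have := expf_neq0 w.-1 tn; have := expf_neq0 w pin.
  have := expf_neq0 w gn; have := expf_neq0 w.-1 gn; have := expf_neq0 k gn; have := expf_neq0 k tn.
  move: (t ^+ w.-1) (pi ^+ w) (g%:R ^+ w) (g%:R ^+ w.-1) (g%:R ^+ k) (t ^+ k) => tw1 pw gw gw1 gk tk.
  move: (2 ^+ k) ((k.-1)`!%:R) (pi ^+ k) => k2 F pk n3 n4 n5 n6 n7 n8 n9.
  move: (pi : R) pin => P Pn.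
  by field; rewrite ?n3 ?n4 ?n5 ?n6 ?n7 ?n8 ?n9 ?tn ?Pn.
rewrite main mulrDr; congr (_ + _ + _); congr (_ * _).
case: eqP => [->|_]; last by rewrite !mul0r.
by rewrite !expr1 !mulrA; congr (_ * _); ring.
Qed.

End ModeExpansion.

(** * Coefficients of the exponentials: exponents, support and growth *)

Section ModeData.
Variable R : realType.
Implicit Types (t : R) (g w k N : nat).

Lemma gcd_decomposition (n1 n2 : int) : (n1, n2) != 0 ->
  exists (g : nat) (nu1 nu2 mu1 mu2 : int),
  [/\ (0 < g)%N, n1 = g%:Z * nu1, n2 = g%:Z * nu2 & nu1 * mu2 - nu2 * mu1 = 1].
Proof.
move=> n0; pose g := absz (gcdz n1 n2).
have gE : gcdz n1 n2 = g%:Z by [].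
have g0 : (0 < g)%N.
  rewrite absz_gt0 gcdz_eq0; apply: contra n0 => /andP[/eqP-> /eqP->].
  by apply/eqP.
have [u [v uv]] := Bezoutz n1 n2; rewrite gE in uv.
have h1 : n1 = g%:Z * (n1 %/ g)%Z by rewrite mulrC divzK// -gE dvdz_gcdl.
have h2 : n2 = g%:Z * (n2 %/ g)%Z by rewrite mulrC divzK// -gE dvdz_gcdr.
(* Bezout's relation u n1 + v n2 = g, divided by g, is the determinant condition for mu = (-v,
   u). *)
exists g, (n1 %/ g)%Z, (n2 %/ g)%Z, (- v), u; split=> //.
have gn : g%:Z != 0 by lia.
apply: (mulfI gn); move: uv; rewrite mulr1 {1}h1 {1}h2 => uv.
by rewrite -[RHS]uv; ring.
Qed.

Lemma mode_sum_reindex a1 a2 a3 t g (nu1 nu2 mu1 mu2 : int) :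
  nu1 * mu2 - nu2 * mu1 = 1 ->
  mode_sum a1 a2 a3 t (g%:Z * nu1, g%:Z * nu2) =
  (\esum_(d in [set: int]) \esum_(j in [set: int])
     \int[lebesgue_measure]_(x in `[0%R, 1%R])
       (row_product nu1 nu2 mu1 mu2 a1 a2 a3 d (g%:R * t) (j%:~R + g%:R * x))%:E)%E.
Proof.
move=> det1; rewrite esum_esum; last first.
  by move=> d j _ _; apply: integral_ge0 => x _; rewrite lee_fin row_product_ge0.
have -> : [set: int] `*`` (fun=> [set: int]) = [set: int * int] by apply/seteqP; split.
pose e (p : int * int) := (p.2 * nu1 + p.1 * mu1, p.2 * nu2 + p.1 * mu2).
have bij : set_bij [set: int * int] [set: int * int] e.
  split=> //.
  - move=> [d j] [d' j'] _ _; rewrite /e /= => -[h1 h2].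
    have dE x y : nu1 * (y * nu2 + x * mu2) - nu2 * (y * nu1 + x * mu1) = x.
      by rewrite -[RHS]mulr1 -det1; ring.
    have jE x y : mu2 * (y * nu1 + x * mu1) - mu1 * (y * nu2 + x * mu2) = y.
      by rewrite -[RHS]mulr1 -det1; ring.
    by congr pair; [rewrite -(dE d j) -(dE d' j') h1 h2|rewrite -(jE d j) -(jE d' j') h1 h2].
  - move=> [m1 m2] _; exists (nu1 * m2 - nu2 * m1, mu2 * m1 - mu1 * m2) => //.
    rewrite /e /=; congr pair.
      by rewrite -[RHS]mulr1 -det1; ring.
    by rewrite -[RHS]mulr1 -det1; ring.
rewrite /mode_sum (reindex_esum _ _ _ _ bij); apply: eq_esum => -[d j] _ /=.
apply: eq_integral => x _; congr (_%:E).
have E (n m : int) : row_factor_real (g%:Z * n) (j * n + d * m) 1 t x =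
    row_factor_real n m d (g%:R * t) (j%:~R + g%:R * x).
  by rewrite /row_factor_real !(intrD, intrM) /=; congr (_^-1); ring.
rewrite /row_product /= !E.
have -> : - (g%:Z * nu1 + g%:Z * nu2) = g%:Z * (- (nu1 + nu2)) by ring.
have -> : - (j * nu1 + d * mu1 + (j * nu2 + d * mu2)) = j * (- (nu1 + nu2)) + d * (- (mu1 + mu2)) by ring.
by rewrite E.
Qed.

(** Pole order k contributes to the exponent m = k + 1 - w; the factor [4 ^ (- m)] converts powers
    of pi t into powers of 4 pi t. *)
Definition mode_coef w g (s : seq (rat * int * nat)) N (m : int) : rat :=
  \sum_(x <- s | x.2.+1%:Z - w%:Z == m) exp_coef w g x N * 4 ^ (- m).

Definition mode_term w (f : nat -> int -> rat) t N : R :=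
  expR (- (N%:R * (4 * pi * t))) *
  \sum_(m <- zrange (2 - w%:Z) (w%:Z - 3)) ratr (f N m) * (4 * pi * t) ^ m.

Lemma exp_coef_eq0 w g x N : x.1.2 = 0 -> exp_coef w g x N = 0.
Proof. by move=> x0; rewrite /exp_coef x0 eqxx. Qed.

Lemma mode_coef_sum S w g (s : seq (rat * int * nat)) N t : (2 < w)%N -> 0 < t ->
  all (admissible S (2 * w).-1 w.-1) s ->
  \sum_(m <- zrange (2 - w%:Z) (w%:Z - 3)) ratr (mode_coef w g s N m) * (4 * pi * t) ^ m =
  \sum_(x <- s) (pi * t) ^+ x.2.+1 / (pi * t) ^+ w * ratr (exp_coef w g x N).
Proof.
move=> w2 t0 adm; have p0 := pi_gt0 R.
rewrite /mode_coef.
transitivity (\sum_(m <- zrange (2 - w%:Z) (w%:Z - 3)) \sum_(x <- s)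
    (if x.2.+1%:Z - w%:Z == m then ratr (exp_coef w g x N * 4 ^ (- m)) * (4 * pi * t) ^ m else 0)).
  apply: eq_bigr => m _; rewrite raddf_sum /= mulr_suml big_mkcond /=.
  by apply: eq_bigr => x _; case: ifP.
rewrite exchange_big /= big_seq [RHS]big_seq; apply: eq_bigr => x /(allP adm) /and4P[_ x0 _ xw].
have [k0|k0] := eqVneq x.1.2 0.
  rewrite exp_coef_eq0// rmorph0 mulr0 big1// => m _.
  by rewrite mul0r rmorph0 mul0r if_same.
rewrite -big_mkcond -big_filter.
(* The exponent lies in the range because 1 <= k <= w - 1 gives 2 - w <= k + 1 - w <= 0, and 0 <= w
   - 3. *)
have -> : [seq m <- zrange (2 - w%:Z) (w%:Z - 3) | x.2.+1%:Z - w%:Z == m] = [:: x.2.+1%:Z - w%:Z].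
  rewrite -[RHS](filter_pred1_uniq (zrange_uniq (2 - w%:Z) (w%:Z - 3))).
    by apply: eq_filter => m /=; rewrite eq_sym.
  rewrite mem_zrange; move: (implyP xw k0) x0; move: (x.2) => k; lia.
rewrite big_seq1 rmorphM/=; set m := _ - _.
have pt : pi * t != 0 by rewrite gt_eqF// mulr_gt0.
have n4 : 4 != 0 :> R by rewrite pnatr_eq0.
have -> : ratr (4 ^ (- m)) = (4 ^ (- m)) :> R by rewrite fmorphXz rmorph_nat.
have -> : 4 * pi * t = 4 * (pi * t) by rewrite mulrA.
have e4 : 4 ^ (- m) * 4 ^ m = 1 :> R by rewrite -expfzDr// addNr expr0z.
rewrite expfzMl; transitivity (4 ^ (- m) * 4 ^ m * ((pi * t) ^ m * ratr (exp_coef w g x N))).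
  by ring.
rewrite e4 mul1r.
congr (_ * _); rewrite /m expfzDr// -exprnN -exprnP.
by [].
Qed.

Lemma exp_part_sum S w g (s : seq (rat * int * nat)) t : (0 < g)%N -> (2 < w)%N -> 0 < t ->
  all (admissible S (2 * w).-1 w.-1) s ->
  cvgn (series (fun N => mode_term w (mode_coef w g s) t N.+1)) /\
  \sum_(x <- s) (pi * t) ^+ x.2.+1 / (pi * t) ^+ w * limn (series (exp_summand (exp_coef w g x) t)) =
  limn (series (fun N => mode_term w (mode_coef w g s) t N.+1)).
Proof.
move=> g0 w2 t0 adm.
have -> : (fun N => mode_term w (mode_coef w g s) t N.+1) =
    fun N => \sum_(x <- s) (pi * t) ^+ x.2.+1 / (pi * t) ^+ w * exp_summand (exp_coef w g x) t N.
  apply/funext => N; rewrite /mode_term (mode_coef_sum g N.+1 w2 t0 adm) mulr_sumr.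
  apply: eq_bigr => x _; rewrite /exp_summand.
  have -> : N.+1%:R * (4 * pi * t) = 4 * pi * t * N.+1%:R by ring.
  by ring.
suff h : series (fun N => \sum_(x <- s) (pi * t) ^+ x.2.+1 / (pi * t) ^+ w * exp_summand (exp_coef w g x) t N)
    @ \oo --> \sum_(x <- s) (pi * t) ^+ x.2.+1 / (pi * t) ^+ w * limn (series (exp_summand (exp_coef w g x) t)).
  by split; [apply/cvg_ex; eexists; exact: h|rewrite (cvg_lim _ h)].
elim: s adm => [|x s IH] /=.
  move=> _; rewrite big_nil; apply: seq_eq (cvg_cst 0) => n.
  by rewrite /series /= big1// => i _; rewrite big_nil.
move=> /andP[/and4P[_ x0 xh xw] adm]; rewrite big_cons.
have cx : cvgn (series (exp_summand (exp_coef w g x) t)).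
  apply: (@exp_summand_cvg R _ ((Num.truncn `|x.1.1|).+1 * 2 ^ w) w) => // N.
  apply: (le_trans (exp_coef_le g0 (ltn0Sn N) xh xw)).
  rewrite !natrM !natrX mulrA ler_wpM2r ?exprn_ge0// ler_wpM2r ?exprn_ge0//.
  exact: ltW (truncnS_gt _).
have := seqD (seqZ ((pi * t) ^+ x.2.+1 / (pi * t) ^+ w) cx) (IH adm); apply: seq_eq => n.
rewrite /series /= mulr_sumr -big_split /=; apply: eq_bigr => i _.
by rewrite big_cons.
Qed.

Lemma laurent_part_sum S w g (s : seq (rat * int * nat)) : (0 < g)%N -> (0 < w)%N ->
  all (admissible S (2 * w).-1 w.-1) s ->
  exists2 p : {poly R}, (size p <= 2 * w)%N & forall t, 0 < t ->
    \sum_(x <- s) (t / pi) ^+ w * (2 * pi * (ratr x.1.1 * (g%:R * t) ^+ x.2 / (g%:R * t) ^+ (2 * w).-1) *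
       lattice_sum (2 * x.1.2%:~R * (g%:R * t)) x.2) =
    (t ^+ w.-1)^-1 * p.[t] + \sum_(x <- s)
      (pi * t) ^+ x.2.+1 / (pi * t) ^+ w * limn (series (exp_summand (exp_coef w g x) t)).
Proof.
move=> g0 w0; elim: s => [|x s IH] /=.
  by move=> _; exists 0; rewrite ?size_poly0// => t _; rewrite !big_nil horner0 mulr0 addr0.
move=> /andP[/and4P[_ x0 xh xw] adm]; have [p sp hp] := IH adm.
have [q sq hq] := @lattice_part R w g x g0 x0 xh xw w0.
exists (q + p); first by rewrite (leq_trans (size_polyD _ _))// geq_max sq.
by move=> t t0; rewrite !big_cons hp// hq// hornerD; ring.
Qed.

(** Divisibility gives g |kappa| <= N, and [dominating] bounds g |nu_i| by twice the left-hand
    side. *)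
Lemma exp_coef_support w g (nu1 nu2 : int) x N : (0 < N)%N -> dominating nu1 nu2 x.1.2 ->
  exp_coef w g x N != 0 -> (g * absz nu1 <= 2 * N)%N /\ (g * absz nu2 <= 2 * N)%N.
Proof.
move=> N0; rewrite /exp_coef /dominating; case: ifP => [/andP[k0 eN]|]; last by rewrite eqxx.
rewrite (negPf k0) /= => /andP[h1 h2] _.
have le := dvdn_leq N0 eN.
have l1 : (absz nu1 <= 2 * absz x.1.2)%N by lia.
have l2 : (absz nu2 <= 2 * absz x.1.2)%N by lia.
by split; nia.
Qed.

(** The first factor is [step_cost] with row bound 16 N^2 and the powers of N removed; these are the
    N^(4 w w) in [growth_exp]. The factors 2^w and N^w come from [exp_coef_le], and 4^w bounds
    [4 ^ (- m)]. *)
Definition growth_const w : nat := ((32 * (2 * w).+1) ^ (2 * w)) ^ w * 2 ^ w * 4 ^ w.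
Definition growth_exp w : nat := 4 * w * w + w.

(** The partial fraction bound depends on nu, but as soon as one coefficient at N is nonzero, its
    support bounds nu by 2N; this makes the estimate uniform over the modes. *)
Lemma mode_coef_le w g (nu1 nu2 : int) (s : seq (rat * int * nat)) N m :
  (0 < g)%N -> (0 < N)%N ->
  all (admissible (dominating nu1 nu2) (2 * w).-1 w.-1) s ->
  \sum_(x <- s) `|x.1.1| <= ((step_cost (row_bound nu1 nu2) (2 * w)) ^ w)%:R ->
  `|mode_coef w g s N m| <= (growth_const w)%:R * N%:R ^+ growth_exp w.
Proof.
move=> g0 N0 adm sB.
have rhs0 : 0 <= (growth_const w)%:R * N%:R ^+ growth_exp w :> rat by rewrite mulr_ge0 ?exprn_ge0.
have [/hasP[x xs /andP[/eqP xm xN]]|/hasPn none] :=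
    boolP (has (fun x => (x.2.+1%:Z - w%:Z == m) && (exp_coef w g x N != 0)) s); last first.
  rewrite /mode_coef big_seq_cond big1 ?normr0// => x /andP[xs xm].
  by have := none x xs; rewrite xm /= negbK => /eqP->; rewrite mul0r.
have /and4P[xS x0 _ _] := allP adm x xs.
have [l1 l2] := exp_coef_support N0 xS xN.
have m4 : (4 : rat) ^ (- m) <= (4 ^ w)%:R.
  rewrite -xm opprB expfzDr// -exprnN -exprnP natrX ler_pdivrMr ?exprn_gt0// ler_peMr ?exprn_ge0// exprn_ege1//.
have m40 : 0 <= (4 : rat) ^ (- m) by rewrite exprz_ge0.
have Qle : (step_cost (row_bound nu1 nu2) (2 * w) ^ w <= ((32 * (2 * w).+1) ^ (2 * w)) ^ w * N ^ (4 * w * w))%N.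
  have n1 : (absz nu1 <= 2 * N)%N by apply: leq_trans l1; rewrite leq_pmull.
  have n2 : (absz nu2 <= 2 * N)%N by apply: leq_trans l2; rewrite leq_pmull.
  have rb : (row_bound nu1 nu2 <= 16 * N ^ 2)%N.
    rewrite /row_bound; apply: (@leq_trans ((4 * N) ^ 2)); last by rewrite expnMn.
    by rewrite leq_sqr; lia.
  have -> : (4 * w * w = (2 * (2 * w)) * w)%N by lia.
  rewrite [(N ^ _)%N]expnM -expnMn; case: (posnP w) => [->//|w0].
  rewrite leq_exp2r// [(N ^ (2 * _))%N]expnM -expnMn /step_cost.
  by rewrite leq_exp2r ?muln_gt0//; nia.
rewrite /mode_coef; apply: (le_trans (ler_norm_sum _ _ _)).
apply: (@le_trans _ _ (\sum_(x <- s) `|x.1.1| * ((2 ^ w * N ^ w)%:R * (4 ^ w)%:R))).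
  rewrite [leRHS](bigID (fun x : rat * int * nat => x.2.+1%:Z - w%:Z == m)) /=.
  rewrite -[leLHS]addr0; apply: lerD; last by apply: sumr_ge0 => y _; rewrite !mulr_ge0.
  rewrite big_seq_cond [leRHS]big_seq_cond; apply: ler_sum => y /andP[ys _].
  have /and4P[_ _ yh yw] := allP adm y ys.
  rewrite normrM [`|4 ^ _|]ger0_norm// mulrA ler_pM//.
  exact: exp_coef_le.
rewrite -mulr_suml; apply: (@le_trans _ _ ((((32 * (2 * w).+1) ^ (2 * w)) ^ w * N ^ (4 * w * w))%:R * ((2 ^ w * N ^ w)%:R * (4 ^ w)%:R))).
  by rewrite ler_wpM2r ?mulr_ge0// (le_trans sB)// ler_nat.
rewrite -natrX -!natrM ler_nat /growth_const /growth_exp expnD.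
by rewrite leq_eqVlt; apply/orP; left; apply/eqP; ring.
Qed.

End ModeData.

(** * The expansion of a single mode *)

Section PerMode.
Variable R : realType.
Implicit Types t : R.

Lemma mode_coef_support w g (nu1 nu2 : int) (s : seq (rat * int * nat)) N m : (0 < N)%N ->
  all (admissible (dominating nu1 nu2) (2 * w).-1 w.-1) s -> mode_coef w g s N m != 0 ->
  (g * absz nu1 <= 2 * N)%N /\ (g * absz nu2 <= 2 * N)%N.
Proof.
move=> N0 adm fn; have [/hasP[x xs xN]|/hasPn none] :=
    boolP (has (fun x => exp_coef w g x N != 0) s).
  have /and4P[xS _ _ _] := allP adm x xs.
  exact: exp_coef_support N0 xS xN.
case/eqP: fn; rewrite /mode_coef big_seq_cond big1// => x /andP[/none xs _].
by move: xs; rewrite negbK => /eqP->; rewrite mul0r.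
Qed.

Lemma mode_term0 w t N : mode_term w (fun _ _ => 0) t N = 0.
Proof. by rewrite /mode_term big1 ?mulr0// => m _; rewrite rmorph0 mul0r. Qed.

Lemma mode_sum_zero a1 a2 a3 t : mode_sum a1 a2 a3 t (0, 0) = mode_sum a1 a2 a3 1 (0, 0).
Proof.
apply: eq_esum => m _; apply: eq_integral => x _; congr (_%:E).
have E (d : int) : row_factor_real 0 d 1 t x = row_factor_real 0 d 1 1 x.
  by rewrite /row_factor_real !mul0r.
by rewrite /row_product /= !addr0 oppr0 !E.
Qed.

Lemma mode_data a1 a2 a3 (n : int * int) : (0 < a1)%N -> (0 < a2)%N -> (0 < a3)%N ->
  let w := (a1 + a2 + a3)%N in
  exists (P : {poly R}) (f : nat -> int -> rat),
  [/\ (size P <= 2 * w)%N,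
    forall N m, (0 < N)%N -> `|f N m| <= (growth_const w)%:R * N%:R ^+ growth_exp w,
    forall N m, (0 < N)%N -> f N m != 0 -> (absz n.1 <= 2 * N)%N /\ (absz n.2 <= 2 * N)%N
  & forall t, 0 < t -> cvgn (series (fun N => mode_term w f t N.+1)) /\
      (t / pi) ^+ w * fine (mode_sum a1 a2 a3 t n) =
      (t ^+ w.-1)^-1 * P.[t] + limn (series (fun N => mode_term w f t N.+1))].
Proof.
move=> h1 h2 h3 w; have w2 : (2 < w)%N by rewrite /w; lia.
have w0 : (0 < w)%N by lia.
have pin : (pi : R) != 0 by rewrite gt_eqF// pi_gt0.
case: n => n1 n2; have [[-> ->]|n0] := eqVneq (n1, n2) 0.
  (* For n = 0 the mode is a constant times t^w, that is, t^(1-w) times a multiple of t^(2w-1). *)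
  exists ((fine (mode_sum a1 a2 a3 (1 : R) (0, 0)) / pi ^+ w) *: 'X^((2 * w).-1)), (fun _ _ => 0).
  split=> [|N m N0|N m N0|t t0].
  - by rewrite (leq_trans (size_scale_leq _ _))// size_polyXn; lia.
  - by rewrite normr0 mulr_ge0 ?exprn_ge0.
  - by rewrite eqxx.
  have -> : series (fun N => mode_term w (fun _ _ => 0) t N.+1) = fun=> 0.
    by apply/funext => N; rewrite /series /= big1// => i _; rewrite mode_term0.
  split; first exact: is_cvg_cst.
  rewrite (cvg_lim _ (cvg_cst (0 : R)))// addr0 hornerZ hornerXn mode_sum_zero.
  have tn : t != 0 by rewrite gt_eqF.
  have -> : (2 * w).-1 = (w.-1 + w)%N by lia.
  rewrite exprD expr_div_n mulrCA mulrA mulrAC.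
  by move: (fine _) => F; field; rewrite ?expf_neq0//= pin.
have [g [nu1 [nu2 [mu1 [mu2 [g0 e1 e2 det1]]]]]] := gcd_decomposition n0.
have [s [K [adm sB tot]]] := row_total R det1 h1 h2 h3.
rewrite -/w in adm sB tot.
have [p sp hp] := laurent_part_sum R g0 w0 adm.
exists ((K / (pi ^+ w * g%:R ^+ (2 * w).-1))%:P + p), (mode_coef w g s); split=> [|N m N0|N m N0 fn|t t0].
- by rewrite (leq_trans (size_polyD _ _))// geq_max sp andbT (leq_trans (size_polyC_leq1 _))//; lia.
- exact: mode_coef_le g0 N0 adm sB.
- by rewrite /= e1 e2 !abszM; exact: mode_coef_support N0 adm fn.
have [cv eX] := exp_part_sum g0 w2 t0 adm; split=> //.
have gt0 : 0 < g%:R * t by rewrite mulr_gt0// ltr0n.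
rewrite e1 e2 (mode_sum_reindex _ _ _ _ _ det1) tot//= mulrDr mulr_sumr.
rewrite hp// eX hornerD hornerC mulrDr addrA; congr (_ + _ + _).
have tn : t != 0 by rewrite gt_eqF.
have gn : (g%:R : R) != 0 by rewrite pnatr_eq0; lia.
have -> : (2 * w).-1 = (w.-1 + w)%N by lia.
rewrite expr_div_n exprMn !exprD.
move: (pi : R) pin => P Pn.
by field; rewrite ?expf_neq0//= Pn gn tn.
Qed.

End PerMode.

(** * Limits and uniqueness of Laurent polynomials *)

Section LaurentUniqueness.
Variable R : realType.
Implicit Types (t : R) (p : {poly R}).

Lemma seq_sum (I : Type) (s : seq I) (u : I -> nat -> R) (l : I -> R) :
  (forall i, u i @ \oo --> l i) ->
  (fun M => \sum_(i <- s) u i M) @ \oo --> \sum_(i <- s) l i.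
Proof.
move=> ul; elim: s => [|i s IH].
  by rewrite big_nil; apply: seq_eq (cvg_cst 0) => M; rewrite big_nil.
by rewrite big_cons; apply: seq_eq (seqD (ul i) IH) => M; rewrite big_cons.
Qed.

(* Dividing by X - c reduces the degree. *)
Lemma poly_coef_cvg (d : nat) (p : nat -> {poly R}) (a : R) :
  (forall M, (size (p M) <= d)%N) -> (forall t, a < t -> cvgn (fun M => (p M).[t])) ->
  forall i, cvgn (fun M => (p M)`_i).
Proof.
elim: d p a => [|d IH] p a sp cp i.
  rewrite (_ : (fun _ => _) = fun=> 0); first exact: is_cvg_cst.
  by apply/funext => M; move: (sp M); rewrite size_poly_leq0 => /eqP->; rewrite coef0.
pose c := a + 1; have ac : a < c by rewrite ltrDl.
pose q M := (p M - (p M).[c]%:P) %/ ('X - c%:P).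
have pq M : p M = q M * ('X - c%:P) + (p M).[c]%:P.
  rewrite /q divpK ?subrK// dvdp_XsubCl /root hornerD hornerN hornerC subrr//.
have sq M : (size (q M) <= d)%N.
  rewrite size_divp ?polyXsubC_eq0// size_XsubC leq_subLR add1n.
  rewrite (leq_trans (size_polyD _ _))// size_polyN geq_max sp /=.
  exact: leq_trans (size_polyC_leq1 _) _.
have cq t : c < t -> cvgn (fun M => (q M).[t]).
  move=> ct; have tc : t - c != 0 by rewrite gt_eqF// subr_gt0.
  rewrite (_ : (fun _ => _) = fun M => ((p M).[t] - (p M).[c]) / (t - c)).
    apply: is_cvgMl; apply: is_cvgB; apply: cp => //; exact: lt_trans ct.
  apply/funext => M; rewrite [in (p M).[t]]pq !hornerE.
  by field.
have {}IH := IH q c sq cq.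
rewrite (_ : (fun _ => _) = fun M => (if i == 0%N then 0 else (q M)`_i.-1) - (q M)`_i * c + (if i == 0%N then (p M).[c] else 0)).
  apply: is_cvgD; last by case: (i == 0%N); [exact: cp|exact: is_cvg_cst].
  apply: is_cvgB; last by apply: is_cvgMl; exact: IH.
  by case: (i == 0%N); [exact: is_cvg_cst|exact: IH].
by apply/funext => M; rewrite [in LHS]pq mulrBr !coefE.
Qed.

Lemma poly_limit (d : nat) (p : nat -> {poly R}) (h : R -> R) :
  (forall M, (size (p M) <= d)%N) ->
  (forall t, 0 < t -> (fun M => (p M).[t]) @ \oo --> h t) ->
  exists q : {poly R}, forall t, 0 < t -> h t = q.[t].
Proof.
move=> sp ph.
have cc i : cvgn (fun M => (p M)`_i).
  by apply: (poly_coef_cvg (a := 0) sp) => t t0; apply/cvg_ex; exists (h t); exact: ph.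
exists (\poly_(i < d) limn (fun M => (p M)`_i)) => t t0.
have h1 (i : 'I_d) : (fun M => (p M)`_i * t ^+ i) @ \oo --> limn (fun M => (p M)`_i) * t ^+ i.
  by apply: cvgMl; exact: cc.
rewrite horner_poly -(cvg_lim _ (ph t t0))//; apply: cvg_lim => //.
apply: seq_eq (seq_sum (s := index_enum 'I_d) h1) => M.
by rewrite (horner_coef_wide _ (sp M)).
Qed.

Lemma exponentially_decayingB (f g : R -> R) :
  exponentially_decaying f -> exponentially_decaying g ->
  exponentially_decaying (fun t => f t - g t).
Proof.
move=> [c [K [c0 fK]]] [c' [K' [c'0 gK]]].
have le (a b k t : R) : 0 < t -> b <= a -> k * expR (- (a * t)) <= `|k| * expR (- (b * t)).
  move=> t0 ba; apply: (le_trans (ler_wpM2r (expR_ge0 _) (ler_norm k))).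
  by rewrite ler_wpM2l// ler_expR lerN2 ler_wpM2r// ltW.
exists (Num.min c c'), (`|K| + `|K'|); split; first by rewrite lt_min c0.
near=> t; have t0 : 0 < t by near: t; exact: nbhs_pinfty_gt.
apply: (le_trans (ler_normB _ _)); rewrite mulrDl lerD//.
  apply: (@le_trans _ _ (K * expR (- (c * t)))); first by near: t.
  by apply: le => //; rewrite ge_min lexx.
apply: (@le_trans _ _ (K' * expR (- (c' * t)))); first by near: t.
by apply: le => //; rewrite ge_min lexx orbT.
Unshelve. all: by end_near. Qed.

(** A positive leading coefficient would be an eventual lower bound for p, whereas along the
    integers p is at most K t^v exp(-ct), which tends to 0. *)
Lemma lead_coef_le0 p v : exponentially_decaying (fun t => p.[t] / t ^+ v) -> lead_coef p <= 0.
Proof.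
move=> [c [K [c0 hK]]]; rewrite leNgt; apply/negP => lc.
have [n hn] := poly_pinfty_gt_lc lc.
have [A [_ hA]] := hK.
have u0 : (fun q => K * (q.+1%:R ^+ v * expR (- (c * q.+1%:R)))) @ \oo --> (0 : R).
  by rewrite -[X in _ --> X](mulr0 K); apply: cvgMr; apply: cvg_series_cvg_0; exact: cvg_pow_exp.
have : lead_coef p <= 0; last by rewrite leNgt lc.
apply: (ler_cvg_to (cvg_cst (lead_coef p)) u0).
near=> q; have qx (B : R) : (Num.truncn `|B| <= q)%N -> B < q.+1%:R.
  move=> Bq; apply: (le_lt_trans (ler_norm B)); apply: (lt_le_trans (truncnS_gt _)).
  by rewrite ler_nat ltnS.
have hA' := hA q.+1%:R (qx A _); have hn' := hn q.+1%:R (ltW (qx n _)).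
have q0 : 0 < q.+1%:R ^+ v :> R by rewrite exprn_gt0.
apply: (le_trans (hn' _)); first by near: q; exact: nbhs_infty_ge.
apply: (le_trans (ler_norm _)); rewrite mulrCA mulrC -ler_pdivrMr//.
rewrite -[X in _ / X](gtr0_norm q0) -normf_div; apply: hA'.
by near: q; exact: nbhs_infty_ge.
Unshelve. all: by end_near.
Qed.

Lemma poly_decay_eq0 p v : exponentially_decaying (fun t => p.[t] / t ^+ v) -> p = 0.
Proof.
move=> h; apply/eqP; rewrite -lead_coef_eq0 eq_le (lead_coef_le0 h) -oppr_le0 -lead_coefN.
apply: (@lead_coef_le0 _ v); have [c [K [c0 hK]]] := h.
exists c, K; split=> //; apply: filterS hK => t.
by rewrite hornerN mulNr normrN.
Qed.

End LaurentUniqueness.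

(** * Convergence and decay of the exponential series; sums over boxes *)

Section Assembly.
Variable R : realType.
Implicit Types (t y : R) (w N A E L M : nat) (f : nat -> int -> rat).

Definition power_sum w y : R := \sum_(m <- zrange (2 - w%:Z) (w%:Z - 3)) y ^ m.

Lemma power_sum_ge0 w y : 0 < y -> 0 <= power_sum w y.
Proof. by move=> y0; apply: sumr_ge0 => m _; rewrite exprz_ge0// ltW. Qed.

Lemma power_sum_le w y : 1 <= y ->
  power_sum w y <= (size (zrange (2 - w%:Z) (w%:Z - 3)))%:R * y ^+ w.
Proof.
move=> y1; have y0 : 0 < y by apply: lt_le_trans y1.
rewrite /power_sum big_seq; apply: (@le_trans _ _ (\sum_(m <- zrange (2 - w%:Z) (w%:Z - 3) | m \in zrange (2 - w%:Z) (w%:Z - 3)) y ^+ w)).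
  apply: ler_sum => m; rewrite mem_zrange => /andP[_ hm].
  by rewrite exprnP ler_weXz2l//; lia.
by rewrite -big_seq big_const_seq count_predT iter_addr_0 mulr_natl.
Qed.

Lemma mode_term_le w f t N A E : 0 < t -> (forall m, `|f N m| <= A%:R * N%:R ^+ E) ->
  `|mode_term w f t N| <=
  A%:R * power_sum w (4 * pi * t) * (N%:R ^+ E * expR (- (4 * pi * t * N%:R))).
Proof.
move=> t0 fA; have y0 : 0 < 4 * pi * t by rewrite !mulr_gt0 ?pi_gt0.
rewrite /mode_term normrM ger0_norm ?expR_ge0// [4 * pi * t * N%:R]mulrC.
have h : `|\sum_(m <- zrange (2 - w%:Z) (w%:Z - 3)) ratr (f N m) * (4 * pi * t) ^ m| <=
    A%:R * N%:R ^+ E * power_sum w (4 * pi * t).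
  apply: (le_trans (ler_norm_sum _ _ _)); rewrite /power_sum mulr_sumr; apply: ler_sum => m _.
  rewrite normrM [`|_ ^ m|]gtr0_norm ?exprz_gt0// ler_wpM2r//; first by rewrite exprz_ge0// ltW.
  move: (fA m); rewrite -(ler_rat R) rmorphM rmorphXn /= !ratr_nat.
  by apply: le_trans; rewrite ratr_norm.
apply: (le_trans (ler_wpM2l (expR_ge0 _) h)).
by rewrite le_eqVlt; apply/orP; left; apply/eqP; ring.
Qed.

Lemma mode_series_cvg w f t A E : 0 < t ->
  (forall N m, `|f N.+1 m| <= A%:R * N.+1%:R ^+ E) ->
  cvgn (series (fun N => mode_term w f t N.+1)).
Proof.
move=> t0 fA; apply: (cvg_series_dom (fun N => mode_term_le w t0 (fA N))).
by apply: cvg_seriesZ; apply: cvg_pow_exp; rewrite !mulr_gt0 ?pi_gt0.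
Qed.

(** exp(y/(2w)) >= y/(2w), raised to the power w. *)
Lemma expr_expR_le w y : (0 < w)%N -> 0 <= y -> y ^+ w * expR (- (y / 2)) <= (2 * w)%:R ^+ w.
Proof.
move=> w0 y0; have k0 : 0 < (2 * w)%:R :> R by rewrite ltr0n; lia.
rewrite expRN ler_pdivrMr ?expR_gt0// mulrC -ler_pdivrMr ?exprn_gt0// -expr_div_n.
apply: (@le_trans _ _ (expR (y / (2 * w)%:R) ^+ w)).
  rewrite lerXn2r ?nnegrE ?expR_ge0//; first by rewrite divr_ge0// ltW.
  by have := expR_ge1Dx (y / (2 * w)%:R); lra.
rewrite -expRM_natl ler_expR natrM.
have w1 : (w%:R : R) != 0 by rewrite pnatr_eq0; lia.
by rewrite le_eqVlt; apply/orP; left; apply/eqP; field.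
Qed.

Lemma mode_series_decay w f A E : (0 < w)%N ->
  (forall N m, `|f N.+1 m| <= A%:R * N.+1%:R ^+ E) ->
  exponentially_decaying (fun t : R => limn (series (fun N => mode_term w f t N.+1))).
Proof.
move=> w0 fA; have p0 := pi_gt0 R.
pose u N : R := N.+1%:R ^+ E * expR (- (pi * N.+1%:R)).
have cu : cvgn (series u) by exact: cvg_pow_exp.
pose k : R := A%:R * ((size (zrange (2 - w%:Z) (w%:Z - 3)))%:R * (2 * w)%:R ^+ w).
exists pi, (k * limn (series u)); split=> //.
near=> t; have t1 : 1 <= t by near: t; apply: nbhs_pinfty_ge; exact: num_real.
have t0 : 0 < t by apply: lt_le_trans t1.
have bd N : `|mode_term w f t N.+1| <= k * expR (- (pi * t)) * u N.
  apply: (le_trans (mode_term_le w t0 (fA N))).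
  have y1 : 1 <= 4 * pi * t by have := pi_ge2 R; nra.
  have y0 : 0 < 4 * pi * t by apply: lt_le_trans y1.
  have n1 : 1 <= N.+1%:R :> R by rewrite ler1n.
  (* Since 4tN >= 3t + N for t, N >= 1, the exponent splits into three parts: half of 4 pi t to
     absorb the powers of t, pi t for the decay, and pi N for the summation. *)
  have e : expR (- (4 * pi * t * N.+1%:R)) <=
      expR (- (4 * pi * t / 2)) * (expR (- (pi * t)) * expR (- (pi * N.+1%:R))).
    rewrite -!expRD ler_expR; set n := N.+1%:R in n1 *.
    have : pi * (3 * t + n) <= pi * (4 * t * n) by rewrite ler_pM2l//; nra.
    lra.
  have Ey := expr_expR_le w0 (ltW y0).
  have ps := power_sum_le w y1.
  set Y := 4 * pi * t in y1 y0 e Ey ps *; set z := (size _)%:R in ps *.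
  have z0 : 0 <= z by rewrite /z.
  rewrite /u /k -/z.
  apply: (@le_trans _ _ (A%:R * (z * Y ^+ w) * (N.+1%:R ^+ E * (expR (- (Y / 2)) * (expR (- (pi * t)) * expR (- (pi * N.+1%:R))))))).
    rewrite ler_pM ?mulr_ge0 ?power_sum_ge0 ?exprn_ge0 ?expR_ge0//.
      by rewrite ler_wpM2l.
    by rewrite ler_wpM2l ?exprn_ge0.
  have -> : A%:R * (z * Y ^+ w) * (N.+1%:R ^+ E * (expR (- (Y / 2)) * (expR (- (pi * t)) * expR (- (pi * N.+1%:R))))) =
     (Y ^+ w * expR (- (Y / 2))) * (A%:R * z * (expR (- (pi * t)) * (N.+1%:R ^+ E * expR (- (pi * N.+1%:R))))) by ring.
  have -> : A%:R * (z * (2 * w)%:R ^+ w) * expR (- (pi * t)) * (N.+1%:R ^+ E * expR (- (pi * N.+1%:R))) =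
     (2 * w)%:R ^+ w * (A%:R * z * (expR (- (pi * t)) * (N.+1%:R ^+ E * expR (- (pi * N.+1%:R))))) by ring.
  by rewrite ler_wpM2r// !mulr_ge0 ?expR_ge0 ?exprn_ge0.
have cb : cvgn (series (fun N => k * expR (- (pi * t)) * u N)) by exact: cvg_seriesZ.
have := series_tail 0 bd cb; rewrite lim_seriesZ// /series /= !big_geq// !subr0.
by move=> /le_trans; apply; rewrite mulrAC.
Unshelve. all: by end_near. Qed.

Lemma mem_sym_window M (k : int) : (k \in sym_window M) = (absz k <= M)%N.
Proof.
rewrite /sym_window in_cons mem_cat; apply/idP/idP => [/or3P[/eqP->//|/mapP[l]|/mapP[l]]|kM].
- by rewrite mem_iota => lM ->; lia.
- by rewrite mem_iota => lM ->; lia.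
case: k kM => [[|k]|k] kM; apply/or3P; first by constructor 1.
  by constructor 2; apply/mapP; exists k => //; rewrite mem_iota; lia.
by constructor 3; apply/mapP; exists k; [rewrite mem_iota; lia|rewrite NegzE].
Qed.

Lemma mem_box M (n : int * int) : (n \in box M) = (absz n.1 <= M)%N && (absz n.2 <= M)%N.
Proof.
case: n => n1 n2; rewrite /box; apply/allpairsP/idP => [[[x y] [+ + [-> ->]]]|/andP[h1 h2]] /=.
  by rewrite !mem_sym_window => -> ->.
by exists (n1, n2); rewrite !mem_sym_window.
Qed.

Lemma size_box L : size (box L) = ((2 * L).+1 ^ 2)%N.
Proof.
have s : size (sym_window L) = (2 * L).+1.
  by rewrite /sym_window /= size_cat !size_map !size_iota; lia.
by rewrite size_allpairs s mulnn.
Qed.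

Lemma sum_box_support (V : nmodType) (g : int * int -> V) L M :
  (forall n, g n != 0 -> (absz n.1 <= L)%N /\ (absz n.2 <= L)%N) ->
  \sum_(n <- box M) g n = \sum_(n <- [seq n <- box M | n \in box L]) g n.
Proof.
move=> gL; rewrite big_filter [RHS]big_mkcond; apply: eq_bigr => n _.
case: ifPn => //; rewrite mem_box; have [->//|/gL[-> ->]] := eqVneq (g n) 0.
by [].
Qed.

Lemma sum_box_stable (V : nmodType) (g : int * int -> V) L M : (L <= M)%N ->
  (forall n, g n != 0 -> (absz n.1 <= L)%N /\ (absz n.2 <= L)%N) ->
  \sum_(n <- box M) g n = \sum_(n <- box L) g n.
Proof.
move=> LM gL; rewrite (sum_box_support M gL); apply: perm_big.
have [u _] := box_exhausting; apply: uniq_perm; rewrite ?filter_uniq// => n.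
by rewrite mem_filter !mem_box; lia.
Qed.

Lemma sum_box_le (g : int * int -> rat) L M (B : rat) :
  (forall n, g n != 0 -> (absz n.1 <= L)%N /\ (absz n.2 <= L)%N) ->
  (forall n, `|g n| <= B) ->
  `|\sum_(n <- box M) g n| <= ((2 * L).+1 ^ 2)%:R * B.
Proof.
move=> gL gB; rewrite (sum_box_support M gL).
apply: (le_trans (ler_norm_sum _ _ _)); apply: (@le_trans _ _ (\sum_(n <- [seq n <- box M | n \in box L]) B)).
  by apply: ler_sum => n _; exact: gB.
rewrite big_const_seq count_predT iter_addr_0 -[leLHS]mulr_natl; apply: ler_wpM2r.
  exact: le_trans (normr_ge0 _) (gB (0, 0)).
rewrite ler_nat -size_box; apply: uniq_leq_size; last by move=> n; rewrite mem_filter => /andP[].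
by have [u _] := box_exhausting; exact: filter_uniq.
Qed.

Lemma lim_series_sum (I : Type) (s : seq I) (u : I -> nat -> R) :
  (forall i, cvgn (series (u i))) ->
  limn (series (fun N => \sum_(i <- s) u i N)) = \sum_(i <- s) limn (series (u i)).
Proof.
move=> cu; apply: cvg_lim => //; apply: seq_eq (seq_sum (s := s) cu) => N.
by rewrite /series /= exchange_big.
Qed.

Lemma mode_term_sum (I : Type) (s : seq I) (f : I -> nat -> int -> rat) w t N :
  mode_term w (fun N m => \sum_(i <- s) f i N m) t N = \sum_(i <- s) mode_term w (f i) t N.
Proof.
rewrite /mode_term -mulr_sumr exchange_big /=; congr (_ * _); apply: eq_bigr => m _.
by rewrite raddf_sum mulr_suml.
Qed.

Lemma laurent_poly_horner w (L : R -> R) : (0 < w)%N -> laurent_poly (1 - w%:Z) w%:Z L ->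
  exists p : {poly R}, forall t, 0 < t -> L t = p.[t] / t ^+ w.-1.
Proof.
move=> w0 [c hL]; exists (\sum_(k <- zrange (1 - w%:Z) w%:Z) c k *: 'X^(absz (k + w%:Z - 1)%R)) => t t0.
rewrite hL// horner_sum mulr_suml big_seq [RHS]big_seq; apply: eq_bigr => k.
rewrite mem_zrange => hk; rewrite hornerZ hornerXn -mulrA; congr (_ * _).
rewrite exprnP exprnN -expfzDr ?gt_eqF//; congr (_ ^ _); lia.
Qed.

End Assembly.

(** * The decomposition of the constant mode and its uniqueness *)

Lemma constant_mode_decomposition (R : realType) (a1 a2 a3 : nat) :
  (0 < a1)%N -> (0 < a2)%N -> (0 < a3)%N ->
  let w := (a1 + a2 + a3)%N in
  exists (f : nat -> int -> rat) (A E : nat) (q : {poly R}),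
    (forall N m, `|f N.+1 m| <= A%:R * N.+1%:R ^+ E) /\
    forall t : R, 0 < t -> constant_mode a1 a2 a3 t =
      q.[t] / t ^+ w.-1 + limn (series (fun N => mode_term w f t N.+1)).
Proof.
move=> h1 h2 h3 w.
have [P /choice[fn hfn]] := choice (fun n => mode_data R n h1 h2 h3).
pose F M N m := \sum_(n <- box M) fn n N m.
(* By the support property, the coefficient at N no longer changes once the box has size 2N. *)
pose f N m := F (2 * N)%N N m.
(* The box of size 2N has (4N + 1)^2 <= 25 N^2 points, which accounts for the 25 and for the 2 in
   the exponent. *)
pose A := (25 * growth_const w)%N; pose E := (2 + growth_exp w)%N.
have sup N m n : fn n N.+1 m != 0 -> (absz n.1 <= 2 * N.+1)%N /\ (absz n.2 <= 2 * N.+1)%N.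
  by have [_ _ h _] := hfn n; exact: h.
have FA M N m : `|F M N.+1 m| <= A%:R * N.+1%:R ^+ E.
  have le := sum_box_le M (sup N m) (fun n => let: And4 _ h _ _ := hfn n in h N.+1 m (ltn0Sn N)).
  apply: (le_trans le); rewrite -/w.
  have -> : A%:R * N.+1%:R ^+ E = (25 * N.+1 ^ 2)%:R * ((growth_const w)%:R * N.+1%:R ^+ growth_exp w) :> rat.
    by rewrite /A /E exprD !natrM natrX; ring.
  apply: ler_wpM2r; first by rewrite mulr_ge0 ?exprn_ge0.
  by rewrite ler_nat; nia.
have Ff M N m : (2 * N.+1 <= M)%N -> F M N.+1 m = f N.+1 m.
  by move=> NM; exact: sum_box_stable NM (sup N m).
pose X (t : R) := limn (series (fun N => mode_term w f t N.+1)).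
have XM (t : R) : 0 < t -> (fun M => limn (series (fun N => mode_term w (F M) t N.+1))) @ \oo --> X t.
  (* For each N the term is eventually constant in M, and the majorant given by [FA] does not depend
     on M. *)
  move=> t0; apply: (@tannery _ _ _ _ (fun M N => mode_term w (F M) t N.+1) (fun N => mode_term w f t N.+1)
      (fun N => A%:R * power_sum w (4 * pi * t) * (N.+1%:R ^+ E * expR (- (4 * pi * t * N.+1%:R))))).
  - move=> N; apply: cvg_near_cst; near=> M; rewrite /mode_term; congr (_ * _).
    apply: eq_bigr => m _; rewrite Ff//.
    by near: M; exact: nbhs_infty_ge.
  - by apply: nearW => M N; exact: mode_term_le.
  - by apply: cvg_seriesZ; apply: cvg_pow_exp; rewrite !mulr_gt0 ?pi_gt0.
have QM (t : R) : 0 < t ->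
    (fun M => (\sum_(n <- box M) P n).[t]) @ \oo --> t ^+ w.-1 * (constant_mode a1 a2 a3 t - X t).
  move=> t0; have [_ cm] := constant_mode_cvg t0 h1 h2 h3.
  have := seqZ (t ^+ w.-1) (seqD cm (seqZ (-1) (XM t t0))); rewrite mulN1r.
  apply: seq_eq => M; rewrite -/w.
  have eM : limn (series (fun N => mode_term w (F M) t N.+1)) =
      \sum_(n <- box M) limn (series (fun N => mode_term w (fn n) t N.+1)).
    rewrite -lim_series_sum; last by move=> n; have [_ _ _ h] := hfn n; have [] := h t t0.
    by congr (limn (series _)); apply/funext => N; rewrite /F mode_term_sum.
  rewrite eM mulN1r -sumrB horner_sum mulr_sumr; apply: eq_bigr => n _.
  have [_ _ _ h] := hfn n; have [_ ->] := h t t0.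
  by rewrite addrK mulVKf// gt_eqF// exprn_gt0.
have sP M : (size (\sum_(n <- box M) P n)%R <= 2 * w)%N.
  by apply: (big_ind (fun p : {poly R} => size p <= 2 * w)%N) => [|p q sp sq|n _];
    [rewrite size_poly0|rewrite (leq_trans (size_polyD _ _))// geq_max sp|have [] := hfn n].
have [q hq] := poly_limit sP QM.
exists f, A, E, q; split=> [N m|t t0]; first exact: FA.
have tn : t ^+ w.-1 != 0 by rewrite gt_eqF// exprn_gt0.
by rewrite -hq// mulrC mulKf// subrK.
Unshelve. all: by end_near. Qed.

Lemma exponential_part_unique (R : realType) (a1 a2 a3 : nat) (E X : R -> R) (q : {poly R}) :
  let w := (a1 + a2 + a3)%N in (0 < w)%N ->
  is_exponential_part a1 a2 a3 E -> exponentially_decaying X ->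
  (forall t, 0 < t -> constant_mode a1 a2 a3 t = q.[t] / t ^+ w.-1 + X t) ->
  forall t, 0 < t -> E t = X t.
Proof.
move=> w w0 [L [/(laurent_poly_horner w0)[p hp] dE cE]] dX cX.
have eq t : 0 < t -> E t - X t = (q - p).[t] / t ^+ w.-1.
  by move=> t0; have := cE t t0; rewrite cX// hp// hornerD hornerN mulrBl; lra.
have /poly_decay_eq0 qp : exponentially_decaying (fun t => (q - p).[t] / t ^+ w.-1).
  have [c [K [c0 hK]]] := exponentially_decayingB dE dX.
  exists c, K; split=> //; near=> t; rewrite -eq; first by near: t.
  by near: t; exact: nbhs_pinfty_gt.
by move=> t t0; apply/eqP; rewrite -subr_eq0 eq// qp horner0 mul0r.
Unshelve. all: by end_near. Qed.

Theorem theorem1p3 (R : realType) (a1 a2 a3 : nat)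
    (ha1 : (0 < a1)%N) (ha2 : (0 < a2)%N) (ha3 : (0 < a3)%N)
    (E : R -> R) (hE : is_exponential_part a1 a2 a3 E) :
  let w := (a1 + a2 + a3)%N in
  exists (fp fm : nat -> nat -> rat) (f : nat -> nat -> int -> rat),
  forall t : R, 0 < t ->
    let y := 4 * pi * t in
    let term (s n : nat) : R :=
      (ratr (fp s n) * y ^+ s + ratr (fm s n) / y ^+ (s - 1)) * Ei (n%:R * y)
      + expR (- (n%:R * y))
        * \sum_(m <- zrange (2 - w%:Z) (w%:Z - 3)) ratr (f s n m) * y ^ m in
    (forall s : nat, (1 <= s <= w - 2)%N ->
       cvgn (fun N : nat => \sum_(1 <= n < N) term s n)) /\
    E t = \sum_(1 <= s < (w - 2).+1) limn (fun N : nat => \sum_(1 <= n < N) term s n).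
Proof.
move=> w; have w2 : (2 < w)%N by rewrite /w; lia.
have [f [A [e [q [fA cm]]]]] := constant_mode_decomposition R ha1 ha2 ha3.
have w0 : (0 < w)%N by lia.
have EX := exponential_part_unique w0 hE (mode_series_decay R w0 fA) cm.
(* The whole exponential series is placed at s = 1, which is an admissible index because w >= 3. *)
exists (fun _ _ => 0), (fun _ _ => 0), (fun s N m => if s == 1%N then f N m else 0).
move=> t t0 y term.
have term1 N : term 1%N N = mode_term w f t N.
  by rewrite /term /mode_term !rmorph0 !mul0r addr0 mul0r add0r.
have term0 s N : s != 1%N -> term s N = 0.
  move=> /negPf s1; rewrite /term !rmorph0 !mul0r addr0 mul0r add0r s1.
  by rewrite big1 ?mulr0// => m _; rewrite rmorph0 mul0r.
have cv := mode_series_cvg t0 fA.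
have S1 : (fun N : nat => \sum_(1 <= n < N.+1) term 1%N n) = series (fun N => mode_term w f t N.+1).
  apply/funext => N; rewrite /series /= big_add1 /=.
  by apply: eq_bigr => i _; rewrite term1.
(* A sum over 1 <= n < N has N - 1 terms; [cvg_shiftS] accounts for the shift against [series]. *)
have c1 : (fun N : nat => \sum_(1 <= n < N) term 1%N n) @ \oo --> limn (series (fun N => mode_term w f t N.+1)).
  by rewrite -(cvg_shiftS _) S1; exact: cv.
have c0 s : s != 1%N -> (fun N : nat => \sum_(1 <= n < N) term s n) @ \oo --> (0 : R).
  move=> s1; apply: seq_eq (cvg_cst 0) => N.
  by rewrite big1// => i _; exact: term0.
split=> [s _|].
  have [->|s1] := eqVneq s 1%N; apply/cvg_ex; eexists; first exact: c1.
  exact: c0 s1.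
rewrite (EX t t0) big_ltn; last by lia.
rewrite (cvg_lim _ c1)// big_nat_cond big1 ?addr0// => s /andP[/andP[s1 _] _].
by apply: cvg_lim => //; apply: c0; lia.
Qed.
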